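(* Consider learning $\mathrm{FO}^k$ queries over $(\mathbb{Q},<)$: given finite sets $\mathit{P}$ and $\mathit{N}$ of $k$-tuples of rational numbers and a regular tree grammar $\mathcal{G}$ over syntax trees of $\mathrm{FO}^k$ formulas over the signature $\{<\}$, synthesize a formula $\varphi(\overline{x})\in L(\mathcal{G})$ such that $(\mathbb{Q},<),t\models\varphi(\overline{x})$ for every $t\in\mathit{P}$ and $(\mathbb{Q},<),t\not\models\varphi(\overline{x})$ for every $t\in\mathit{N}$, or declare none exists. This problem is decidable in time $\mathcal{O}(2^{\mathrm{poly}(mk^k)}\cdot|\mathcal{G}|)$, where $m=|\mathit{P}|+|\mathit{N}|$.
   Context: $\mathrm{FO}^k$ denotes first-order formulas using only a fixed set of $k$ variables $\overline{x}=(x_1,\dots,x_k)$, built from atoms $x<y$ and $x=y$ (for variables $x,y$), Boolean connectives $\wedge,\vee,\neg$, and quantifiers $\forall x,\exists x$; they are represented as syntax trees over the ranked alphabet with unary symbols $\forall x,\exists x$, nullary atoms, and Boolean symbols. A tuple $t\in\mathbb{Q}^k$ is treated as the assignment of its components to $x_1,\dots,x_k$. $L(\mathcal{G})$ is the tree language of the regular tree grammar $\mathcal{G}$ and $|\mathcal{G}|$ its size. *)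

(* Defs.v *)
From HB Require Import structures.
From mathcomp Require Import all_boot all_order all_algebra.
From Stdlib Require Import Relation_Operators.
From Stdlib Require List.

Set Implicit Arguments.
Unset Strict Implicit.
Unset Printing Implicit Defensive.

(** * FO^k over the signature {<} *)

(* Trees over the ranked alphabet of FO^k, with extra nullary symbols X
   (the set T_Sigma(X) of tree-grammar theory). The variable x_(i+1) is i : 'I_k. *)
Inductive term (k : nat) (X : Type) : Type :=
| Leaf of X
| TLt of 'I_k & 'I_k
| TEq of 'I_k & 'I_k
| TNot of term k X
| TAnd of term k X & term k X
| TOr of term k X & term k X
| TEx of 'I_k & term k X
| TAll of 'I_k & term k X.

Arguments Leaf {k X} _.
Arguments TLt {k X} _ _.
Arguments TEq {k X} _ _.
Arguments TNot {k X} _.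
Arguments TAnd {k X} _ _.
Arguments TOr {k X} _ _.
Arguments TEx {k X} _ _.
Arguments TAll {k X} _ _.

Definition formula (k : nat) : Type := term k void.

Fixpoint map_term k X Y (f : X -> Y) (s : term k X) : term k Y :=
  match s with
  | Leaf x => Leaf (f x)
  | TLt i j => TLt i j
  | TEq i j => TEq i j
  | TNot s1 => TNot (map_term f s1)
  | TAnd s1 s2 => TAnd (map_term f s1) (map_term f s2)
  | TOr s1 s2 => TOr (map_term f s1) (map_term f s2)
  | TEx i s1 => TEx i (map_term f s1)
  | TAll i s1 => TAll i (map_term f s1)
  end.

Fixpoint term_size k X (s : term k X) : nat :=
  match s with
  | Leaf _ | TLt _ _ | TEq _ _ => 1
  | TNot s1 | TEx _ s1 | TAll _ s1 => (term_size s1).+1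
  | TAnd s1 s2 | TOr s1 s2 => (term_size s1 + term_size s2).+1
  end.

Definition upd (A : eqType) (B : Type) (f : A -> B) (a : A) (b : B) : A -> B :=
  fun x => if x == a then b else f x.

Fixpoint sat k (phi : formula k) (v : 'I_k -> rat) : Prop :=
  match phi with
  | Leaf x => match x with end
  | TLt i j => (v i < v j)%R
  | TEq i j => v i = v j
  | TNot phi1 => ~ sat phi1 v
  | TAnd phi1 phi2 => sat phi1 v /\ sat phi2 v
  | TOr phi1 phi2 => sat phi1 v \/ sat phi2 v
  | TEx i phi1 => exists r : rat, sat phi1 (upd v i r)
  | TAll i phi1 => forall r : rat, sat phi1 (upd v i r)
  end.

Definition models k (t : k.-tuple rat) (phi : formula k) : Prop :=
  sat phi (tnth t).

(** * Regular tree grammars *)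

Record grammar (k : nat) : Type := Grammar {
  nnt : nat;
  start : 'I_nnt;
  rules : seq ('I_nnt * term k 'I_nnt)
}.

(* Membership in a list of rules; [term] is not given an [eqType] structure. *)
Definition is_rule k (G : grammar k) (A : 'I_(nnt G)) (s : term k 'I_(nnt G)) :=
  List.In (A, s) (rules G).

(* One derivation step: rewrite one nonterminal leaf by one of its rules. *)
Inductive step k (G : grammar k) :
    term k 'I_(nnt G) -> term k 'I_(nnt G) -> Prop :=
| step_rule A s : is_rule A s -> step (Leaf A) s
| step_not s s' : step s s' -> step (TNot s) (TNot s')
| step_andl s s' u : step s s' -> step (TAnd s u) (TAnd s' u)
| step_andr s s' u : step s s' -> step (TAnd u s) (TAnd u s')
| step_orl s s' u : step s s' -> step (TOr s u) (TOr s' u)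
| step_orr s s' u : step s s' -> step (TOr u s) (TOr u s')
| step_ex i s s' : step s s' -> step (TEx i s) (TEx i s')
| step_all i s s' : step s s' -> step (TAll i s) (TAll i s').

Definition lang k (G : grammar k) (phi : formula k) : Prop :=
  clos_refl_trans _ (@step k G) (Leaf (start G)) (map_term (of_void _) phi).

Definition grammar_size k (G : grammar k) : nat :=
  nnt G + \sum_(r <- rules G) (term_size r.2).+1.

(** * The learning problem *)

Definition solution k (P N : seq (k.-tuple rat)) (G : grammar k)
    (phi : formula k) : Prop :=
  [/\ lang G phi,
      forall t, t \in P -> models t phi
    & forall t, t \in N -> ~ models t phi].

(** * Random access machines

   Uniform-cost RAM programs in structured form: registers and memory cells hold
   natural numbers, addresses may be computed, and the only arithmetic is addition
   and truncated subtraction. Multiplication is left out on purpose: at unit cost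
   it would make the machine unrealistically powerful. The rational numbers of the
   input sit on a separate read-only tape, and all a program can do with them is
   compare two of them, at unit cost. *)

Inductive expr : Type :=
| Const of nat
| Reg of nat
| Deref of expr
| Add of expr & expr
| Sub of expr & expr
| Lt of expr & expr
| Eq of expr & expr
| RatLt of expr & expr.

Inductive cmd : Type :=
| Skip
| Assign of nat & expr
| Store of expr & expr
| Seq of cmd & cmd
| If of expr & cmd & cmd
| While of expr & cmd.

Record state : Type := State {
  regs : nat -> nat;
  mem : nat -> nat
}.

Fixpoint eval (q : seq rat) (s : state) (e : expr) : nat :=
  match e with
  | Const n => n
  | Reg x => regs s x
  | Deref e1 => mem s (eval q s e1)
  | Add e1 e2 => eval q s e1 + eval q s e2
  | Sub e1 e2 => eval q s e1 - eval q s e2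
  | Lt e1 e2 => eval q s e1 < eval q s e2
  | Eq e1 e2 => eval q s e1 == eval q s e2
  | RatLt e1 e2 =>
      (nth 0%R q (eval q s e1) < nth 0%R q (eval q s e2))%R : bool
  end.

Fixpoint expr_cost (e : expr) : nat :=
  match e with
  | Const _ | Reg _ => 1
  | Deref e1 => (expr_cost e1).+1
  | Add e1 e2 | Sub e1 e2 | Lt e1 e2 | Eq e1 e2 | RatLt e1 e2 =>
      (expr_cost e1 + expr_cost e2).+1
  end.

(* [exec q c s s' t]: on rational tape [q], the program [c] started in state [s]
   halts in state [s'] after [t] time units. *)
Inductive exec (q : seq rat) : cmd -> state -> state -> nat -> Prop :=
| exec_skip s : exec q Skip s s 1
| exec_assign x e s :
    exec q (Assign x e) s (State (upd (regs s) x (eval q s e)) (mem s))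
      (expr_cost e).+1
| exec_store e1 e2 s :
    exec q (Store e1 e2) s
      (State (regs s) (upd (mem s) (eval q s e1) (eval q s e2)))
      (expr_cost e1 + expr_cost e2).+1
| exec_seq c1 c2 s s1 s2 t1 t2 :
    exec q c1 s s1 t1 -> exec q c2 s1 s2 t2 ->
    exec q (Seq c1 c2) s s2 (t1 + t2)
| exec_ifT e c1 c2 s s' t :
    eval q s e != 0 -> exec q c1 s s' t ->
    exec q (If e c1 c2) s s' (expr_cost e + t).+1
| exec_ifF e c1 c2 s s' t :
    eval q s e = 0 -> exec q c2 s s' t ->
    exec q (If e c1 c2) s s' (expr_cost e + t).+1
| exec_whileT e c s s1 s2 t1 t2 :
    eval q s e != 0 -> exec q c s s1 t1 -> exec q (While e c) s1 s2 t2 ->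
    exec q (While e c) s s2 (expr_cost e + t1 + t2).+1
| exec_whileF e c s :
    eval q s e = 0 -> exec q (While e c) s s (expr_cost e).+1.

Lemma exec_det q c s s1 t1 s2 t2 :
  exec q c s s1 t1 -> exec q c s s2 t2 -> s1 = s2 /\ t1 = t2.
Proof.
move=> H; move: s2 t2; induction H => s2' t2' H'; inversion H'; subst;
  repeat match goal with
  | IH : forall s t, exec q ?c ?s0 s t -> _, E : exec q ?c ?s0 _ _ |- _ =>
      case: (IH _ _ E) => ? ?; clear IH; subst
  | E : is_true (eval ?q ?s ?e != 0), E0 : eval ?q ?s ?e = 0 |- _ =>
      by rewrite E0 in E
  end; by [].
Qed.

(** * Input and output conventions *)

(* Prefix code of the right-hand side of a rule. *)
Fixpoint code_term k n (s : term k 'I_n) : seq nat :=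
  match s with
  | Leaf A => [:: 0; nat_of_ord A]
  | TLt i j => [:: 1; nat_of_ord i; nat_of_ord j]
  | TEq i j => [:: 2; nat_of_ord i; nat_of_ord j]
  | TNot s1 => 3 :: code_term s1
  | TAnd s1 s2 => 4 :: code_term s1 ++ code_term s2
  | TOr s1 s2 => 5 :: code_term s1 ++ code_term s2
  | TEx i s1 => [:: 6, nat_of_ord i & code_term s1]
  | TAll i s1 => [:: 7, nat_of_ord i & code_term s1]
  end.

Definition code_input k (P N : seq (k.-tuple rat)) (G : grammar k) : seq nat :=
  [:: k; size P; size N; nnt G; nat_of_ord (start G); size (rules G)] ++
  flatten [seq nat_of_ord r.1 :: code_term r.2 | r <- rules G].

(* Component j of the tuple number i of P ++ N is at position i * k + j. *)
Definition rat_tape k (P N : seq (k.-tuple rat)) : seq rat :=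
  flatten [seq tval t | t <- P ++ N].

(* Input word in the first memory cells, its length in register 0. *)
Definition init_state (w : seq nat) : state :=
  State (upd (fun=> 0) 0 (size w)) (nth 0 w).

(* [stored M a phi]: the syntax tree phi is stored at address a, every node being
   a tag followed by its arguments, where subtrees are given by their addresses.
   Common subtrees may be shared: the smallest formula in L(G) can have a syntax
   tree with exponentially many nodes in |G|, so writing all of them out within a
   time bound linear in |G| is impossible. *)
Fixpoint stored k (M : nat -> nat) (a : nat) (phi : formula k) : Prop :=
  match phi with
  | Leaf x => match x with end
  | TLt i j => [/\ M a = 1, M a.+1 = i & M a.+2 = j]
  | TEq i j => [/\ M a = 2, M a.+1 = i & M a.+2 = j]
  | TNot phi1 => M a = 3 /\ stored M (M a.+1) phi1
  | TAnd phi1 phi2 =>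
      [/\ M a = 4, stored M (M a.+1) phi1 & stored M (M a.+2) phi2]
  | TOr phi1 phi2 =>
      [/\ M a = 5, stored M (M a.+1) phi1 & stored M (M a.+2) phi2]
  | TEx i phi1 => [/\ M a = 6, M a.+1 = i & stored M (M a.+2) phi1]
  | TAll i phi1 => [/\ M a = 7, M a.+1 = i & stored M (M a.+2) phi1]
  end.

(* Register 0 holds 1 and register 1 the address of a solution, or register 0
   holds 0 and there is no solution. *)
Definition correct_answer k (P N : seq (k.-tuple rat)) (G : grammar k)
    (s : state) : Prop :=
  (regs s 0 = 1 /\
     exists phi : formula k, stored (mem s) (regs s 1) phi /\ solution P N G phi)
  \/ (regs s 0 = 0 /\ ~ exists phi : formula k, solution P N G phi).

(* Main.v *)
(** The truth value of a formula of FO^k at an assignment in (Q,<) depends only on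
    the order type of the assignment, and every order type is realised by a map
    from the k variables to {0,...,k-1}. So a formula has a value among the
    2^(k^k) sets of such maps, and the connectives and quantifiers act on values:
    a quantifier over x_i compares maps that agree in order off x_i. It remains
    to compute, for every nonterminal, all the values of its formulas; this is a
    least fixpoint, found by a worklist in which each node of a right-hand side
    is treated again only when a new value of one of its children appears. Each
    value comes with the address of a formula having it, built from the addresses
    kept for the children. When there are no examples a single value suffices,
    which keeps the cost independent of k in that case. *)

From mathcomp Require Import all_boot all_order all_algebra.
From mathcomp Require Import zify.
From Stdlib Require Import Relation_Operators.
From Stdlib Require List.
Require Import Defs.

Set Implicit Arguments.
Unset Strict Implicit.
Unset Printing Implicit Defensive.
Import Order.TTheory GRing.Theory Num.Theory.

(** * A structured language and its compilation *)

(** The difficulty is the factor |G|: the grammar may enter the running time only linearly. Just two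
    loops have a number of turns that depends on it, the parser (one turn per input cell) and the
    worklist (3 V D turns, with V the number of values and D linear in |G|). All other loops make at
    most Z = 2^(m k^k + 1) turns, and a fixed power of Z is again 2 to a polynomial in m k^k; so
    brute force is allowed inside a turn, whose cost is a constant times Z to the nesting depth of
    its loops. Products with D must then be computed by loops over the other factor, and the nodes
    concerned by a new value must be found through linked lists. The only loop of the machine being
    [While], the algorithm is written in a language of bounded loops, where results and costs are
    functions defined by recursion, and a compiler correctness proof transfers both to [exec]. *)

Inductive bop := BAdd | BSub | BLt | BEq | BRat.

(* In [EFold n i b] the body [b] sees the accumulator as variable 0 and the loop
   index as variable 1; [ECall a b c f] evaluates [f] in the environment made of
   the three arguments only. *)
Inductive ex :=
| EC of nat
| EV of nat
| EG of nat
| EM of ex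
| EB of bop & ex & ex
| EIf of ex & ex & ex
| EFold of ex & ex & ex
| ECall of ex & ex & ex & ex.

Inductive stm :=
| SSkip
| SSet of nat & ex
| SSt of ex & ex
| SSeq of stm & stm
| SIf of ex & stm & stm
| SRep of ex & stm.

Definition nglob := 20.

Definition bev (q : seq rat) (o : bop) (x y : nat) : nat :=
  match o with
  | BAdd => x + y
  | BSub => x - y
  | BLt => x < y
  | BEq => x == y
  | BRat => (nth 0%R q x < nth 0%R q y)%R
  end.

Section Semantics.

Variable q : seq rat.

Fixpoint ev (s : state) (r : seq nat) (e : ex) : nat :=
  match e with
  | EC n => n
  | EV i => nth 0 r i
  | EG x => regs s x
  | EM a => mem s (ev s r a)
  | EB o a b => bev q o (ev s r a) (ev s r b)
  | EIf c a b => if ev s r c != 0 then ev s r a else ev s r b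
  | EFold n i b =>
      foldl (fun acc j => ev s [:: acc, j & r] b) (ev s r i) (iota 0 (ev s r n))
  | ECall a b c f => ev s [:: ev s r a; ev s r b; ev s r c] f
  end.

Definition acc_at s r i b j : nat :=
  foldl (fun acc j => ev s [:: acc, j & r] b) (ev s r i) (iota 0 j).

Lemma acc_atS s r i b j :
  acc_at s r i b j.+1 = ev s [:: acc_at s r i b j, j & r] b.
Proof. by rewrite /acc_at -addn1 iotaD foldl_cat. Qed.

(** The constants count the instructions emitted by [comp]. A turn of a fold pays 10 for the test,
    the copy of the accumulator and the increment of the index; the 8 outside pays for the initial
    index, the failing test and the final copy. *)
Fixpoint ecost (s : state) (r : seq nat) (e : ex) : nat :=
  match e with
  | EC _ | EV _ | EG _ => 2
  | EM a => ecost s r a + 3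
  | EB o a b => ecost s r a + ecost s r b + 4
  | EIf c a b =>
      ecost s r c + (if ev s r c != 0 then ecost s r a else ecost s r b) + 2
  | EFold n i b =>
      ecost s r n + ecost s r i + 8 +
      \sum_(j < ev s r n) (ecost s [:: acc_at s r i b j, nat_of_ord j & r] b + 10)
  | ECall a b c f =>
      ecost s r a + ecost s r b + ecost s r c +
      ecost s [:: ev s r a; ev s r b; ev s r c] f + 2
  end.

Definition setr (s : state) x v :=
  State (fun y => if y == x then v else regs s y) (mem s).
Definition setm (s : state) a v := State (regs s) (upd (mem s) a v).

Fixpoint den (c : stm) (s : state) : state :=
  match c with
  | SSkip => s
  | SSet x e => setr s x (ev s [::] e)
  | SSt a e => setm s (ev s [::] a) (ev s [::] e)
  | SSeq c1 c2 => den c2 (den c1 s)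
  | SIf e c1 c2 => if ev s [::] e != 0 then den c1 s else den c2 s
  | SRep e c1 => iter (ev s [::] e) (den c1) s
  end.

Fixpoint scost (c : stm) (s : state) : nat :=
  match c with
  | SSkip => 1
  | SSet x e => ecost s [::] e + 2
  | SSt a e => ecost s [::] a + ecost s [::] e + 3
  | SSeq c1 c2 => scost c1 s + scost c2 (den c1 s)
  | SIf e c1 c2 =>
      ecost s [::] e + (if ev s [::] e != 0 then scost c1 s else scost c2 s) + 2
  | SRep e c1 =>
      ecost s [::] e + 6 +
      \sum_(j < ev s [::] e) (scost c1 (iter j (den c1) s) + 10)
  end.

Definition cbop o :=
  match o with
  | BAdd => Add | BSub => Sub | BLt => Lt | BEq => Eq | BRat => RatLt
  end.

(* Leaves the value in register [d] and changes no register below [d]; variable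
   [i] of the environment lives in register [nth 0 rs i]. *)
Fixpoint comp (rs : seq nat) (d : nat) (e : ex) : cmd :=
  match e with
  | EC n => Assign d (Const n)
  | EV i => Assign d (if i < size rs then Reg (nth 0 rs i) else Const 0)
  | EG x => Assign d (Reg x)
  | EM a => Seq (comp rs d a) (Assign d (Deref (Reg d)))
  | EB o a b =>
      Seq (comp rs d a)
        (Seq (comp rs d.+1 b) (Assign d (cbop o (Reg d) (Reg d.+1))))
  | EIf c a b => Seq (comp rs d c) (If (Reg d) (comp rs d a) (comp rs d b))
  | EFold n i b =>
      Seq (comp rs d n) (Seq (comp rs d.+1 i) (Seq (Assign d.+2 (Const 0))
        (Seq (While (Lt (Reg d.+2) (Reg d))
                (Seq (comp [:: d.+1, d.+2 & rs] d.+3 b)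
                   (Seq (Assign d.+1 (Reg d.+3))
                      (Assign d.+2 (Add (Reg d.+2) (Const 1))))))
             (Assign d (Reg d.+1)))))
  | ECall a b c f =>
      Seq (comp rs d a) (Seq (comp rs d.+1 b) (Seq (comp rs d.+2 c)
        (Seq (comp [:: d; d.+1; d.+2] d.+3 f) (Assign d (Reg d.+3)))))
  end.

Fixpoint scomp (d : nat) (c : stm) : cmd :=
  match c with
  | SSkip => Skip
  | SSet x e => Seq (comp [::] d e) (Assign x (Reg d))
  | SSt a e =>
      Seq (comp [::] d a) (Seq (comp [::] d.+1 e) (Store (Reg d) (Reg d.+1)))
  | SSeq c1 c2 => Seq (scomp d c1) (scomp d c2)
  | SIf e c1 c2 => Seq (comp [::] d e) (If (Reg d) (scomp d c1) (scomp d c2))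
  | SRep e c1 =>
      Seq (comp [::] d e) (Seq (Assign d.+1 (Const 0))
        (While (Lt (Reg d.+1) (Reg d))
           (Seq (scomp d.+2 c1) (Assign d.+1 (Add (Reg d.+1) (Const 1))))))
  end.

Fixpoint ewf (e : ex) : bool :=
  match e with
  | EC _ | EV _ => true
  | EG x => x < nglob
  | EM a => ewf a
  | EB _ a b => ewf a && ewf b
  | EIf a b c | EFold a b c => [&& ewf a, ewf b & ewf c]
  | ECall a b c f => [&& ewf a, ewf b, ewf c & ewf f]
  end.

Fixpoint swf (c : stm) : bool :=
  match c with
  | SSkip => true
  | SSet x e => (x < nglob) && ewf e
  | SSt a e => ewf a && ewf e
  | SSeq c1 c2 => swf c1 && swf c2
  | SIf e c1 c2 => [&& ewf e, swf c1 & swf c2]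
  | SRep e c1 => ewf e && swf c1
  end.

(** Registers from [nglob] on are scratch space of the compiled code, used as a stack, and are left
    unconstrained. *)
Definition refines (s s0 : state) :=
  mem s0 = mem s /\ forall x, x < nglob -> regs s0 x = regs s x.

Definition env_at (s0 : state) (d : nat) (rs r : seq nat) :=
  size rs = size r /\
  forall i, i < size rs -> nth 0 rs i < d /\ regs s0 (nth 0 rs i) = nth 0 r i.

Definition keeps d (s0 s1 : state) :=
  mem s1 = mem s0 /\ forall x, x < d -> regs s1 x = regs s0 x.

Lemma keepsT d s0 s1 s2 : keeps d s0 s1 -> keeps d s1 s2 -> keeps d s0 s2.
Proof.
by case=> m1 h1 [m2 h2]; split=> [|x xd]; [rewrite m2 | rewrite h2 ?h1].
Qed.

Lemma keepsW d d' s0 s1 : d' <= d -> keeps d s0 s1 -> keeps d' s0 s1.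
Proof. by move=> dd [m1 h1]; split=> // x xd; rewrite h1 //; lia. Qed.

Lemma keeps_setr d s0 s1 x v : d <= x -> keeps d s0 s1 ->
  keeps d s0 (State (upd (regs s1) x v) (mem s1)).
Proof.
by move=> dx [m1 h1]; split=> //= y yd; rewrite /upd; case: eqP => [?|_]; [lia|exact: h1].
Qed.

Lemma refines_keeps s s0 s1 d : nglob <= d ->
  keeps d s0 s1 -> refines s s0 -> refines s s1.
Proof.
by move=> gd [m1 h1] [m2 h2]; split=> [|x xd]; [rewrite m1 | rewrite h1 ?h2 //; lia].
Qed.

Lemma env_keeps s0 s1 d d' rs r : d <= d' -> keeps d s0 s1 -> env_at s0 d rs r ->
  env_at s1 d' rs r.
Proof.
move=> dd [m1 h1] [sz h]; split=> // i ilt; have [h3 h4] := h _ ilt.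
by split; [lia | rewrite h1].
Qed.

Definition runs c s0 d v n :=
  exists s1 t, [/\ exec q c s0 s1 t, t <= n, keeps d s0 s1 & regs s1 d = v].

Lemma comp_correct e : forall rs d s s0 r, ewf e -> nglob <= d ->
  refines s s0 -> env_at s0 d rs r ->
  runs (comp rs d e) s0 d (ev s r e) (ecost s r e).
Proof.
elim: e => [n|i|x|a IHa|o a IHa b IHb|c IHc a IHa b IHb|n IHn i IHi b IHb
           |a IHa b IHb c IHc f IHf] rs d s s0 r /= wf gd ref env.
- exists (State (upd (regs s0) d n) (mem s0)), 2; split=> //; first exact: (exec_assign q).
    exact: keeps_setr.
  by rewrite /= /upd eqxx.
- case: env => sz env.
  set e := (X in Assign d X); have Ee : eval q s0 e = nth 0 r i.
    rewrite /e; case: ltnP => h /=; first by case: (env _ h).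
    by rewrite nth_default // -sz.
  have Ec : expr_cost e = 1 by rewrite /e; case: ifP.
  exists (State (upd (regs s0) d (eval q s0 e)) (mem s0)), (expr_cost e).+1.
  split; [exact: exec_assign|by rewrite Ec|exact: keeps_setr|].
  by rewrite /= /upd eqxx.
- exists (State (upd (regs s0) d (eval q s0 (Reg x))) (mem s0)), 2.
  split=> //; [exact: exec_assign|exact: keeps_setr|].
  by rewrite /= /upd eqxx; case: ref => _ ->.
- have [s1 [t [h1 h2 h3 h4]]] := IHa rs d s s0 r wf gd ref env.
  exists (State (upd (regs s1) d (eval q s1 (Deref (Reg d)))) (mem s1)), (t + 3).
  split; [|lia|exact: keeps_setr|].
    by apply: exec_seq h1 _; exact: (exec_assign q).
  by rewrite /= /upd eqxx h4; case: h3 => ->; case: ref => ->.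
- case/andP: wf => wa wb.
  have [s1 [t [h1 h2 h3 h4]]] := IHa rs d s s0 r wa gd ref env.
  have [|s2 [t2 [k1 k2 k3 k4]]] := IHb rs d.+1 s s1 r wb (leqW gd)
    (refines_keeps gd h3 ref); first exact: env_keeps (leqnSn _) h3 env.
  set e := cbop o (Reg d) (Reg d.+1).
  exists (State (upd (regs s2) d (eval q s2 e)) (mem s2)), (t + (t2 + (expr_cost e).+1)).
  split.
  + by apply: exec_seq h1 _; apply: exec_seq k1 _; exact: (exec_assign q).
  + by rewrite /e; case: (o) => /=; lia.
  + by apply: keeps_setr => //; apply: keepsT h3 _; apply: keepsW k3.
  + have E1 : regs s2 d = ev s r a by case: k3 => _ ->.
    by rewrite /= /upd eqxx /e; case: (o) => /=; rewrite E1 k4.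
- case/and3P: wf => wc wa wb.
  have [s1 [t [h1 h2 h3 h4]]] := IHc rs d s s0 r wc gd ref env.
  have ref1 := refines_keeps gd h3 ref.
  have env1 := env_keeps (leqnn d) h3 env.
  case: ifPn => hc.
    have [s2 [t2 [k1 k2 k3 k4]]] := IHa rs d s s1 r wa gd ref1 env1.
    exists s2, (t + (1 + t2).+1); split=> //; [|lia|exact: keepsT h3 _].
    by apply: exec_seq h1 _; apply: exec_ifT k1; rewrite /= h4.
  have [s2 [t2 [k1 k2 k3 k4]]] := IHb rs d s s1 r wb gd ref1 env1.
  exists s2, (t + (1 + t2).+1); split=> //; [|lia|exact: keepsT h3 _].
  by apply: exec_seq h1 _; apply: exec_ifF k1; rewrite /= h4; lia.
- case/and3P: wf => wn wi wb.
  have [s1 [t [h1 h2 h3 h4]]] := IHn rs d s s0 r wn gd ref env.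
  have [|s2 [t2 [k1 k2 k3 k4]]] := IHi rs d.+1 s s1 r wi (leqW gd)
    (refines_keeps gd h3 ref); first exact: env_keeps (leqnSn _) h3 env.
  set s3 := State (upd (regs s2) d.+2 0) (mem s2).
  set W := While _ _.
  (* Induction on the number [m] of remaining turns, since a derivation of [exec] for [While] is
     built from its last test backwards. *)
  have step (m : nat) : m <= ev s r n -> forall s3 : state,
      regs s3 d = ev s r n -> regs s3 d.+1 = acc_at s r i b (ev s r n - m) ->
      regs s3 d.+2 = ev s r n - m -> keeps d s0 s3 ->
    exists s4 t4, [/\ exec q W s3 s4 t4,
      t4 <= 4 + \sum_(ev s r n - m <= j < ev s r n)
         (ecost s [:: acc_at s r i b j, j & r] b + 10), keeps d s0 s4
      & regs s4 d.+1 = acc_at s r i b (ev s r n)].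
    elim: m => [|m IHm] lem {}s3 e0 e1 e2 ks.
      exists s3, 4; split=> //; last by rewrite e1 subn0.
      by apply: exec_whileF; rewrite /= e0 e2 subn0 ltnn.
    set j := ev s r n - m.+1 in e1 e2 *.
    have [|s4 [t4 [l1 l2 l3 l4]]] := IHb [:: d.+1, d.+2 & rs] d.+3 s s3
      [:: acc_at s r i b j, j & r] wb (leqW (leqW (leqW gd))) (refines_keeps gd ks ref).
      case: (env_keeps (leqW (leqW (leqnSn d))) ks env) => sz he.
      by split=> [|[|[|l]]] //=; [rewrite sz | rewrite ltnS; exact: he].
    case: l3 => l3 l5.
    set s5 := State (upd (regs s4) d.+1 (regs s4 d.+3)) (mem s4).
    set s6 := State (upd (regs s5) d.+2 (regs s5 d.+2 + 1)) (mem s5).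
    have ej : j.+1 = ev s r n - m by rewrite /j; lia.
    have [|||||s7 [t7 [m1 m2 m3 m4]]] := IHm _ s6.
    + by lia.
    + by rewrite /= /upd !ifF ?l5 //; apply/eqP; lia.
    + by rewrite /= /upd eqxx ifF ?l4 -?ej ?acc_atS //; apply/eqP; lia.
    + by rewrite /= /upd eqxx ifF ?l5 ?e2 //; [lia|apply/eqP; lia].
    + apply: keeps_setr; first lia.
      apply: keeps_setr; first lia.
      apply: keepsT ks _; split=> // x xd; apply: l5; lia.
    exists s7, (3 + (t4 + (2 + 4)) + t7).+1; split=> //.
      apply: exec_whileT m1; first by rewrite /= e0 e2; lia.
      by apply: exec_seq l1 _; apply: exec_seq; exact: (exec_assign q).
    rewrite big_ltn; last by lia.
    by rewrite -ej in m2 *; lia.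
  have [||||s4 [t4 [m1 m2 m3 m4]]] := step (ev s r n) (leqnn _) s3.
  + by rewrite /= /upd ifF ?(proj2 k3) // ; apply/eqP; lia.
  + by rewrite subnn /= /upd ifF // ; apply/eqP; lia.
  + by rewrite subnn /= /upd eqxx.
  + by apply: keeps_setr; [lia|apply: keepsT h3 _; apply: keepsW k3].
  exists (State (upd (regs s4) d (regs s4 d.+1)) (mem s4)), (t + (t2 + (2 + (t4 + 2)))).
  split.
  + apply: exec_seq h1 _; apply: exec_seq k1 _; apply: exec_seq; first exact: (exec_assign q).
    by apply: exec_seq m1 _; exact: (exec_assign q).
  + rewrite subnn big_mkord in m2.
    by move: m2; set S := \sum_(j < _) _ => m2; lia.
  + exact: keeps_setr.
  + by rewrite /= /upd eqxx m4.
- case/and4P: wf => wa wb wc wf.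
  have [s1 [t [h1 h2 h3 h4]]] := IHa rs d s s0 r wa gd ref env.
  have r1 := refines_keeps gd h3 ref; have v1 := env_keeps (leqnSn _) h3 env.
  have [s2 [t2 [k1 k2 k3 k4]]] := IHb rs d.+1 s s1 r wb (leqW gd) r1 v1.
  have r2 := refines_keeps (leqW gd) k3 r1; have v2 := env_keeps (leqnSn _) k3 v1.
  have [s3 [t3 [l1 l2 l3 l4]]] := IHc rs d.+2 s s2 r wc (leqW (leqW gd)) r2 v2.
  have r3 := refines_keeps (leqW (leqW gd)) l3 r2.
  have [|s4 [t4 [m1 m2 m3 m4]]] := IHf [:: d; d.+1; d.+2] d.+3 s s3
     [:: ev s r a; ev s r b; ev s r c] wf (leqW (leqW (leqW gd))) r3.
    split=> // -[|[|[|]]] //= _; split; try lia.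
    + by rewrite (proj2 l3) ?(proj2 k3).
    + by rewrite (proj2 l3).
  exists (State (upd (regs s4) d (regs s4 d.+3)) (mem s4)), (t + (t2 + (t3 + (t4 + 2)))).
  split.
  + apply: exec_seq h1 _; apply: exec_seq k1 _; apply: exec_seq l1 _.
    by apply: exec_seq m1 _; exact: (exec_assign q).
  + by lia.
  + apply: keeps_setr => //; apply: keepsT h3 _; apply: keepsT (keepsW _ k3) _ => //.
    by apply: keepsT (keepsW _ l3) (keepsW _ m3); lia.
  + by rewrite /= /upd eqxx m4.
Qed.

(** Statements, unlike expressions, change registers below [nglob]. What an enclosing loop relies on
    is that its counter and its bound, kept in scratch registers below [d], survive the body. *)
Definition above d (s0 s1 : state) :=
  forall x, nglob <= x -> x < d -> regs s1 x = regs s0 x.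

Definition sruns c s0 d s n :=
  exists s1 t, [/\ exec q c s0 s1 t, t <= n, refines s s1 & above d s0 s1].

Lemma keeps_above d s0 s1 : keeps d s0 s1 -> above d s0 s1.
Proof. by case=> _ h x _ xd; exact: h. Qed.

Lemma aboveT d s0 s1 s2 : above d s0 s1 -> above d s1 s2 -> above d s0 s2.
Proof. by move=> h1 h2 x gx xd; rewrite h2 ?h1. Qed.

Lemma aboveW d d' s0 s1 : d' <= d -> above d s0 s1 -> above d' s0 s1.
Proof. by move=> dd h1 x gx xd; apply: h1; lia. Qed.

Lemma above_setr d s0 s1 x v : (x < nglob) || (d <= x) -> above d s0 s1 ->
  above d s0 (State (upd (regs s1) x v) (mem s1)).
Proof.
move=> dx h1 y gy yd /=; rewrite /upd; case: eqP => [?|_]; last exact: h1.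
by lia.
Qed.

Lemma refines_setr s s0 x v : refines s s0 ->
  refines (setr s x v) (State (upd (regs s0) x v) (mem s0)).
Proof.
case=> h1 h2; split=> //= y yg; rewrite /upd; case: eqP => // _; exact: h2.
Qed.

Lemma refines_temp s s0 x v : nglob <= x -> refines s s0 ->
  refines s (State (upd (regs s0) x v) (mem s0)).
Proof.
move=> gx [h1 h2]; split=> //= y yg; rewrite /upd; case: eqP => [?|_]; last exact: h2.
by lia.
Qed.

Lemma scomp_correct c : forall d s s0, swf c -> nglob <= d -> refines s s0 ->
  sruns (scomp d c) s0 d (den c s) (scost c s).
Proof.
have envE d s0 : env_at s0 d [::] [::] by [].
elim: c => [|x e|a e|c1 IH1 c2 IH2|e c1 IH1 c2 IH2|e c IH] d s s0 /= wf gd ref.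
- by exists s0, 1; split=> //; exact: exec_skip.
- case/andP: wf => xg we.
  have [s1 [t [h1 h2 h3 h4]]] := comp_correct we gd ref (envE _ _).
  exists (State (upd (regs s1) x (regs s1 d)) (mem s1)), (t + 2); split.
  + by apply: exec_seq h1 _; exact: (exec_assign q).
  + by lia.
  + by rewrite h4; apply: refines_setr; apply: refines_keeps ref; eauto.
  + by apply: above_setr; [rewrite xg|exact: keeps_above].
- case/andP: wf => wa we.
  have [s1 [t [h1 h2 h3 h4]]] := comp_correct wa gd ref (envE _ _).
  have r1 := refines_keeps gd h3 ref.
  have [s2 [t2 [k1 k2 k3 k4]]] := comp_correct we (leqW gd) r1 (envE _ _).
  exists (State (regs s2) (upd (mem s2) (regs s2 d) (regs s2 d.+1))), (t + (t2 + 3)).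
  have r2 := refines_keeps (leqW gd) k3 r1.
  split.
  + by apply: exec_seq h1 _; apply: exec_seq k1 _; exact: (exec_store q).
  + by lia.
  + case: r2 => m2 g2; split=> //=; by rewrite k4 (proj2 k3) // h4 m2.
  + by apply: keeps_above (keepsT h3 (keepsW (leqnSn d) k3)).
- case/andP: wf => w1 w2.
  have [s1 [t [h1 h2 h3 h4]]] := IH1 d s s0 w1 gd ref.
  have [s2 [t2 [k1 k2 k3 k4]]] := IH2 d _ s1 w2 gd h3.
  by exists s2, (t + t2); split=> //; [exact: exec_seq k1|lia|exact: aboveT k4].
- case/and3P: wf => we w1 w2.
  have [s1 [t [h1 h2 h3 h4]]] := comp_correct we gd ref (envE _ _).
  have r1 := refines_keeps gd h3 ref.
  case: ifPn => hc.
    have [s2 [t2 [k1 k2 k3 k4]]] := IH1 d s s1 w1 gd r1.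
    exists s2, (t + (1 + t2).+1); split=> //; [|lia|].
      by apply: exec_seq h1 _; apply: exec_ifT k1; rewrite /= h4.
    by apply: aboveT k4; exact: keeps_above.
  have [s2 [t2 [k1 k2 k3 k4]]] := IH2 d s s1 w2 gd r1.
  exists s2, (t + (1 + t2).+1); split=> //; [|lia|].
    by apply: exec_seq h1 _; apply: exec_ifF k1; rewrite /= h4; lia.
  by apply: aboveT k4; exact: keeps_above.
- case/andP: wf => we wc.
  have [s1 [t [h1 h2 h3 h4]]] := comp_correct we gd ref (envE _ _).
  have r1 := refines_keeps gd h3 ref.
  set n := ev s [::] e in h4 *.
  set W := While _ _.
  have step (m : nat) : m <= n -> forall s3 : state,
      regs s3 d = n -> regs s3 d.+1 = n - m -> refines (iter (n - m) (den c) s) s3 ->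
      above d s0 s3 ->
    exists s4 t4, [/\ exec q W s3 s4 t4,
      t4 <= 4 + \sum_(n - m <= j < n) (scost c (iter j (den c) s) + 10),
      refines (iter n (den c) s) s4 & above d s0 s4].
    elim: m => [|m IHm] lem s3 e0 e1 rf ks.
      exists s3, 4; split=> //; last by rewrite subn0 in rf.
      by apply: exec_whileF; rewrite /= e0 e1 subn0 ltnn.
    set j := n - m.+1 in e1 rf *.
    have [s5 [t5 [l1 l2 l3 l5]]] := IH d.+2 _ s3 wc (leqW (leqW gd)) rf.
    set s6 := State (upd (regs s5) d.+1 (regs s5 d.+1 + 1)) (mem s5).
    have ej : j.+1 = n - m by rewrite /j; lia.
    have [|||||s7 [t7 [m1 m2 m3 m4]]] := IHm _ s6.
    + by lia.
    + by rewrite /= /upd !ifF ?l5 //; apply/eqP; lia.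
    + by rewrite /= /upd eqxx l5 //; lia.
    + by rewrite -ej iterS; apply: refines_temp l3; lia.
    + by apply: above_setr; [lia|apply: aboveT ks (aboveW _ l5); lia].
    exists s7, (3 + (t5 + 4) + t7).+1; split=> //.
      apply: exec_whileT m1; first by rewrite /= e0 e1; lia.
      by apply: exec_seq l1 _; exact: (exec_assign q).
    rewrite big_ltn; last by lia.
    by rewrite -ej in m2 *; lia.
  have [||||s4 [t4 [m1 m2 m3 m4]]] := step n (leqnn _) (State (upd (regs s1) d.+1 0) (mem s1)).
  + by rewrite /= /upd ifF ?h4 // ; apply/eqP; lia.
  + by rewrite subnn /= /upd eqxx.
  + by rewrite subnn; apply: refines_temp; [lia|].
  + by apply: above_setr; [lia|exact: keeps_above].
  exists s4, (t + (2 + t4)); split=> //.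
    by apply: exec_seq h1 _; apply: exec_seq m1; exact: (exec_assign q).
  rewrite subnn big_mkord in m2.
  by move: m2; set S := \sum_(j < _) _ => m2; lia.
Qed.

(* [eok Z s r e]: no fold met while evaluating [e] makes more than [Z] turns. *)
Fixpoint eok (Z : nat) (s : state) (r : seq nat) (e : ex) : Prop :=
  match e with
  | EC _ | EV _ | EG _ => True
  | EM a => eok Z s r a
  | EB o a b => eok Z s r a /\ eok Z s r b
  | EIf c a b => eok Z s r c /\ (if ev s r c != 0 then eok Z s r a else eok Z s r b)
  | EFold n i b => [/\ eok Z s r n, eok Z s r i, ev s r n <= Z
      & forall j, j < ev s r n -> eok Z s [:: acc_at s r i b j, j & r] b]
  | ECall a b c f => [/\ eok Z s r a, eok Z s r b, eok Z s r c
      & eok Z s [:: ev s r a; ev s r b; ev s r c] f]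
  end.

(** The 18 of a fold is the 8 of its set-up plus the 10 of each turn in [ecost]. *)
Fixpoint ewt (e : ex) : nat :=
  match e with
  | EC _ | EV _ | EG _ => 2
  | EM a => ewt a + 3
  | EB _ a b => ewt a + ewt b + 4
  | EIf a b c => ewt a + ewt b + ewt c + 2
  | EFold a b c => ewt a + ewt b + ewt c + 18
  | ECall a b c f => ewt a + ewt b + ewt c + ewt f + 2
  end.

Fixpoint edep (e : ex) : nat :=
  match e with
  | EC _ | EV _ | EG _ => 0
  | EM a => edep a
  | EB _ a b => maxn (edep a) (edep b)
  | EIf a b c => maxn (edep a) (maxn (edep b) (edep c))
  | EFold a b c => maxn (edep a) (maxn (edep b) (edep c).+1)
  | ECall a b c f => maxn (edep a) (maxn (edep b) (maxn (edep c) (edep f)))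
  end.

(** A fold of at most [Z] turns multiplies the cost of its body by at most [Z], so the exponent is
    the nesting depth. Weight and depth are syntactic, hence constants for a given program. *)
Lemma ecost_bound Z e : 0 < Z -> forall s r n, eok Z s r e -> edep e <= n ->
  ecost s r e <= ewt e * Z ^ n.
Proof.
move=> Z0.
elim: e => [m|i|x|a IHa|o a IHa b IHb|c IHc a IHa b IHb|n IHn i IHi b IHb
           |a IHa b IHb c IHc f IHf] s r N /=.
1-3: by move=> _ _; rewrite leq_pmulr // expn_gt0 Z0.
all: have P : 0 < Z ^ N by rewrite expn_gt0 Z0.
- by move=> h d; have := IHa s r N h d; nia.
- case=> ha hb; rewrite geq_max => /andP[da db].
  by have := IHa s r N ha da; have := IHb s r N hb db; nia.
- case=> hc hab; rewrite !geq_max => /and3P[dc da db].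
  have := IHc s r N hc dc; case: ifP hab => _ h; [have := IHa s r N h da | have := IHb s r N h db]; nia.
- case=> hn hi hZ hb; rewrite !geq_max => /and3P[dn di].
  case: N P dn di => // N P dn di db; rewrite ltnS in db.
  have := IHn s r _ hn dn; have := IHi s r _ hi di.
  have P' : 0 < Z ^ N by rewrite expn_gt0 Z0.
  have S : \sum_(j < ev s r n) (ecost s [:: acc_at s r i b j, nat_of_ord j & r] b + 10)
     <= (ewt b + 10) * Z ^ N.+1.
    apply: (@leq_trans (\sum_(j < ev s r n) (ewt b + 10) * Z ^ N)).
      apply: leq_sum => j _; rewrite mulnDl leq_add ?leq_pmulr //.
      exact: IHb (hb j (ltn_ord j)) db.
    rewrite sum_nat_const card_ord expnS mulnCA.
    by apply: leq_mul => //; apply: leq_mul.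
  by move: S; set S' := \sum_(j < _) _; nia.
- case=> ha hb hc hf; rewrite !geq_max => /and4P[da db dc df].
  have := IHa s r N ha da; have := IHb s r N hb db; have := IHc s r N hc dc.
  have := IHf _ _ N hf df; nia.
Qed.

Fixpoint sok (Z : nat) (c : stm) (s : state) : Prop :=
  match c with
  | SSkip => True
  | SSet x e => eok Z s [::] e
  | SSt a e => eok Z s [::] a /\ eok Z s [::] e
  | SSeq c1 c2 => sok Z c1 s /\ sok Z c2 (den c1 s)
  | SIf e c1 c2 =>
      eok Z s [::] e /\ (if ev s [::] e != 0 then sok Z c1 s else sok Z c2 s)
  | SRep e c1 => [/\ eok Z s [::] e, ev s [::] e <= Z
      & forall j, j < ev s [::] e -> sok Z c1 (iter j (den c1) s)]
  end.

Fixpoint swt (c : stm) : nat :=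
  match c with
  | SSkip => 1
  | SSet _ e => ewt e + 2
  | SSt a e => ewt a + ewt e + 3
  | SSeq c1 c2 => swt c1 + swt c2
  | SIf e c1 c2 => ewt e + swt c1 + swt c2 + 2
  | SRep e c1 => ewt e + swt c1 + 16
  end.

Fixpoint sdep (c : stm) : nat :=
  match c with
  | SSkip => 0
  | SSet _ e => edep e
  | SSt a e => maxn (edep a) (edep e)
  | SSeq c1 c2 => maxn (sdep c1) (sdep c2)
  | SIf e c1 c2 => maxn (edep e) (maxn (sdep c1) (sdep c2))
  | SRep e c1 => maxn (edep e) (sdep c1).+1
  end.

Lemma scost_bound Z c : 0 < Z -> forall s n, sok Z c s -> sdep c <= n ->
  scost c s <= swt c * Z ^ n.
Proof.
move=> Z0.
elim: c => [|x e|a e|c1 IH1 c2 IH2|e c1 IH1 c2 IH2|e c IH] s N /=.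
all: have P : 0 < Z ^ N by rewrite expn_gt0 Z0.
- by rewrite mul1n.
- by move=> h d; have := ecost_bound Z0 h d; nia.
- case=> ha he; rewrite geq_max => /andP[da de].
  by have := ecost_bound Z0 ha da; have := ecost_bound Z0 he de; nia.
- case=> h1 h2; rewrite geq_max => /andP[d1 d2].
  by have := IH1 _ _ h1 d1; have := IH2 _ _ h2 d2; nia.
- case=> he h; rewrite !geq_max => /and3P[de d1 d2].
  have := ecost_bound Z0 he de.
  by case: ifP h => _ h; [have := IH1 _ _ h d1|have := IH2 _ _ h d2]; nia.
- case=> he hZ h; rewrite !geq_max => /andP[de].
  case: N P de => // N P de d1; rewrite ltnS in d1.
  have := ecost_bound Z0 he de.
  have P' : 0 < Z ^ N by rewrite expn_gt0 Z0.
  have S : \sum_(j < ev s [::] e) (scost c (iter j (den c) s) + 10)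
     <= (swt c + 10) * Z ^ N.+1.
    apply: (@leq_trans (\sum_(j < ev s [::] e) (swt c + 10) * Z ^ N)).
      apply: leq_sum => j _; rewrite mulnDl leq_add ?leq_pmulr //.
      exact: IH (h j (ltn_ord j)) d1.
    rewrite sum_nat_const card_ord expnS mulnCA.
    by apply: leq_mul => //; apply: leq_mul.
  by move: S; set S' := \sum_(j < _) _; nia.
Qed.

Lemma iter_rule (I : nat -> state -> Prop) n f s :
  I 0 s -> (forall j s', j < n -> I j s' -> I j.+1 (f s')) ->
  forall j, j <= n -> I j (iter j f s).
Proof.
by move=> I0 IS; elim=> [|j IH] jn //; apply: IS => //; apply: IH; lia.
Qed.

(** For the loops whose number of turns depends on the grammar: the count stays a factor of its own
    instead of being absorbed in a power of [Z]. *)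
Lemma scost_rep B e c s :
  (forall j, j < ev s [::] e -> scost c (iter j (den c) s) <= B) ->
  scost (SRep e c) s <= ecost s [::] e + 6 + ev s [::] e * (B + 10).
Proof.
move=> h /=; rewrite leq_add2l.
apply: (@leq_trans (\sum_(j < ev s [::] e) (B + 10))).
  by apply: leq_sum => j _; rewrite leq_add2r h.
by rewrite sum_nat_const card_ord.
Qed.

End Semantics.

Fixpoint elf (e : ex) : bool :=
  match e with
  | EC _ | EV _ | EG _ => true
  | EM a => elf a
  | EB _ a b => elf a && elf b
  | EIf a b c => [&& elf a, elf b & elf c]
  | EFold a b c => false
  | ECall a b c f => [&& elf a, elf b, elf c & elf f]
  end.

Fixpoint slf (c : stm) : bool :=
  match c with
  | SSkip => true
  | SSet x e => elf e
  | SSt a e => elf a && elf e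
  | SSeq c1 c2 => slf c1 && slf c2
  | SIf e c1 c2 => [&& elf e, slf c1 & slf c2]
  | SRep e c1 => false
  end.

Lemma elf_ok q Z s e : forall r, elf e -> eok q Z s r e.
Proof.
elim: e => //= [o a IHa b IHb|c IHc a IHa b IHb|a IHa b IHb c IHc f IHf] r.
- by case/andP => ha hb; split; auto.
- by case/and3P => hc ha hb; split; [auto|case: ifP; auto].
- by case/and4P => ha hb hc hf; split; auto.
Qed.

Lemma slf_ok q Z c : forall s, slf c -> sok q Z c s.
Proof.
elim: c => //= [x e|a e|c1 IH1 c2 IH2|e c1 IH1 c2 IH2] s.
- exact: elf_ok.
- by case/andP => ha hb; split; apply: elf_ok.
- by case/andP => h1 h2; split; auto.
- by case/and3P => he h1 h2; split; [exact: elf_ok|case: ifP; auto].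
Qed.

(** * Order types coded by numbers *)

(** Serves twice: in base [k], a number below [k ^ k] codes a map from the variables to {0,...,k-1};
    in base 2, a number below [2 ^ T] codes a set of such numbers. *)
Definition digit b x i := x %/ b ^ i %% b.

Lemma digit_lo b x c n i : 0 < b -> i < n -> digit b (x + c * b ^ n) i = digit b x i.
Proof.
move=> b0 lin; rewrite /digit -(subnK (ltnW lin)) expnD mulnA addnC.
rewrite divnMDl ?expn_gt0 ?b0 // -(subnSK lin) expnS mulnCA (mulnC b) modnMDl //.
Qed.

Lemma digit_hi b x c n : x < b ^ n -> c < b -> digit b (x + c * b ^ n) n = c.
Proof.
move=> xlt cb; have b0 : 0 < b by apply: leq_ltn_trans cb.
by rewrite /digit addnC divnMDl ?expn_gt0 ?b0 // divn_small // addn0 modn_small.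
Qed.

Fixpoint enc b (h : nat -> nat) n :=
  if n is m.+1 then enc b h m + h m * b ^ m else 0.

Lemma enc_lt b h n : (forall i, i < n -> h i < b) -> enc b h n < b ^ n.
Proof.
elim: n => [|n IH] H //=; have := IH (fun i lt => H i (leqW lt)).
have := H n (leqnn _); rewrite expnS; nia.
Qed.

Lemma digit_enc b h n i :
  (forall i, i < n -> h i < b) -> i < n -> digit b (enc b h n) i = h i.
Proof.
elim: n => [|n IH] H //=; rewrite ltnS leq_eqVlt => /orP[/eqP->|lt].
  by apply: digit_hi; [apply: enc_lt => j jn; apply: H; lia | apply: H].
have b0 : 0 < b by apply: leq_ltn_trans (H n _).
by rewrite digit_lo // IH // => j jn; apply: H; lia.
Qed.

(** Written as a left fold to match the loop that the program runs; [bits_enc] gives the form by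
    binary digits that is fit for proofs. *)
Definition bits (p : nat -> bool) T :=
  foldl (fun acc f => if p f then acc + 2 ^ f else acc) 0 (iota 0 T).

Lemma bits_enc p T : bits p T = enc 2 (fun f => p f) T.
Proof.
rewrite /bits; elim: T => [|T IH] //.
rewrite -[in iota _ _]addn1 iotaD foldl_cat IH /= add0n /=.
by case: (p T); rewrite ?mul1n ?mul0n ?addn0.
Qed.

Definition bit v f := digit 2 v f != 0.

Lemma bits_lt p T : bits p T < 2 ^ T.
Proof. by rewrite bits_enc; apply: enc_lt => i _; case: (p i). Qed.

Lemma bit_bits p T f : f < T -> bit (bits p T) f = p f.
Proof.
move=> fT; rewrite /bit bits_enc digit_enc //; first by case: (p f).
by move=> i _; case: (p i).
Qed.

Lemma eq_bits p p' T : (forall f, f < T -> p f = p' f) -> bits p T = bits p' T.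
Proof.
rewrite !bits_enc; elim: T => //= T IH H.
by rewrite H // IH // => f fT; apply: H; lia.
Qed.

Section Types.

Variables k T : nat.

(* The codes [f] and [g] have the same order type off the variable [i]. *)
Definition agree f g i :=
  all (fun a => all (fun b =>
    [|| a == i, b == i |
        (digit k f a < digit k f b) == (digit k g a < digit k g b)])
  (iota 0 k)) (iota 0 k).

(** The tags are those of the input code. Tag 0, a nonterminal leaf, copies the value of the
    nonterminal, which makes such a leaf a unary node like the others. *)
Definition opb tag i j v1 v2 f : bool :=
  match tag with
  | 0 => bit v1 f
  | 1 => digit k f i < digit k f j
  | 2 => digit k f i == digit k f j
  | 3 => ~~ bit v1 f
  | 4 => bit v1 f && bit v2 f
  | 5 => bit v1 f || bit v2 f
  | 6 => has (fun g => bit v1 g && agree f g i) (iota 0 T)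
  | _ => all (fun g => agree f g i ==> bit v1 g) (iota 0 T)
  end.

Definition opv tag i j v1 v2 := bits (opb tag i j v1 v2) T.

(** [T] stays a parameter because the program takes [T = 0] when there are no examples; every
    formula then has value 0. A missing child is given value 0, in accordance with the dummy child
    of the program. *)
Fixpoint val (phi : formula k) : nat :=
  match phi with
  | Leaf x => match x with end
  | TLt i j => opv 1 i j 0 0
  | TEq i j => opv 2 i j 0 0
  | TNot p => opv 3 0 0 (val p) 0
  | TAnd p1 p2 => opv 4 0 0 (val p1) (val p2)
  | TOr p1 p2 => opv 5 0 0 (val p1) (val p2)
  | TEx i p => opv 6 i 0 (val p) 0
  | TAll i p => opv 7 i 0 (val p) 0
  end.

Lemma val_lt phi : val phi < 2 ^ T.
Proof. by case: phi => //= *; exact: bits_lt. Qed.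

Lemma opv_copy phi i j v : opv 0 i j (val phi) v = val phi.
Proof.
have E p : opv 0 i j (bits p T) v = bits p T.
  by rewrite /opv; apply: eq_bits => f fT /=; rewrite bit_bits.
by case: phi => //= *; exact: E.
Qed.

Lemma agreeP f g i :
  reflect (forall a b, a < k -> b < k -> a != i -> b != i ->
             (digit k f a < digit k f b) = (digit k g a < digit k g b))
          (agree f g i).
Proof.
apply: (iffP allP) => [H a b ak bk ai bi|H a].
  have /H/allP/(_ b) : a \in iota 0 k by rewrite mem_iota.
  rewrite mem_iota => /(_ bk).
  by rewrite (negPf ai) (negPf bi) => /eqP.
rewrite mem_iota => /= ak; apply/allP => b; rewrite mem_iota => /= bk.
by case: eqP => //= /eqP ai; case: eqP => //= /eqP bi; rewrite H.
Qed.

End Types.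

(** * Order types in the rationals and the meaning of values *)

Section Rationals.

Variable k : nat.
Local Open Scope ring_scope.
Implicit Types v w : 'I_k -> rat.

Definition same_type v w := forall a b, (v a < v b) = (w a < w b).

Lemma same_typeC v w : same_type v w -> same_type w v.
Proof. by move=> H a b; rewrite H. Qed.

(** The order has no end points, which settles the case of an empty [lo] or [hi], and it is dense,
    which settles the rest. *)
Lemma separate (lo hi : seq rat) :
  (forall x y, x \in lo -> y \in hi -> x < y) ->
  exists r, (forall x, x \in lo -> x < r) /\ (forall y, y \in hi -> r < y).
Proof.
elim: lo hi => [|x lo IH] hi H.
  elim: hi {H} => [|y hi [r [_ H]]]; first by exists 0.
  exists (Num.min r (y - 1)); split=> // z; rewrite inE gt_min => /orP[/eqP->|/H->//].
  by rewrite ltrBlDr ltrDl ltr01 orbT.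
have [|r [H1 H2]] := IH hi.
  by move=> x' y' h1 h2; apply: H => //; rewrite inE h1 orbT.
have [rx|xr] := leP r x; last first.
  by exists r; split=> // z; rewrite inE => /orP[/eqP->|/H1].
(* The old cut [r] does not exceed the new point [x], so a cut between [x] and [hi] is above the
   rest of [lo] as well. *)
have {}H y : y \in hi -> x < y by apply: H; rewrite inE eqxx.
have [r' [h1 h2]] : exists r', x < r' /\ (forall y, y \in hi -> r' < y).
  elim: hi H {H2 IH} => [|y hi IH] H; first by exists (x + 1); rewrite ltrDl.
  have [|r' [h1 h2]] := IH; first by move=> z zh; apply: H; rewrite inE zh orbT.
  have xy : x < y by apply: H; rewrite inE eqxx.
  exists (Num.min r' ((x + y) / 2%:R)); split.
    by rewrite lt_min h1 /= (midf_lt xy).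
  move=> z; rewrite inE gt_min => /orP[/eqP->|/h2->//].
  by rewrite (midf_lt xy) orbT.
exists r'; split=> // z; rewrite inE => /orP[/eqP->|/H1 zr] //.
exact: lt_trans (lt_le_trans zr rx) h1.
Qed.

(* One back-and-forth step in the dense order of the rationals. *)
Lemma extend v w i r :
  (forall a b, a != i -> b != i -> (v a < v b) = (w a < w b)) ->
  exists r', same_type (upd v i r) (upd w i r').
Proof.
move=> H.
(* Either [r] is a value of [v] off [i], answered by the value of [w] at the same variable, or [r]
   lies in a gap between such values, answered by a cut of the corresponding values of [w]. *)
have [[b [bi vb]]|nob] : (exists b, b != i /\ v b = r) \/ (forall b, b != i -> v b != r).
  case: (pickP [pred b | (b != i) && (v b == r)]) => [b /andP[bi /eqP vb]|h].
    by left; exists b.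
  by right=> b bi; have := h b; rewrite inE bi /= => ->.
  exists (w b) => a c; rewrite /upd -vb.
  by case: (eqVneq a i) => ai; case: (eqVneq c i) => ci; rewrite ?ltxx ?H.
pose lo := [seq w b | b <- enum 'I_k & (b != i) && (v b < r)].
pose hi := [seq w b | b <- enum 'I_k & (b != i) && (r < v b)].
have [|r' [h1 h2]] := @separate lo hi.
  move=> x y /mapP[a]; rewrite mem_filter => /andP[/andP[ai ar] _] ->.
  move=> /mapP[b]; rewrite mem_filter => /andP[/andP[bi br] _] ->.
  by rewrite -H //; apply: lt_trans br.
have L b : b != i -> v b < r -> w b < r'.
  by move=> bi br; apply: h1; apply: map_f; rewrite mem_filter bi br mem_enum.
have U b : b != i -> r < v b -> r' < w b.
  by move=> bi br; apply: h2; apply: map_f; rewrite mem_filter bi br mem_enum.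
exists r' => a c; rewrite /upd.
case: (eqVneq a i) => ai; case: (eqVneq c i) => ci; rewrite ?ltxx ?H //.
- have := nob _ ci; case: (ltgtP (v c) r) => // h _; first by rewrite ltNge (ltW (L _ ci h)).
  by rewrite U.
- have := nob _ ai; case: (ltgtP (v a) r) => // h _; first by rewrite L.
  by rewrite ltNge (ltW (U _ ai h)).
Qed.

Lemma same_type_off v w i : same_type v w ->
  forall a b, a != i -> b != i -> (v a < v b) = (w a < w b).
Proof. by move=> H a b _ _; exact: H. Qed.

(** The Ehrenfeucht-Fraisse argument: [extend] answers each quantified point, and the symmetry of
    [same_type] gives both directions from one. *)
Lemma sat_same_type phi v w : same_type v w -> sat phi v <-> sat phi w.
Proof.
elim: phi v w => [[]|i j|i j|p IH|p1 IH1 p2 IH2|p1 IH1 p2 IH2|i p IH|i p IH] v w H /=.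
- by rewrite H.
- suff E : (v i == v j) = (w i == w j).
    by split=> /eqP h; apply/eqP; rewrite ?E // -E.
  by rewrite !eq_le !leNgt !H.
- by rewrite (IH v w).
- by rewrite (IH1 v w) ?(IH2 v w).
- by rewrite (IH1 v w) ?(IH2 v w).
- have E v' w' : same_type v' w' ->
      (exists r, sat p (upd v' i r)) -> exists r, sat p (upd w' i r).
    move=> H' [r hr]; have [r' h] := extend r (same_type_off (i := i) H').
    by exists r'; apply/(IH _ _ h).
  by split; apply: E => //; exact: same_typeC.
- have E v' w' : same_type v' w' ->
      (forall r, sat p (upd v' i r)) -> forall r, sat p (upd w' i r).
    move=> H' hr r.
    have [r' h] := extend r (same_type_off (i := i) (same_typeC H')).
    by apply/(IH _ _ h).
  by split; apply: E => //; exact: same_typeC.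
Qed.

Definition dec f : 'I_k -> rat := fun i => (digit k f i)%:R.

Lemma dec_lt f a b : (dec f a < dec f b) = (digit k f a < digit k f b)%N.
Proof. by rewrite ltr_nat. Qed.

(** A variable is sent to its rank, the number of variables of strictly smaller value; this is below
    [k] because the variable does not count itself. *)
Lemma dec_onto v : exists2 f, (f < k ^ k)%N & same_type (dec f) v.
Proof.
pose h (i : 'I_k) := #|[set b | v b < v i]|.
pose h' n := if insub n is Some i then h i else 0%N.
have hk i : (h i < k)%N.
  rewrite -[X in (_ < X)%N]card_ord -cardsT; apply: proper_card.
  by apply/properP; split; [apply: subsetT | exists i; rewrite ?inE ?ltxx].
have hk' i : (i < k)%N -> (h' i < k)%N by move=> ik; rewrite /h' insubT.
exists (enc k h' k) => [|a b]; first exact: enc_lt.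
have E (c : 'I_k) : digit k (enc k h' k) c = h c.
  by rewrite digit_enc // /h' valK.
rewrite dec_lt !E /h; have [ab|ba] := ltP (v a) (v b).
  apply: proper_card; apply/properP; split.
    by apply/subsetP => c; rewrite !inE => /lt_trans; apply.
  by exists a; rewrite !inE ?ltxx.
apply/negbTE; rewrite -leqNgt; apply: subset_leq_card.
by apply/subsetP => c; rewrite !inE => h1; apply: lt_le_trans ba.
Qed.

(** For the quantifiers, [dec_onto] turns a rational into a code, and [extend] turns a code that
    agrees off [i] into a rational; so ranging over [k ^ k] codes is as good as ranging over all
    rationals. *)
Lemma val_sat phi f : (f < k ^ k)%N -> bit (val (k ^ k) phi) f <-> sat phi (dec f).
Proof.
elim: phi f => [[]|i j|i j|p IH|p1 IH1 p2 IH2|p1 IH1 p2 IH2|i p IH|i p IH] f fk /=;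
  rewrite bit_bits //=.
- by rewrite dec_lt.
- by rewrite /dec; split=> [/eqP->//|/eqP]; rewrite eqr_nat.
- by rewrite -(IH f fk); split=> [/negP|h]; last exact/negP.
- by rewrite -(IH1 f fk) -(IH2 f fk); split=> [/andP|h]; last exact/andP.
- by rewrite -(IH1 f fk) -(IH2 f fk); split=> [/orP|h]; last exact/orP.
- split=> [/hasP[g]|[r hr]].
    rewrite mem_iota => /= gk /andP[bg /agreeP ag].
    have [|r' h] := @extend (dec g) (dec f) i (dec g i).
      by move=> a b ai bi; rewrite !dec_lt ag.
    exists r'; apply/(sat_same_type _ h).
    (* Updating [dec g] at [i] by its own value changes nothing pointwise; [same_type] expresses
       this without an equality of functions. *)
    suff S : same_type (dec g) (upd (dec g) i (dec g i)).
      by apply/(sat_same_type _ S)/IH.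
    by move=> a b; rewrite /upd; case: eqP => [->|_]; case: eqP => [->|_].
  have [g gk hg] := dec_onto (upd (dec f) i r).
  apply/hasP; exists g; first by rewrite mem_iota.
  apply/andP; split; first by apply/IH/(sat_same_type _ hg).
  apply/agreeP => a b ak bk ai bi.
  have := hg (Ordinal ak) (Ordinal bk).
  by rewrite /upd -!val_eqE /= (negPf ai) (negPf bi) !dec_lt /= => ->.
- split=> [/allP H r|H].
    have [g gk hg] := dec_onto (upd (dec f) i r).
    apply/(sat_same_type _ hg)/IH => //.
    have := H g; rewrite mem_iota => /(_ gk)/implyP; apply.
    apply/agreeP => a b ak bk ai bi.
    have := hg (Ordinal ak) (Ordinal bk).
    by rewrite /upd -!val_eqE /= (negPf ai) (negPf bi) !dec_lt /= => ->.
  apply/allP => g; rewrite mem_iota => /= gk; apply/implyP => /agreeP ag.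
  have [|r' h] := @extend (dec g) (dec f) i (dec g i).
    by move=> a b ai bi; rewrite !dec_lt ag.
  have S : same_type (dec g) (upd (dec g) i (dec g i)).
    by move=> a b; rewrite /upd; case: eqP => [->|_]; case: eqP => [->|_].
  by apply/IH => //; apply/(sat_same_type _ S)/(sat_same_type _ h).
Qed.

End Rationals.

(** * Big-step derivations *)

Section Derivations.

Variables (k : nat) (G : grammar k).

(** In this big-step form the derivation of a formula splits into derivations of its subformulas, as
    the records built during saturation do. *)
Inductive der : term k 'I_(nnt G) -> formula k -> Prop :=
| der_leaf A s phi : is_rule A s -> der s phi -> der (Leaf A) phi
| der_lt i j : der (TLt i j) (TLt i j)
| der_eq i j : der (TEq i j) (TEq i j)
| der_not s p : der s p -> der (TNot s) (TNot p)
| der_and s1 s2 p1 p2 : der s1 p1 -> der s2 p2 -> der (TAnd s1 s2) (TAnd p1 p2)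
| der_or s1 s2 p1 p2 : der s1 p1 -> der s2 p2 -> der (TOr s1 s2) (TOr p1 p2)
| der_ex i s p : der s p -> der (TEx i s) (TEx i p)
| der_all i s p : der s p -> der (TAll i s) (TAll i p).

Let emb : formula k -> term k 'I_(nnt G) := map_term (of_void _).
Let steps := clos_refl_trans _ (@step k G).

Lemma steps_congr (F : term k 'I_(nnt G) -> term k 'I_(nnt G)) s s' :
  (forall u u', step u u' -> step (F u) (F u')) -> steps s s' -> steps (F s) (F s').
Proof.
move=> H; elim=> [u u' h|u|u1 u2 u3 _ IH1 _ IH2].
- by apply: rt_step; exact: H.
- exact: rt_refl.
- exact: rt_trans IH1 IH2.
Qed.

Lemma der_steps s phi : der s phi -> steps s (emb phi).
Proof.
elim=> {s phi} [A s phi r _ IH|i j|i j|s p _ IH|s1 s2 p1 p2 _ IH1 _ IH2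
  |s1 s2 p1 p2 _ IH1 _ IH2|i s p _ IH|i s p _ IH] /=.
- by apply: rt_trans IH; apply: rt_step; constructor.
- exact: rt_refl.
- exact: rt_refl.
- by apply: (steps_congr (F := TNot)) IH => *; constructor.
- apply: (@rt_trans _ _ _ (TAnd (emb p1) s2)).
    by apply: (steps_congr (F := fun x => TAnd x s2)) IH1 => *; constructor.
  by apply: (steps_congr (F := fun x => TAnd (emb p1) x)) IH2 => *; constructor.
- apply: (@rt_trans _ _ _ (TOr (emb p1) s2)).
    by apply: (steps_congr (F := fun x => TOr x s2)) IH1 => *; constructor.
  by apply: (steps_congr (F := fun x => TOr (emb p1) x)) IH2 => *; constructor.
- by apply: (steps_congr (F := TEx i)) IH => *; constructor.
- by apply: (steps_congr (F := TAll i)) IH => *; constructor.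
Qed.

Lemma der_refl phi : der (emb phi) phi.
Proof. by elim: phi => [[]|*|*|*|*|*|*|*] /=; constructor. Qed.

(** Lets a rewriting sequence be read from its end: the final formula derives itself by [der_refl],
    and each earlier step is absorbed here. *)
Lemma step_der s s' phi : step s s' -> der s' phi -> der s phi.
Proof.
move=> h; elim: h phi => {s s'} [A s r|s s' h IH|s s' u h IH|s s' u h IH
  |s s' u h IH|s s' u h IH|i s s' h IH|i s s' h IH] phi d.
  exact: der_leaf d.
all: by inversion d; subst; constructor=> //; exact: IH.
Qed.

Lemma steps_der s s' phi : steps s s' -> der s' phi -> der s phi.
Proof.
move=> h; elim: h phi => [u u' /step_der h|u|u1 u2 u3 _ IH1 _ IH2] phi d; auto.
Qed.

Lemma lang_der phi : lang G phi <-> der (Leaf (start G)) phi.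
Proof.
split=> [h|/der_steps//]; exact: steps_der h (der_refl _).
Qed.

End Derivations.

(** * Arithmetic and the operations on values, as expressions *)

Definition eadd := EB BAdd.
Definition esub := EB BSub.
Definition elt := EB BLt.
Definition eeq := EB BEq.

(** The loop runs over the first factor, so only that one has to be at most [Z]; the second may be
    as large as D. The body sees the arguments shifted by two, whence [EV 3] for the second
    factor. *)
Definition mulE := EFold (EV 0) (EC 0) (eadd (EV 0) (EV 3)).
Definition emul a b := ECall a b (EC 0) mulE.
Definition powE := EFold (EV 1) (EC 1) (emul (EV 2) (EV 0)).
Definition epow a b := ECall a b (EC 0) powE.
(** Counts the positive multiples of the divisor up to the dividend, one candidate per turn. A
    divisor 0 gives no turn and the quotient 0, as [%/] does. *)
Definition divE :=
  EFold (EIf (EV 1) (EV 0) (EC 0)) (EC 0)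
    (EIf (elt (EV 2) (emul (eadd (EV 1) (EC 1)) (EV 3)))
       (EV 0) (eadd (EV 0) (EC 1))).
Definition ediv a b := ECall a b (EC 0) divE.
Definition remE := esub (EV 0) (emul (ediv (EV 0) (EV 1)) (EV 1)).
Definition digitE := ECall (ediv (EV 1) (epow (EV 0) (EV 2))) (EV 0) (EC 0) remE.
Definition ebit v f := ECall (EC 2) v f digitE.
Definition edig f i := ECall (EM (EC 0)) f i digitE.

Definition eall n c := EFold n (EC 1) (EIf c (EV 0) (EC 0)).
Definition ehas n c := EFold n (EC 0) (EIf c (EC 1) (EV 0)).

(* Environment: f, g, i *)
Definition agreeE :=
  eall (EM (EC 0)) (eall (EM (EC 0))
    (EIf (eeq (EV 3) (EV 6)) (EC 1)
      (EIf (eeq (EV 1) (EV 6)) (EC 1)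
        (eeq (elt (edig (EV 4) (EV 3)) (edig (EV 4) (EV 1)))
             (elt (edig (EV 5) (EV 3)) (edig (EV 5) (EV 1))))))).

Definition opExE := (* environment: _, g, _, f, u, v1, v2 *)
  EIf (ebit (EV 5) (EV 1))
    (ECall (EV 3) (EV 1) (EM (eadd (EV 4) (EC 1))) agreeE) (EC 0).
Definition opAllE :=
  EIf (ECall (EV 3) (EV 1) (EM (eadd (EV 4) (EC 1))) agreeE)
    (ebit (EV 5) (EV 1)) (EC 1).

(* Environment: _, f, u, v1, v2 *)
Definition opbE :=
  let tag := EM (EV 2) in
  let i := EM (eadd (EV 2) (EC 1)) in
  let j := EM (eadd (EV 2) (EC 2)) in
  let b1 := ebit (EV 3) (EV 1) in
  let b2 := ebit (EV 4) (EV 1) in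
  EIf (eeq tag (EC 0)) b1
  (EIf (eeq tag (EC 1)) (elt (edig (EV 1) i) (edig (EV 1) j))
  (EIf (eeq tag (EC 2)) (eeq (edig (EV 1) i) (edig (EV 1) j))
  (EIf (eeq tag (EC 3)) (eeq b1 (EC 0))
  (EIf (eeq tag (EC 4)) (EIf b1 b2 (EC 0))
  (EIf (eeq tag (EC 5)) (EIf b1 (EC 1) b2)
  (EIf (eeq tag (EC 6)) (ehas (EG 2) opExE)
     (eall (EG 2) opAllE))))))).

(* Environment: u, v1, v2 *)
Definition opE :=
  EFold (EG 2) (EC 0)
    (EIf opbE (eadd (EV 0) (epow (EC 2) (EV 1))) (EV 0)).

(* Environment: f, t *)
Definition typE :=
  eall (EM (EC 0)) (eall (EM (EC 0))
    (eeq (elt (edig (EV 4) (EV 3)) (edig (EV 4) (EV 1)))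
         (EB BRat (eadd (emul (EV 5) (EM (EC 0))) (EV 3))
                  (eadd (emul (EV 5) (EM (EC 0))) (EV 1))))).

(* Environment: v *)
Definition acceptE :=
  eall (eadd (EM (EC 1)) (EM (EC 2))) (eall (EG 2)
    (EIf (ECall (EV 1) (EV 3) (EC 0) typE)
       (eeq (ebit (EV 4) (EV 1)) (elt (EV 3) (EM (EC 1)))) (EC 1))).


Lemma nat_of_bool_neq0 (b : bool) : (nat_of_bool b != 0) = b.
Proof. by case: b. Qed.

Lemma iota0S n : iota 0 n.+1 = iota 0 n ++ [:: n].
Proof. by rewrite -[n.+1]addn1 iotaD. Qed.

Lemma fold_iota (F : nat -> nat) f x0 n :
  F 0 = x0 -> (forall j, j < n -> F j.+1 = f (F j) j) ->
  foldl f x0 (iota 0 n) = F n.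
Proof.
move=> F0; elim: n => [|n IH] H //.
by rewrite iota0S foldl_cat IH ?H // => j jn; apply: H; lia.
Qed.

Lemma fold_all (c : nat -> nat -> nat) p n :
  (forall acc j, j < n -> (c acc j != 0) = p j) ->
  foldl (fun acc j => if c acc j != 0 then acc else 0) 1 (iota 0 n) =
  all p (iota 0 n).
Proof.
move=> H; apply: (fold_iota (F := fun n => all p (iota 0 n))) => // j jn.
by rewrite iota0S all_cat /= H // andbT; case: (p j); rewrite ?andbT ?andbF.
Qed.

Lemma fold_has (c : nat -> nat -> nat) p n :
  (forall acc j, j < n -> (c acc j != 0) = p j) ->
  foldl (fun acc j => if c acc j != 0 then 1 else acc) 0 (iota 0 n) =
  has p (iota 0 n).
Proof.
move=> H; apply: (fold_iota (F := fun n => has p (iota 0 n))) => // j jn.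
by rewrite iota0S has_cat /= H // orbF; case: (p j); rewrite ?orbT ?orbF.
Qed.

Lemma eq_foldl (f g : nat -> nat -> nat) x l :
  (forall a j, f a j = g a j) -> foldl f x l = foldl g x l.
Proof. by move=> H; elim: l x => //= j l IH x; rewrite H IH. Qed.

(** * Values of the expressions, and bounds on their loops *)

Section Spec.

Variable q : seq rat.
Variable s : state.
Variable Z : nat.

Lemma ev_mul x y z : ev q s [:: x; y; z] mulE = x * y.
Proof.
rewrite /mulE /=; apply: (fold_iota (F := fun n => n * y)) => // j _.
by rewrite mulSn addnC.
Qed.

Lemma ok_mul x y z : x <= Z -> eok q Z s [:: x; y; z] mulE.
Proof. by []. Qed.

#[global] Opaque mulE.

Lemma ev_pow x y z : ev q s [:: x; y; z] powE = x ^ y.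
Proof.
rewrite /powE /=; apply: (fold_iota (F := fun n => x ^ n)) => // j _.
by rewrite ev_mul expnS.
Qed.

Lemma ok_pow x y z : (0 < y -> x <= Z) -> y <= Z -> eok q Z s [:: x; y; z] powE.
Proof.
by move=> h ? /=; split=> // j jy; split=> //; apply: ok_mul; apply: h; lia.
Qed.

#[global] Opaque powE.

Lemma ev_div x y z : ev q s [:: x; y; z] divE = x %/ y.
Proof.
rewrite /divE /=; case: y => [|y] /=; first by rewrite divn0.
(* After [n] turns the accumulator has counted the successful candidates among the first [n], which
   are the initial ones. *)
rewrite (fold_iota (F := fun n => minn n (x %/ y.+1))) //.
  by apply/minn_idPr; exact: leq_div.
  by rewrite min0n.
move=> j jx; rewrite ev_mul nat_of_bool_neq0 addn1.
have E : (x < j.+1 * y.+1) = (x %/ y.+1 < j.+1) by rewrite ltn_divLR.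
rewrite E; case: ltnP => h; rewrite /minn; case: ltnP; case: ltnP; lia.
Qed.

Lemma ok_div x y z : x <= Z -> eok q Z s [:: x; y; z] divE.
Proof.
move=> xZ /=; split=> //; first by case: ifP.
  by case: ifP.
move=> j jx; split; last by case: ifP.
split=> //; split=> //; apply: ok_mul; move: jx; case: ifP => _ //=; rewrite ?ltn0 //; lia.
Qed.

#[global] Opaque divE.

Lemma ev_rem x y z : ev q s [:: x; y; z] remE = x %% y.
Proof.
by rewrite /remE /= ev_mul ev_div {1}(divn_eq x y) addnC addnK.
Qed.

Lemma ok_rem x y z : x <= Z -> eok q Z s [:: x; y; z] remE.
Proof.
move=> xZ /=; split=> //; split=> //; first by split=> //; exact: ok_div.
by apply: ok_mul; rewrite ev_div (leq_trans (leq_div _ _)).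
Qed.

#[global] Opaque remE.

Lemma ev_digit b x i : ev q s [:: b; x; i] digitE = digit b x i.
Proof. by rewrite /digitE /= ev_rem ev_div ev_pow. Qed.

Lemma ok_digit b x i : b <= Z -> x <= Z -> i <= Z -> eok q Z s [:: b; x; i] digitE.
Proof.
move=> bZ xZ iZ; rewrite /digitE /=; split; [split|exact: I|exact: I|].
- exact: I.
- by split; [exact: I|exact: I|exact: I|exact: ok_pow].
- exact: I.
- exact: ok_div.
- by apply: ok_rem; rewrite ev_div (leq_trans (leq_div _ _)).
Qed.

#[global] Opaque digitE.

Let k := mem s 0.
Let T := regs s 2.

Lemma ev_agree f g i : ev q s [:: f; g; i] agreeE = agree k f g i.
Proof.
rewrite /agreeE /=; apply: fold_all => acc a _.
rewrite (@fold_all _ (fun b => [|| a == i, b == i |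
        (digit k f a < digit k f b) == (digit k g a < digit k g b)])).
  by rewrite nat_of_bool_neq0.
move=> acc' b _; rewrite !nat_of_bool_neq0 !ev_digit.
case: (a == i) => //=; case: (b == i) => //=.
by rewrite nat_of_bool_neq0; case: (_ < _); case: (_ < _).
Qed.

Lemma ok_agree f g i : k <= Z -> f <= Z -> g <= Z -> eok q Z s [:: f; g; i] agreeE.
Proof.
move=> kZ fZ gZ /=; split=> // a ak; split; last by case: ifP.
split=> // b bk; split; last by case: ifP.
split=> //; case: ifP => _ //; split=> //; case: ifP => _ //.
by do 2!split; split=> //; apply: ok_digit => //; rewrite -/k in ak bk *; lia.
Qed.

#[global] Opaque agreeE.

Lemma ev_op u v1 v2 :
  ev q s [:: u; v1; v2] opE =
  opv k T (mem s u) (mem s (u + 1)) (mem s (u + 2)) v1 v2.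
Proof.
have -> : ev q s [:: u; v1; v2] opE =
    foldl (fun acc f => if ev q s [:: acc; f; u; v1; v2] opbE != 0
                        then acc + ev q s [:: 2; f; 0] powE else acc) 0 (iota 0 T).
  by [].
rewrite /opv /bits.
have E acc f : (ev q s [:: acc; f; u; v1; v2] opbE != 0) =
    opb k T (mem s u) (mem s (u + 1)) (mem s (u + 2)) v1 v2 f.
  rewrite /opbE /=.
  case: (mem s u) => [|[|[|[|[|[|[|n]]]]]]] /=; rewrite ?ev_digit ?nat_of_bool_neq0 //.
  - by rewrite /bit negbK.
  - by rewrite /bit; case: (digit 2 v1 f != 0).
  - by rewrite /bit; case: (digit 2 v1 f != 0).
  - rewrite (@fold_has _ (fun g => bit v1 g && agree k f g (mem s (u + 1)))).
      by rewrite nat_of_bool_neq0.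
    move=> acc' g _; rewrite /opExE /= ev_digit ev_agree /bit.
    by case: (digit 2 v1 g != 0); rewrite ?nat_of_bool_neq0.
  - rewrite (@fold_all _ (fun g => agree k f g (mem s (u + 1)) ==> bit v1 g)).
      by rewrite nat_of_bool_neq0.
    move=> acc' g _; rewrite /opAllE /= ev_digit ev_agree nat_of_bool_neq0 /bit.
    by case: (agree _ _ _ _).
by apply: eq_foldl => acc f; rewrite E ev_pow.
Qed.

(** Only in an atom do the two cells after the tag serve as positions of digits, that is, as loop
    bounds; a quantifier merely compares its variable with loop indices. *)
Definition small_args u :=
  mem s u \in [:: 1; 2] -> mem s (u + 1) <= Z /\ mem s (u + 2) <= Z.

(** The bounds are required for [0 < T] only: without examples the outer loop is empty, and [k] may
    then be larger than [Z]. *)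
Lemma ok_op u v1 v2 : T <= Z ->
  (0 < T -> [/\ 2 <= Z, k <= Z, v1 <= Z, v2 <= Z & small_args u]) ->
  eok q Z s [:: u; v1; v2] opE.
Proof.
move=> TZ h; split=> // f fT.
have {h} [Z2 kZ v1Z v2Z iZ] := h (leq_ltn_trans (leq0n _) fT).
have fZ : f <= Z by apply: leq_trans (ltnW fT) TZ.
move: (acc_at _ _ _ _ _ _) => acc.
have OK w g : w <= Z -> g <= Z -> eok q Z s [:: 2; w; g] digitE by move=> *; apply: ok_digit.
split; last first.
  by case: ifP => // _ /=; split=> //; split=> //; apply: ok_pow.
rewrite /opbE /=; split=> //; case: ifP => [_|t0]; first by split=> //; exact: OK.
split=> //; case: ifP => [t1|_].
  have [iZ1 iZ2] : mem s (u + 1) <= Z /\ mem s (u + 2) <= Z.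
    by apply: iZ; rewrite nat_of_bool_neq0 in t1; rewrite inE t1.
  by do 2!split=> //; apply: ok_digit.
split=> //; case: ifP => [t1|_].
  have [iZ1 iZ2] : mem s (u + 1) <= Z /\ mem s (u + 2) <= Z.
    by apply: iZ; rewrite nat_of_bool_neq0 in t1; rewrite !inE t1 orbT.
  by do 2!split=> //; apply: ok_digit.
split=> //; case: ifP => [t1|_]; first by split=> //; split=> //; exact: OK.
split=> //; case: ifP => [t1|_].
  split; first by split=> //; exact: OK.
  by case: ifP => // _; split=> //; exact: OK.
split=> //; case: ifP => [t1|_].
  split; first by split=> //; exact: OK.
  by case: ifP => // _; split=> //; exact: OK.
split=> //; case: ifP => [t1|_]; split=> // g gT; (split; last by case: ifP).
  have gZ : g <= Z by apply: leq_trans (ltnW gT) TZ.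
  split; first by split=> //; exact: OK.
  by case: ifP => // _; split=> //; exact: ok_agree.
have gZ : g <= Z by apply: leq_trans (ltnW gT) TZ.
split; first by split=> //; exact: ok_agree.
by case: ifP => // _; split=> //; exact: OK.
Qed.

#[global] Opaque opE.

Definition typb f t :=
  all (fun a => all (fun b => (digit k f a < digit k f b) ==
     (nth 0%R q (t * k + a) < nth 0%R q (t * k + b))%R) (iota 0 k)) (iota 0 k).

(** A tuple may have several codes of its order type; the value of a formula has the same bit at all
    of them, so it is no restriction to require the right bit at every one. *)
Definition acceptb v :=
  all (fun t => all (fun f => typb f t ==> (bit v f == (t < mem s 1))) (iota 0 T))
    (iota 0 (mem s 1 + mem s 2)).

Lemma ev_typ f t z : ev q s [:: f; t; z] typE = typb f t.
Proof.
rewrite /typE /=; apply: fold_all => acc a _.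
rewrite (@fold_all _ (fun b => (digit k f a < digit k f b) ==
     (nth 0%R q (t * k + a) < nth 0%R q (t * k + b))%R)).
  by rewrite nat_of_bool_neq0.
move=> acc' b _; rewrite !nat_of_bool_neq0 !ev_digit !ev_mul.
by case: (_ < _); case: (_ < _)%R.
Qed.

Lemma ok_typ f t z : k <= Z -> f <= Z -> t <= Z -> eok q Z s [:: f; t; z] typE.
Proof.
move=> kZ fZ tZ /=; split=> // a ak; split; last by case: ifP.
split=> // b bk; split; last by case: ifP.
split; split=> //.
1,2: by split=> //; apply: ok_digit => //; rewrite -/k in ak bk *; lia.
all: by split=> //; split=> //; exact: ok_mul.
Qed.

#[global] Opaque typE.

Lemma ev_accept v y z : ev q s [:: v; y; z] acceptE = acceptb v.
Proof.
rewrite /acceptE /=; apply: fold_all => acc t _.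
rewrite (@fold_all _ (fun f => typb f t ==> (bit v f == (t < mem s 1)))).
  by rewrite nat_of_bool_neq0.
move=> acc' f _; rewrite ev_typ nat_of_bool_neq0 ev_digit.
case: (typb f t) => //=; rewrite nat_of_bool_neq0 /bit.
have : digit 2 v f < 2 by rewrite /digit ltn_mod.
by case: (digit 2 v f) => [|[|]] //; case: (t < _).
Qed.

Lemma ok_if r c a b : eok q Z s r c ->
  (ev q s r c != 0 -> eok q Z s r a) -> (ev q s r c = 0 -> eok q Z s r b) ->
  eok q Z s r (EIf c a b).
Proof.
by move=> h1 h2 h3 /=; split; [|case: eqP => /= [|/eqP]].
Qed.

Lemma ok_call r a b c f : eok q Z s r a -> eok q Z s r b -> eok q Z s r c ->
  eok q Z s [:: ev q s r a; ev q s r b; ev q s r c] f -> eok q Z s r (ECall a b c f).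
Proof. by []. Qed.

Lemma ok_all r n c : eok q Z s r n -> ev q s r n <= Z ->
  (forall acc j, j < ev q s r n -> eok q Z s [:: acc, j & r] c) ->
  eok q Z s r (eall n c).
Proof.
move=> h1 h2 h3; split; [exact: h1|exact: I|exact: h2|] => j jn.
by apply: ok_if => [|_|_]; [exact: h3|exact: I|exact: I].
Qed.

Lemma ok_accept v y z : mem s 1 + mem s 2 <= Z ->
  (0 < mem s 1 + mem s 2 -> [/\ 2 <= Z, k <= Z, T <= Z & v <= Z]) ->
  eok q Z s [:: v; y; z] acceptE.
Proof.
move=> mZ h; apply: ok_all; [by []|exact: mZ|] => acc t tm.
have {h} [Z2 kZ TZ vZ] := h (leq_ltn_trans (leq0n _) tm).
apply: ok_all; [exact: I|exact: TZ|] => acc' f fT.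
have fZ : f <= Z by apply: leq_trans (ltnW fT) TZ.
have tZ : t <= Z by apply: leq_trans (ltnW tm) mZ.
apply: ok_if => [|_|_]; last exact: I.
  by apply: ok_call; [exact: I|exact: I|exact: I|exact: ok_typ].
split; last by [].
by apply: ok_call; [exact: I|exact: I|exact: I|exact: ok_digit].
Qed.

#[global] Opaque acceptE.

End Spec.

(** * Parsing the grammar *)

Lemma upd_eq (f : nat -> nat) a b x : x = a -> upd f a b x = b.
Proof. by move=> ->; rewrite /upd eqxx. Qed.

Lemma upd_neq (f : nat -> nat) a b x : x <> a -> upd f a b x = f x.
Proof. by rewrite /upd; case: eqP. Qed.

Definition cell D j x := j * D + x.

Ltac rupd := repeat first
  [ rewrite upd_neq; [|by rewrite ?/cell; lia] | rewrite upd_eq; [|by rewrite ?/cell; lia] ].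

(** [j] is a constant of the program, so the product [j * D] is unrolled into [j] additions and
    needs no loop. *)
Definition at_ j e := iter j (eadd (EG 1)) e.

(* With L the length of the input, D = L plus the number of nonterminals and
   H = (6 + V) D, register 0 holds L, 1: D, 2: the number T of maps, 3: the number
   V of values, 4: the parse position, 5: the top of the parse stack, 6: H, 7: the
   node being treated, 8 and 9: the two ends of the queue. A node is named by its
   position in the input, the nonterminal A by L + A; 0 is a dummy child, which
   makes every node binary. The cell at j * D + x holds, for j = 0, the input;
   1 and 2: the children of x; 3: where the values of x go, x itself or a
   nonterminal; 4: the first node with child x; 5: the next such node after x;
   6 + v: the address of a formula for x of value v. The stack starts at H and is
   later overwritten by the queue, in which a formula and x form a record. *)
Definition attach :=
  SIf (eeq (EG 5) (EG 6))
   (SSeq (SSt (at_ 3 (eadd (EG 4) (EC 1))) (eadd (EG 0) (EM (EG 4))))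
         (SSet 4 (eadd (EG 4) (EC 1))))
   (SSeq (SSet 5 (esub (EG 5) (EC 1)))
   (SSeq (SSet 17 (EM (EG 5)))
   (SSeq (SIf (eeq (EM (at_ 1 (EG 17))) (EC 0))
              (SSt (at_ 1 (EG 17)) (EG 4))
              (SSt (at_ 2 (EG 17)) (EG 4)))
   (SSeq (SSt (at_ 3 (EG 4)) (EG 4))
         (SSt (at_ 4 (EG 4)) (EG 17)))))).

(** An inner node is pushed once for each child that it awaits, hence twice for tags 4 and 5. A leaf
    is put at the front of the list of users of its nonterminal, or of the dummy 0 if it is an atom.
    For a quantifier (tag above 5) the parse position also skips the variable index. *)
Definition open :=
  SIf (elt (EM (EG 4)) (EC 3))
   (SSeq (SSet 17 (EIf (eeq (EM (EG 4)) (EC 0))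
                       (eadd (EG 0) (EM (eadd (EG 4) (EC 1)))) (EC 0)))
   (SSeq (SSt (at_ 1 (EG 4)) (EG 17))
   (SSeq (SSt (at_ 5 (EG 4)) (EM (at_ 4 (EG 17))))
   (SSeq (SSt (at_ 4 (EG 17)) (EG 4))
         (SSet 4 (eadd (EG 4) (EIf (eeq (EM (EG 4)) (EC 0)) (EC 2) (EC 3))))))))
   (SSeq (SSt (EG 5) (EG 4))
   (SSeq (SSet 5 (eadd (EG 5) (EC 1)))
   (SSeq (SIf (EIf (eeq (EM (EG 4)) (EC 4)) (EC 1) (eeq (EM (EG 4)) (EC 5)))
              (SSeq (SSt (EG 5) (EG 4)) (SSet 5 (eadd (EG 5) (EC 1)))) SSkip)
         (SSet 4 (eadd (EG 4) (EIf (elt (EC 5) (EM (EG 4))) (EC 2) (EC 1))))))).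

(** Every turn that acts advances the parse position, so as many turns as input cells suffice; the
    test makes the surplus turns idle. *)
Definition parse_body := SIf (elt (EG 4) (EG 0)) (SSeq attach open) SSkip.

Definition at_code (w : seq nat) a (c : seq nat) :=
  forall i, i < size c -> nth 0 w (a + i) = nth 0 c i.

Lemma at_code_cat w a c1 c2 :
  at_code w a (c1 ++ c2) -> at_code w a c1 /\ at_code w (a + size c1) c2.
Proof.
move=> h; split=> i il.
  by have := h i; rewrite size_cat nth_cat il => ->; lia.
have := h (size c1 + i); rewrite size_cat nth_cat addnA => ->; last by lia.
by rewrite ifF; [congr nth; lia|lia].
Qed.

Lemma at_code_cons w a x c :
  at_code w a (x :: c) -> nth 0 w a = x /\ at_code w a.+1 c.
Proof.
move=> h; split; first by rewrite -[a]addn0 h.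
by move=> i il; rewrite addSnnS h.
Qed.

Section Parse.

Variables (q : seq rat) (k n : nat) (w : seq nat) (L D T V H : nat).
Hypotheses (LD : D = L + n) (HD : 6 * D <= H).

Notation term := (term k 'I_n).
Notation den := (den q).
Implicit Types (s : state) (t : term) (U : nat -> seq nat) (m : nat -> nat).

Notation cell := (cell D).

(** The children that can have arbitrarily many users, and so need a linked list: the nonterminals,
    and the dummy 0, child of all atoms. A node of a right-hand side has at most one parent. *)
Definition ntid x := (x == 0) || (L <= x < D).

Fixpoint chain m p (l : seq nat) : Prop :=
  if l is u :: l' then [/\ p = u, 0 < u & chain m (m (cell 5 u)) l'] else p = 0.

Lemma chain_eq m m' p l : (forall u, u \in l -> m' (cell 5 u) = m (cell 5 u)) ->
  chain m p l -> chain m' p l.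
Proof.
elim: l p => //= u l IH p h [-> u0 c]; split=> //.
rewrite h ?inE ?eqxx //; apply: IH => // v vl; apply: h; by rewrite inE vl orbT.
Qed.

(** [U] is a ghost: [U x] is the content of the linked list that starts at the cell 4 of [x]. By
    [pU] the members of the lists lie below the parse position, so writing the link of the node
    being opened breaks no list. *)
Record pst s a stk U : Prop := Pst {
  p0 : regs s 0 = L; p1 : regs s 1 = D; p2 : regs s 2 = T; p3 : regs s 3 = V;
  p6 : regs s 6 = H; p4 : regs s 4 = a; p5 : regs s 5 = H + size stk;
  pin : forall x, x < D -> mem s x = nth 0 w x;
  pW : forall y, 6 * D <= y -> y < H -> mem s y = 0;
  pstk : forall i, i < size stk -> mem s (H + i) = nth 0 stk i;
  pch : forall x, ntid x -> chain (mem s) (mem s (cell 4 x)) (U x);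
  pU : forall x y, ntid x -> y \in U x -> 0 < y < a
}.

Lemma ev_at s r j e : ev q s r (at_ j e) = j * regs s 1 + ev q s r e.
Proof. by elim: j => //= j ->; rewrite mulSn addnA. Qed.

#[local] Opaque at_.

Lemma pst_frame s s' a a' stk stk' U :
  pst s a stk U ->
  [/\ regs s' 0 = regs s 0, regs s' 1 = regs s 1, regs s' 2 = regs s 2,
      regs s' 3 = regs s 3 & regs s' 6 = regs s 6] ->
  regs s' 4 = a' -> regs s' 5 = H + size stk' -> a <= a' -> a <= L ->
  (forall x, x < D -> mem s' x = mem s x) ->
  (forall y, 6 * D <= y -> y < H -> mem s' y = mem s y) ->
  (forall i, i < size stk' -> mem s' (H + i) = nth 0 stk' i) ->
  (forall x, ntid x -> mem s' (cell 4 x) = mem s (cell 4 x)) ->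
  (forall x, 0 < x < a -> mem s' (cell 5 x) = mem s (cell 5 x)) ->
  pst s' a' stk' U.
Proof.
move=> P [R0 R1 R2 R3 R6] R4 R5 aa aL M1 M2 M3 M4 M5; split=> //.
- by rewrite R0 (p0 P).
- by rewrite R1 (p1 P).
- by rewrite R2 (p2 P).
- by rewrite R3 (p3 P).
- by rewrite R6 (p6 P).
- by move=> x xD; rewrite M1 // (pin P).
- by move=> y y1 y2; rewrite M2 // (pW P).
- move=> x xn; rewrite M4 //; apply: chain_eq (pch P xn) => u uU.
  by apply: M5; exact: (pU P xn uU).
- by move=> x y xn yU; have := pU P xn yU; lia.
Qed.

(** Child cells start at 0 and no node has address 0, so a zero in cell 1 tells that the first child
    is still missing. *)
Lemma attach_child s b stk u U :
  pst s b (rcons stk u) U -> 0 < u < b -> b < L ->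
  let c := if mem s (cell 1 u) == 0 then 1 else 2 in
  let s' := den attach s in
  pst s' b stk U /\
  mem s' = upd (upd (upd (mem s) (cell c u) b) (cell 3 b) b) (cell 4 b) u.
Proof.
move=> P ub bL c s'.
have E1 : H + size (rcons stk u) - 1 = H + size stk by rewrite size_rcons; lia.
have E2 : mem s (H + size stk) = u.
  by rewrite (pstk P) ?size_rcons // nth_rcons ltnn eqxx.
have E : s' = State (regs s') (upd (upd (upd (mem s) (cell c u) b) (cell 3 b) b) (cell 4 b) u)
   /\ [/\ regs s' 0 = regs s 0, regs s' 1 = regs s 1, regs s' 2 = regs s 2,
      regs s' 3 = regs s 3 & regs s' 6 = regs s 6]
   /\ (regs s' 4 = b /\ regs s' 5 = H + size stk).
  rewrite /s' /= (p5 P) (p6 P) size_rcons nat_of_bool_neq0 ifF; last by apply/eqP; lia.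
  have -> : H + (size stk).+1 - 1 = H + size stk by lia.
  rewrite nat_of_bool_neq0 !ev_at /= (p1 P) (p4 P) E2.
  rewrite /c /cell; case: eqP => h /=; rewrite ?(p4 P) ?ev_at /= ?(p1 P) ?(p4 P);
    by do ?split; rewrite ?(p6 P).
case: E => Es [R [R4 R5]]; have Em : mem s' = upd (upd (upd (mem s) (cell c u) b) (cell 3 b) b) (cell 4 b) u.
  by rewrite Es.
split=> //.
have c12 : c = 1 \/ c = 2 by rewrite /c; case: eqP; auto.
apply: (pst_frame P) => //; first by lia.
- by move=> x xD; rewrite Em /cell; case: c12 => ->; rupd.
- by move=> y y1 y2; rewrite Em /cell; case: c12 => ->; rupd.
- move=> i il; rewrite Em /cell.
  have := pstk P (i := i); rewrite size_rcons nth_rcons il => <-; last by lia.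
  by case: c12 => ->; rupd.
- move=> x; rewrite /ntid => xn; rewrite Em /cell.
  by case: c12 => ->; rupd.
- by move=> x xn; rewrite Em /cell; case: c12 => ->; rupd.
Qed.

(** A value of the root of a right-hand side is a value of its nonterminal, hence the target
    [L + A]. *)
Lemma attach_root s a A U : pst s a [::] U -> a < L -> a.+1 < L -> nth 0 w a = A ->
  let s' := den attach s in
  pst s' a.+1 [::] U /\ mem s' = upd (mem s) (cell 3 a.+1) (L + A).
Proof.
move=> P aL bL wA s'.
have Em : mem s' = upd (mem s) (cell 3 a.+1) (L + A).
  rewrite /s' /= (p5 P) (p6 P) addn0 eqxx /= !ev_at /= (p1 P) (p4 P) (p0 P).
  by rewrite (pin P) ?wA ?addn1 //; lia.
have ER : regs s' = fun y => if y == 4 then a.+1 else regs s y.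
  by rewrite /s' /= (p5 P) (p6 P) addn0 eqxx /= /setr /= (p4 P) addn1.
split=> //; apply: (pst_frame P); rewrite ?ER //=; try (by lia); try by rewrite (p5 P).
- by move=> x xD; rewrite Em /cell; rupd.
- by move=> x xD h; rewrite Em /cell; rupd.
- by move=> x; rewrite /ntid => xn; rewrite Em /cell; rupd.
- by move=> x xn; rewrite Em /cell; rupd.
Qed.

Lemma open_inner s a stk U tag : pst s a stk U -> a < L -> nth 0 w a = tag -> 2 < tag ->
  let two := (tag == 4) || (tag == 5) in
  let stk' := if two then rcons (rcons stk a) a else rcons stk a in
  let s' := den open s in
  pst s' (a + (if 5 < tag then 2 else 1)) stk' U /\
  forall y, y < H -> mem s' y = mem s y.
Proof.
move=> P aL wa t2 two stk' s'.
have Ea : mem s a = tag by rewrite (pin P) //; lia.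
set m1 := upd (mem s) (H + size stk) a.
have E1 : m1 a = tag by rewrite /m1 upd_neq //; lia.
have Em : mem s' = if two then upd m1 (H + size stk).+1 a else m1.
  rewrite /s' /= (p4 P) Ea nat_of_bool_neq0 ltnNge t2 /= (p5 P) ?(p4 P) -/m1 E1.
  rewrite !nat_of_bool_neq0 /two; case: (tag == 4) => /=.
    by rewrite /= ?(p4 P) ?(p5 P) addn1.
  case: (tag == 5) => /=; last by [].
  by rewrite /= ?(p4 P) ?(p5 P) addn1.
have ER : [/\ regs s' 0 = regs s 0, regs s' 1 = regs s 1, regs s' 2 = regs s 2,
      regs s' 3 = regs s 3 & regs s' 6 = regs s 6] /\
     (regs s' 4 = a + (if 5 < tag then 2 else 1) /\ regs s' 5 = H + size stk').
  rewrite /s' /= (p4 P) Ea nat_of_bool_neq0 ltnNge t2 /= (p5 P) ?(p4 P) -/m1 E1.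
  rewrite !nat_of_bool_neq0 /stk' /two.
  have E2 x : upd m1 (H + size stk + 1) x a = tag by rewrite upd_neq //; lia.
  case: (tag == 4) => /=; last case: (tag == 5) => /=;
    rewrite ?(p4 P) ?(p5 P) -/m1 ?E1 ?E2 ?nat_of_bool_neq0 !size_rcons;
    by split=> //; split; lia.
have F y : y < H -> mem s' y = mem s y.
  by move=> yH; rewrite Em /m1; case: (two); rupd.
split=> //; case: ER => R [R4 R5].
apply: (pst_frame P) => //; try lia.
- by move=> x xD; apply: F; lia.
- by move=> y _ yH; apply: F.
- move=> i; rewrite Em /m1 /stk'; case: (two); rewrite !size_rcons => il.
    have [h|h|h] := ltngtP i (size stk).
    + rewrite !nth_rcons !size_rcons h ifT; last by lia.
      by rewrite -(pstk P) //; rupd.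
    + have -> : i = (size stk).+1 by lia.
      by rewrite nth_rcons size_rcons ltnn eqxx -addnS; rupd.
    + by rewrite h !nth_rcons !size_rcons ltnn eqxx ltnSn; rupd.
  have [h|h|h] := ltngtP i (size stk); last 1 first.
  + by rewrite h nth_rcons ltnn eqxx; rupd.
  + by rewrite nth_rcons h -(pstk P) //; rupd.
  + by lia.
- by move=> x; rewrite /ntid => xn; apply: F; rewrite /cell; lia.
- by move=> x xa; apply: F; rewrite /cell; lia.
Qed.

Lemma open_leaf s a stk U tag :
  pst s a stk U -> 0 < a -> a + (if tag == 0 then 2 else 3) <= L ->
  nth 0 w a = tag -> tag < 3 ->
  let x := if tag == 0 then L + nth 0 w a.+1 else 0 in
  ntid x ->
  let s' := den open s in
  pst s' (a + (if tag == 0 then 2 else 3)) stk (fun y => if y == x then a :: U y else U y) /\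
  mem s' = upd (upd (upd (mem s) (cell 1 a) x) (cell 5 a) (mem s (cell 4 x))) (cell 4 x) a.
Proof.
move=> P a0 aL wa t3 x xn s'.
have aL2 : a.+1 < L by move: aL; case: ifP => _; lia.
have Ea : mem s a = tag by rewrite (pin P) //; lia.
have Ea1 : mem s (a + 1) = nth 0 w a.+1 by rewrite addn1 (pin P) //; lia.
have Em : s' = State (regs s') (mem s') /\ mem s' =
    upd (upd (upd (mem s) (cell 1 a) x) (cell 5 a) (mem s (cell 4 x))) (cell 4 x) a
   /\ [/\ regs s' 0 = regs s 0, regs s' 1 = regs s 1, regs s' 2 = regs s 2,
      regs s' 3 = regs s 3 & regs s' 6 = regs s 6] /\
     (regs s' 4 = a + (if tag == 0 then 2 else 3) /\ regs s' 5 = H + size stk).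
  rewrite /s' /= (p4 P) Ea nat_of_bool_neq0 t3 /=.
  rewrite !ev_at /= (p1 P) (p0 P) ?(p4 P) ?Ea ?Ea1 ?nat_of_bool_neq0 -/x -/(cell 1 a) -/(cell 5 a) -/(cell 4 x).
  have -> : upd (mem s) (cell 1 a) x (cell 4 x) = mem s (cell 4 x).
    by move: xn; rewrite /ntid /cell => xn; rupd.
  set m' := upd _ (cell 4 x) a.
  have -> : m' a = tag by rewrite /m' /cell; rupd.
  by rewrite ?nat_of_bool_neq0 (p5 P).
case: Em => _ [Em [[R0 R1 R2 R3 R6] [R4 R5]]].
split=> //.
have fr y : y < D \/ 6 * D <= y -> mem s' y = mem s y.
  by move=> h; rewrite Em /cell; move: xn; rewrite /ntid => xn; rupd.
split=> //.
- by rewrite R0 (p0 P).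
- by rewrite R1 (p1 P).
- by rewrite R2 (p2 P).
- by rewrite R3 (p3 P).
- by rewrite R6 (p6 P).
- by move=> y yD; rewrite fr ?(pin P) //; left.
- by move=> y y1 y2; rewrite fr ?(pW P) //; right.
- by move=> i il; rewrite fr ?(pstk P) //; right; lia.
- move=> y yn; have F z l : (forall u, u \in l -> 0 < u < a) ->
      chain (mem s) z l -> chain (mem s') z l.
    move=> hl; apply: chain_eq => u ul; rewrite Em.
    by have := hl _ ul; move: xn; rewrite /ntid /cell => xn hu; rupd.
  have FU := F _ _ (fun u => @pU _ _ _ _ P y u yn) (pch P yn).
  rewrite Em; case: eqP => [yx|yx].
    rewrite yx upd_eq //=; split=> //; rewrite -Em.
    have -> : mem s' (cell 5 a) = mem s (cell 4 x).
      by rewrite Em; move: xn; rewrite /ntid /cell => xn; rupd.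
    by rewrite -yx.
  have -> : upd (upd (upd (mem s) (cell 1 a) x) (cell 5 a) (mem s (cell 4 x)))
      (cell 4 x) a (cell 4 y) = mem s (cell 4 y).
    by move: xn yn; rewrite /ntid /cell => xn yn; rupd.
  by rewrite -Em.
- move=> y z yn; case: eqP => _; rewrite ?inE.
    case/orP=> [/eqP->|h]; first by case: ifP; lia.
    by have := pU P yn h; lia.
  by move=> h; have := pU P yn h; lia.
Qed.

End Parse.

(** * The parser on one right-hand side *)

Section ParseTerm.

Variables (q : seq rat) (k n : nat) (w : seq nat) (L D T V H : nat).
Hypotheses (LD : D = L + n) (HD : 6 * D <= H).

Notation term := (term k 'I_n).
Notation den := (den q).
Notation cell := (cell D).
Notation ntid := (ntid L D).
Notation pst := (pst w L D T V H).
Notation chain := (chain D).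
Implicit Types (s : state) (t : term) (U : nat -> seq nat) (m : nat -> nat).

(* [insub a t y t']: when the code of [t] starts at address [a], that of its
   subterm occurrence [t'] starts at [y]. *)
Fixpoint insub a t y t' : Prop :=
  (y = a /\ t' = t) \/
  match t with
  | TNot t1 => insub (a + 1) t1 y t'
  | TAnd t1 t2 | TOr t1 t2 =>
      insub (a + 1) t1 y t' \/ insub (a + 1 + size (code_term t1)) t2 y t'
  | TEx _ t1 | TAll _ t1 => insub (a + 2) t1 y t'
  | _ => False
  end.

Lemma den_if e c1 c2 s :
  den (SIf e c1 c2) s = if ev q s [::] e != 0 then den c1 s else den c2 s.
Proof. by []. Qed.

Lemma den_seq c1 c2 s : den (SSeq c1 c2) s = den c2 (den c1 s).
Proof. by []. Qed.

Definition child m j y x :=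
  [/\ m (cell j y) = x, m (cell 3 x) = x & m (cell 4 x) = y].

Definition local m U y t : Prop :=
  match t with
  | Leaf A => [/\ m (cell 1 y) = L + A, m (cell 2 y) = 0 & y \in U (L + A)]
  | TLt _ _ | TEq _ _ => [/\ m (cell 1 y) = 0, m (cell 2 y) = 0 & y \in U 0]
  | TNot _ => child m 1 y (y + 1) /\ m (cell 2 y) = 0
  | TAnd t1 _ | TOr t1 _ =>
      child m 1 y (y + 1) /\ child m 2 y (y + 1 + size (code_term t1))
  | TEx _ _ | TAll _ _ => child m 1 y (y + 2) /\ m (cell 2 y) = 0
  end.

Lemma code_gt0 t : 0 < size (code_term t).
Proof. by case: t. Qed.

Lemma insub_refl a t : insub a t a t.
Proof. by case: t => *; left. Qed.

Lemma insub_range a t y t' : insub a t y t' ->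
  a <= y /\ y + size (code_term t') <= a + size (code_term t).
Proof.
elim: t a => [A|i j|i j|t1 IH|t1 IH1 t2 IH2|t1 IH1 t2 IH2|i t1 IH|i t1 IH] a /=;
  case=> [[-> ->]|] //=; try by lia.
- by move=> /IH; lia.
- by rewrite size_cat; case=> [/IH1|/IH2]; lia.
- by rewrite size_cat; case=> [/IH1|/IH2]; lia.
- by move=> /IH; lia.
- by move=> /IH; lia.
Qed.

Definition ext U U' (Q : nat -> Prop) :=
  forall x, ntid x -> exists new, U' x = new ++ U x /\ forall y, y \in new -> Q y.

Lemma ext_mem U U' Q x y : ntid x -> ext U U' Q -> y \in U x -> y \in U' x.
Proof. by move=> xn /(_ _ xn)[new [-> _]] h; rewrite mem_cat h orbT. Qed.

Lemma ntid_nt (A : 'I_n) : ntid (L + A).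
Proof. by rewrite /ntid LD; have := ltn_ord A; lia. Qed.

Lemma local_stable m m' U U' Q y t a b : ext U U' Q -> local m U y t ->
  a <= y -> y + size (code_term t) <= b ->
  (forall j x, 0 < j < 6 -> a <= x < b -> m' (cell j x) = m (cell j x)) ->
  local m' U' y t.
Proof.
move=> e l ay yb h.
have c0 x : a <= x < b -> m' (cell 1 x) = m (cell 1 x) by move=> ?; apply: h.
have c1 x : a <= x < b -> m' (cell 2 x) = m (cell 2 x) by move=> ?; apply: h.
have c2 x : a <= x < b -> m' (cell 3 x) = m (cell 3 x) by move=> ?; apply: h.
have c3 x : a <= x < b -> m' (cell 4 x) = m (cell 4 x) by move=> ?; apply: h.
case: t l yb => [A|i j|i j|t1|t1 t2|t1 t2|i t1|i t1] /=.
- move=> [e1 e2 yU] yb; rewrite c0 ?c1 ?e1 ?e2; try lia.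
  by split=> //; apply: ext_mem e yU; exact: ntid_nt.
- move=> [e1 e2 yU] yb; rewrite c0 ?c1 ?e1 ?e2; try lia.
  by split=> //; apply: ext_mem e yU.
- move=> [e1 e2 yU] yb; rewrite c0 ?c1 ?e1 ?e2; try lia.
  by split=> //; apply: ext_mem e yU.
- have := code_gt0 t1 => ? [[e1 e2 e3] e4] yb; split; last by rewrite c1 //; lia.
  by split; rewrite ?c0 ?c2 ?c3 //; lia.
- rewrite size_cat; have := code_gt0 t1; have := code_gt0 t2 => ? ?.
  move=> [[e1 e2 e3] [e4 e5 e6]] yb.
  by split; split; rewrite ?c0 ?c1 ?c2 ?c3 //; lia.
- rewrite size_cat; have := code_gt0 t1; have := code_gt0 t2 => ? ?.
  move=> [[e1 e2 e3] [e4 e5 e6]] yb.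
  by split; split; rewrite ?c0 ?c1 ?c2 ?c3 //; lia.
- have := code_gt0 t1 => ? [[e1 e2 e3] e4] yb; split; last by rewrite c1 //; lia.
  by split; rewrite ?c0 ?c2 ?c3 //; lia.
- have := code_gt0 t1 => ? [[e1 e2 e3] e4] yb; split; last by rewrite c1 //; lia.
  by split; rewrite ?c0 ?c2 ?c3 //; lia.
Qed.

Definition fresh s a b := forall x, a <= x < b ->
  [/\ mem s (cell 1 x) = 0, mem s (cell 2 x) = 0, mem s (cell 5 x) = 0
    & a < x -> mem s (cell 4 x) = 0].

(** The total length of the lists enters the number of worklist turns, so the parser has to keep it
    linear in the input length. *)
Definition total U := \sum_(x < D) size (U x).

(* The cells for links into the node [a] itself are set before its subtree is
   parsed. *)
Definition untouched a b s s' := forall j x, 0 < j < 6 -> 0 < x < L ->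
  (x < a \/ b <= x) \/ (x = a /\ (j = 3 \/ j = 4)) ->
  mem s' (cell j x) = mem s (cell j x).

(** At most one user: the link cell 5 of an inner node is never written, so a list that starts with
    one has length one. *)
Definition headed m y (Q : nat -> Prop) :=
  m (cell 4 y) = 0 \/ (Q (m (cell 4 y)) /\ m (cell 5 (m (cell 4 y))) = 0).

Record parsed a t stk U s s' U' : Prop := Parsed {
  ps_pst : pst s' (a + size (code_term t)) stk U';
  ps_unt : untouched a (a + size (code_term t)) s s';
  ps_loc : forall y t', insub a t y t' -> local (mem s') U' y t';
  ps_head : forall y, a < y < a + size (code_term t) ->
     headed (mem s') y (fun u => exists t', insub a t u t');
  ps_ext : ext U U' (fun y => exists t', insub a t y t');
  ps_tot : total U' <= total U + size (code_term t)
}.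

(** The root has already been attached, in the first half of a turn; hence one [open] before the
    whole turns. *)
Definition parses t := forall s a stk U, pst s a stk U -> 0 < a ->
  a + size (code_term t) <= L -> at_code w a (code_term t) ->
  fresh s a (a + size (code_term t)) ->
  exists (i : nat) U', i < size (code_term t) /\
    parsed a t stk U s (iter i (den parse_body) (den open s)) U'.

Lemma parse_body_in s a stk U : pst s a stk U -> a < L ->
  den parse_body s = den open (den attach s).
Proof.
move=> P aL; have E : ev q s [::] (elt (EG 4) (EG 0)) = 1 by rewrite /= (p4 P) (p0 P) aL.
by rewrite /parse_body den_if E den_seq.
Qed.

Lemma parse_child t s b stk u U : parses t -> pst s b (rcons stk u) U ->
  0 < u < b -> b + size (code_term t) <= L -> at_code w b (code_term t) ->
  fresh s b (b + size (code_term t)) ->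
  let c := if mem s (cell 1 u) == 0 then 1 else 2 in
  exists (i : nat) U' s2, [/\ i <= size (code_term t),
    mem s2 = upd (upd (upd (mem s) (cell c u) b) (cell 3 b) b) (cell 4 b) u &
    parsed b t stk U s2 (iter i (den parse_body) s) U'].
Proof.
move=> Pt P ub bL cb fr c; have := code_gt0 t => t0.
have bL' : b < L by lia.
have [P2 E2] := attach_child q LD HD P ub bL'.
have cc : c = 1 \/ c = 2 by rewrite /c; case: eqP; auto.
have fr2 : fresh (den attach s) b (b + size (code_term t)).
  move=> x xb; have [f1 f2 f3 f4] := fr x xb; rewrite E2 -/c.
  split=> [|||bx]; [rewrite -[RHS]f1|rewrite -[RHS]f2|rewrite -[RHS]f3|rewrite -[RHS](f4 bx)];
    by case: cc => ->; rupd.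
have [||m [U' [ml Pm]]] := Pt _ _ _ _ P2 _ _ cb fr2; [by lia|by []|].
exists m.+1, U', (den attach s); split=> //.
by rewrite iterSr (parse_body_in P bL').
Qed.

Lemma ext_leaf s a stk U x t : pst s a stk U -> ntid x ->
  ext U (fun y => if y == x then a :: U y else U y) (fun y => exists t', insub a t y t').
Proof.
move=> P xn y yn; case: eqP => [->|_]; last by exists [::].
exists [:: a]; split=> // z; rewrite inE => /eqP->.
by exists t; exact: insub_refl.
Qed.

Lemma total_leaf U x a : x < D ->
  total (fun y => if y == x then a :: U y else U y) = (total U).+1.
Proof.
move=> xD; rewrite /total (bigD1 (Ordinal xD)) //= [in RHS](bigD1 (Ordinal xD)) //= eqxx /=.
rewrite addSn; congr (_ + _).+1; apply: eq_bigr => y.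
by rewrite -val_eqE /= => /negPf->.
Qed.

Lemma parse_leaf t tag :
  nth 0 (code_term t) 0 = tag -> tag < 3 ->
  size (code_term t) = (if tag == 0 then 2 else 3) ->
  let x := if tag == 0 then L + nth 0 (code_term t) 1 else 0 in
  ntid x ->
  (forall a y t', insub a t y t' -> y = a /\ t' = t) ->
  (forall m U y, m (cell 1 y) = x -> m (cell 2 y) = 0 -> y \in U x -> local m U y t) ->
  parses t.
Proof.
move=> tE t3 sz x xn ins loc s a stk U P a0 aL ca fr.
have wa : nth 0 w a = tag by have := ca 0; rewrite addn0 tE => -> //; exact: code_gt0.
have wa1 : nth 0 w a.+1 = nth 0 (code_term t) 1.
  by have := ca 1; rewrite addn1 => -> //; rewrite sz; case: ifP.
have sz' : a + (if tag == 0 then 2 else 3) <= L by rewrite -sz.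
have := open_leaf q LD HD P a0 sz' wa t3; rewrite wa1 -/x => /(_ xn) [P' E].
set s1 := den open s in P' E.
exists 0, (fun y => if y == x then a :: U y else U y); split; first exact: code_gt0.
rewrite /iter -/s1; clearbody s1.
have xD : x < D by move: xn; rewrite /ntid; lia.
have aL2 : a < L by move: sz'; case: ifP; lia.
have t2 : 1 < size (code_term t) by rewrite sz; case: ifP.
have [|f1 f2 f3 _] := fr a; first by lia.
have C1 : cell 1 a <> cell 5 a /\ cell 1 a <> cell 4 x by rewrite /cell; move: xn; rewrite /ntid; lia.
split.
- by rewrite sz.
- move=> j y j6 yL cases; rewrite E.
  have ya : y <> a \/ (j = 3 \/ j = 4) by lia.
  move: xn; rewrite /ntid /cell => xn.
  have : j = 1 \/ j = 2 \/ j = 3 \/ j = 4 \/ j = 5 by lia.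
  by case=> [|[|[|[|]]]] ?; subst j; rupd.
- move=> y t' /ins[-> ->]; apply: loc; last by rewrite eqxx inE eqxx.
    by rewrite E; move: xn; rewrite /ntid /cell => xn; rupd.
  by rewrite -[RHS]f2 E; move: xn; rewrite /ntid /cell => xn; rupd.
- move=> y ya; left; have [|_ _ _ f4] := fr y; first by lia.
  rewrite -[RHS]f4; last by lia.
  by rewrite E; move: xn; rewrite /ntid /cell => xn; rupd.
- exact: ext_leaf P xn.
- by rewrite total_leaf //; lia.
Qed.

Lemma parse_unary t t1 tag c0 :
  code_term t = c0 ++ code_term t1 -> nth 0 c0 0 = tag -> 2 < tag ->
  (tag == 4) || (tag == 5) = false ->
  size c0 = (if 5 < tag then 2 else 1) ->
  (forall a y t', insub a t y t' <->
     (y = a /\ t' = t) \/ insub (a + size c0) t1 y t') ->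
  (forall m U y, child m 1 y (y + size c0) -> m (cell 2 y) = 0 -> local m U y t) ->
  parses t1 -> parses t.
Proof.
move=> ct tE t2 t45 sz ins loc P1 s a stk U P a0 aL ca fr.
have c00 : 0 < size c0 by rewrite sz; case: ifP.
have szt : size (code_term t) = size c0 + size (code_term t1) by rewrite ct size_cat.
have t10 := code_gt0 t1.
have wa : nth 0 w a = tag.
  by have := ca 0; rewrite addn0 ct nth_cat c00 tE => -> //; rewrite size_cat; lia.
have aL' : a < L by lia.
have := open_inner q LD HD P aL' wa t2; rewrite t45 -sz => -[P' E].
set s1 := den open s in P' E *.
have [|||b1|m [U' [s2 [ml E2 R]]]] := parse_child P1 P'.
- by lia.
- by lia.
- by move: ca; rewrite ct => /at_code_cat[].
- move=> xb; have [|f1 f2 f3 f4] := fr b1; first by lia.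
  by split=> [||| _]; rewrite E ?f1 ?f2 ?f3 ?f4 //; try (by lia); rewrite /cell; lia.
have C0 : mem s1 (cell 1 a) = 0.
  by have [|f1 _ _ _] := fr a; [lia|rewrite E // /cell; lia].
rewrite C0 eqxx in E2.
have keep j x : 0 < j < 6 -> 0 < x < L -> x < a + size c0 \/ a + size c0 + size (code_term t1) <= x ->
   (x, j) <> (a, 1) -> mem (iter m (den parse_body) s1) (cell j x) = mem s (cell j x).
  move=> j6 xL xo xj; rewrite (ps_unt R) //; last by left; lia.
  have e : cell j x < H by rewrite /cell; nia.
  rewrite -E // E2; have xja : ~ (x = a /\ j = 1) by case=> ? ?; apply: xj; congr pair.
  move: xo xja; rewrite /cell => xo xja.
  have : j = 1 \/ j = 2 \/ j = 3 \/ j = 4 \/ j = 5 by lia.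
  by case=> [|[|[|[|]]]] ?; subst j; rupd.
have inb : 0 < a + size c0 < L by lia.
have cb1 : mem (iter m (den parse_body) s1) (cell 1 a) = a + size c0.
  by rewrite (ps_unt R) ?E2 //; [rewrite /cell; rupd|lia|lia].
have cb3 : mem (iter m (den parse_body) s1) (cell 3 (a + size c0)) = a + size c0.
  by rewrite (ps_unt R) ?E2 //; [rewrite /cell; rupd|lia].
have cb4 : mem (iter m (den parse_body) s1) (cell 4 (a + size c0)) = a.
  by rewrite (ps_unt R) ?E2 //; [rewrite /cell; rupd|lia].
have [|_ f2 f5 _] := fr a; first by lia.
exists m, U'; split; first by lia.
split.
- by rewrite szt addnA; exact: ps_pst R.
- move=> j x j6 xL xo; apply: keep => //; first by lia.
  by case=> *; lia.
- move=> y t' /ins[[-> ->]|]; last by move=> h; exact: (ps_loc R h).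
  apply: loc => //; rewrite keep //; first by lia.
  by left; lia.
- move=> y ya; have [yb|yb|yb] := ltngtP y (a + size c0).
  + left; have [|_ _ _ f4] := fr y; first by lia.
    by rewrite keep ?f4 //; try lia; case=> *; lia.
  + have [|h|[[t' h] h5]] := ps_head R (y := y); first by lia.
      by left.
    by right; split=> //; exists t'; apply/ins; right.
  + right; rewrite yb cb4; split; first by exists t; exact: insub_refl.
    by rewrite keep //; try lia; left; lia.
- move=> x xn; have [new [-> h]] := ps_ext R xn; exists new; split=> // y /h[t' ht].
  by exists t'; apply/ins; right.
- by have := ps_tot R; lia.
Qed.

Lemma parse_binary t t1 t2 tag :
  code_term t = tag :: code_term t1 ++ code_term t2 ->
  (tag == 4) || (tag == 5) ->
  (forall a y t', insub a t y t' <-> (y = a /\ t' = t) \/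
     (insub (a + 1) t1 y t' \/ insub (a + 1 + size (code_term t1)) t2 y t')) ->
  (forall m U y, child m 1 y (y + 1) ->
     child m 2 y (y + 1 + size (code_term t1)) -> local m U y t) ->
  parses t1 -> parses t2 -> parses t.
Proof.
move=> ct t45 ins loc P1 P2 s a stk U P a0 aL ca fr.
have szt : size (code_term t) = (size (code_term t1) + size (code_term t2)).+1.
  by rewrite ct /= size_cat.
have t10 := code_gt0 t1; have t20 := code_gt0 t2.
have [wa /at_code_cat[c1 c2]] : nth 0 w a = tag /\ at_code w a.+1 (code_term t1 ++ code_term t2).
  by apply: at_code_cons; rewrite -ct.
rewrite -addn1 in c1 c2.
have aL' : a < L by lia.
have tt : 2 < tag by case/orP: t45 => /eqP->.
have := open_inner q LD HD P aL' wa tt; rewrite t45.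
have -> : (5 < tag) = false by case/orP: t45 => /eqP->.
move=> [P' E].
set s1 := den open s in P' E *; clearbody s1.
set b := a + 1 in P' c1 c2 *; set z1 := size (code_term t1) in szt t10 c2 *.
have ab : b = a + 1 by [].
have [|||b1|i1 [U1 [s2 [ml E2 R1]]]] := parse_child P1 P'.
- by lia.
- by rewrite -/z1; lia.
- exact: c1.
- rewrite -/z1 => xb; have [|f1 f2 f3 f4] := fr b1; first by lia.
  by split=> [||| _]; rewrite E ?f1 ?f2 ?f3 ?f4 //; try (by lia); rewrite /cell; lia.
have [|f1 f2 f5 _] := fr a; first by lia.
have C0 : mem s1 (cell 1 a) = 0 by rewrite E // /cell; lia.
rewrite C0 eqxx in E2.
set s3 := iter i1 (den parse_body) s1 in R1;
have keep1 j x : 0 < j < 6 -> 0 < x < L -> x < b \/ b + z1 <= x ->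
   (x, j) <> (a, 1) -> mem s3 (cell j x) = mem s (cell j x).
  move=> j6 xL xo xj; rewrite (ps_unt R1) //; last by left; lia.
  have e : cell j x < H by rewrite /cell; nia.
  rewrite -E // E2; have xja : ~ (x = a /\ j = 1) by case=> ? ?; apply: xj; congr pair.
  move: xo xja; rewrite /cell => xo xja.
  have : j = 1 \/ j = 2 \/ j = 3 \/ j = 4 \/ j = 5 by lia.
  by case=> [|[|[|[|]]]] ?; subst j; rupd.
have cb1 : mem s3 (cell 1 a) = b.
  by rewrite (ps_unt R1) ?E2 //; [rewrite /cell; rupd|lia|lia].
have cb3 : mem s3 (cell 3 b) = b.
  by rewrite (ps_unt R1) ?E2 //; [rewrite /cell; rupd|lia|lia].
have cb4 : mem s3 (cell 4 b) = a.
  by rewrite (ps_unt R1) ?E2 //; [rewrite /cell; rupd|lia|lia].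
have [|||x|i2 [U2 [s4 [ml2 E4 R2]]]] := parse_child P2 (ps_pst R1).
- by rewrite -/z1; lia.
- by rewrite -/z1; lia.
- exact: c2.
- rewrite -/z1 => xb; have [|g1 g2 g3 g4] := fr x; first by lia.
  by split=> [||| _]; rewrite keep1 ?g1 ?g2 ?g3 ?g4 //; try (by lia); case=> *; lia.
(* The first child now occupies cell 1 of [a], so the second pop of [a] fills cell 2. *)
rewrite cb1 ifF in E4; last by apply/eqP; lia.
rewrite -/z1 in E4 R2.
set s5 := iter i2 (den parse_body) s3 in R2;
set d := b + z1 in E4 R2 c2 *; have db : d = b + z1 by [].
have keep2 j x : 0 < j < 6 -> 0 < x < L -> x < d \/ d + size (code_term t2) <= x ->
   (x, j) <> (a, 2) -> mem s5 (cell j x) = mem s3 (cell j x).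
  move=> j6 xL xo xj; rewrite (ps_unt R2) //; last by left; lia.
  rewrite E4; have xja : ~ (x = a /\ j = 2) by case=> ? ?; apply: xj; congr pair.
  move: xo xja; rewrite /cell => xo xja.
  have : j = 1 \/ j = 2 \/ j = 3 \/ j = 4 \/ j = 5 by lia.
  by case=> [|[|[|[|]]]] ?; subst j; rupd.
have keep12 j x : 0 < j < 6 -> b <= x < d -> mem s5 (cell j x) = mem s3 (cell j x).
  by move=> j6 xb; apply: keep2 => //; try lia; case=> *; lia.
have db1 : mem s5 (cell 2 a) = d.
  by rewrite (ps_unt R2) ?E4 //; [rewrite /cell; rupd|lia|lia].
have db3 : mem s5 (cell 3 d) = d.
  by rewrite (ps_unt R2) ?E4 //; [rewrite /cell; rupd|lia|lia].
have db4 : mem s5 (cell 4 d) = a.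
  by rewrite (ps_unt R2) ?E4 //; [rewrite /cell; rupd|lia|lia].
(* Only leaves are chained to further users; the link of [a] is still 0, so each child of [a] has
   [a] as its only user. *)
have n5 : mem s5 (cell 5 a) = 0.
  by rewrite keep2 ?keep1 //; try lia; case=> *; lia.
exists (i2 + i1), U2; split; first by rewrite -/z1 in ml; lia.
rewrite iterD -/s3 -/s5; split.
- by have := ps_pst R2; congr (pst _ _ _ _); lia.
- move=> j x j6 xL xo; rewrite keep2 ?keep1 //; try lia; by case=> *; lia.
- move=> y t' /ins[[-> ->]|[h|h]]; last exact: (ps_loc R2 h).
    apply: loc => //; split=> //.
    + by rewrite keep2 ?cb1 //; try lia; case=> *; lia.
    + by rewrite keep12 ?cb3 //; lia.
    + by rewrite keep12 ?cb4 //; lia.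
  have [h1 h2] := insub_range h.
  exact: local_stable (ps_ext R2) (ps_loc R1 h) h1 h2 keep12.
- move=> y ya.
  have [yb|yb] := ltnP y d; last first.
    have [yd|yd] := eqVneq y d.
      right; rewrite yd db4; split; last by rewrite n5.
      by exists t; exact: insub_refl.
    have [|h|[[t' h] h5]] := ps_head R2 (y := y); first by lia.
      by left.
    by right; split=> //; exists t'; apply/ins; right; right.
  rewrite /headed keep12; try lia.
  have [yd|yd] := eqVneq y b.
    rewrite yd cb4; right; split; last by rewrite n5.
    by exists t; exact: insub_refl.
  have [|h|[[t' h] h5]] := ps_head R1 (y := y); first by rewrite -/z1; lia.
    by left.
  right; have [h1 h2] := insub_range h; have tt0 := code_gt0 t'.
  rewrite keep12; [|by []|by rewrite -/z1 in h2; lia]; split=> //.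
  by exists t'; apply/ins; right; left.
- move=> x xn; have [new1 [-> h1]] := ps_ext R2 xn; have [new2 [-> h2]] := ps_ext R1 xn.
  exists (new1 ++ new2); split; first by rewrite catA.
  move=> y; rewrite mem_cat => /orP[/h1|/h2] [t' ht].
    by exists t'; apply/ins; right; right.
  by exists t'; apply/ins; right; left.
- rewrite szt; have := ps_tot R1; have := ps_tot R2; rewrite -/z1.
  by move: (total _) (total _) (total _) => *; lia.
Qed.

Lemma parse_term t : parses t.
Proof.
elim: t => [A|i j|i j|t1 IH|t1 IH1 t2 IH2|t1 IH1 t2 IH2|i t1 IH|i t1 IH].
- apply: (@parse_leaf _ 0) => //=; first exact: ntid_nt.
  by move=> a y t' [[]|[]].
- by apply: (@parse_leaf _ 1) => //= a y t' [[]|[]].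
- by apply: (@parse_leaf _ 2) => //= a y t' [[]|[]].
- by apply: (@parse_unary _ t1 3 [:: 3]) => //=.
- by apply: (@parse_binary _ t1 t2 4) => //=.
- by apply: (@parse_binary _ t1 t2 5) => //=.
- by apply: (@parse_unary _ t1 6 [:: 6; nat_of_ord i]) => //=.
- by apply: (@parse_unary _ t1 7 [:: 7; nat_of_ord i]) => //=.
Qed.

End ParseTerm.

(** * The parser on the list of rules *)

Section Rules.

Variables (q : seq rat) (k n : nat) (w : seq nat) (L D T V H : nat).
Hypotheses (LD : D = L + n) (HD : 6 * D <= H).

Notation term := (term k 'I_n).
Notation den := (den q).
Notation cell := (cell D).
Notation ntid := (ntid L D).
Notation pst := (pst w L D T V H).
Notation chain := (chain D).
Notation local := (local L D).
Implicit Types (s : state) (t : term) (U : nat -> seq nat) (m : nat -> nat)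
  (rs : seq ('I_n * term)).

Definition codes rs := flatten [seq nat_of_ord r.1 :: code_term r.2 | r <- rs].

Fixpoint rule_at a rs y A t : Prop :=
  if rs is r :: rs' then
    (y = a + 1 /\ r = (A, t)) \/ rule_at (a + 1 + size (code_term r.2)) rs' y A t
  else False.

Definition innode a rs y t' := exists y0 A t, rule_at a rs y0 A t /\ insub y0 t y t'.

Lemma rule_at_range a rs y A t : rule_at a rs y A t ->
  a < y /\ y + size (code_term t) <= a + size (codes rs).
Proof.
elim: rs a => //= [[B t'] rs] IH a /=; rewrite /codes /= size_cat => -[[-> [_ <-]]|/IH[h1 h2]].
  by lia.
by rewrite /codes in h2; lia.
Qed.

Lemma innode_range a rs y t' : innode a rs y t' ->
  a < y /\ y + size (code_term t') <= a + size (codes rs).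
Proof.
by move=> [y0 [A [t [/rule_at_range h1 /(insub_range LD HD) h2]]]]; lia.
Qed.

Lemma rule_atP a rs A t : List.In (A, t) rs -> exists y, rule_at a rs y A t.
Proof.
elim: rs a => //= r rs IH a [->|/IH h]; first by exists (a + 1); left.
by have [y hy] := h (a + 1 + size (code_term r.2)); exists y; right.
Qed.

Lemma rule_at_in a rs y A t : rule_at a rs y A t -> List.In (A, t) rs.
Proof. by elim: rs a => //= r rs IH a [[_ ->]|/IH]; auto. Qed.

Record parsed_rules a rs U s s' U' : Prop := ParsedRules {
  pr_pst : pst s' (a + size (codes rs)) [::] U';
  pr_unt : forall j x, 0 < j < 6 -> 0 < x < a -> mem s' (cell j x) = mem s (cell j x);
  pr_tgt : forall y A t, rule_at a rs y A t -> mem s' (cell 3 y) = L + A;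
  pr_loc : forall y t, innode a rs y t -> local (mem s') U' y t;
  pr_head : forall y, a <= y < a + size (codes rs) ->
     headed D (mem s') y (fun u => exists t, innode a rs u t);
  pr_ext : ext L D U U' (fun y => exists t, innode a rs y t);
  pr_tot : total D U' <= total D U + size (codes rs)
}.

Lemma parse_rules rs : forall s a U, pst s a [::] U -> 0 < a ->
  a + size (codes rs) <= L -> at_code w a (codes rs) ->
  (forall j x, 0 < j < 6 -> a <= x < a + size (codes rs) -> mem s (cell j x) = 0) ->
  exists (i : nat) U', i <= size (codes rs) /\
    parsed_rules a rs U s (iter i (den parse_body) s) U'.
Proof.
elim: rs => [|[A t] rs IH] s a U P a0 aL ca fr.
  exists 0, U; split=> //; split=> //=; rewrite ?addn0 //.
  - by move=> y t [? [? [? []]]].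
  - by move=> y; rewrite /codes /=; lia.
  - by move=> x xn; exists [::].
have cE : codes ((A, t) :: rs) = nat_of_ord A :: (code_term t ++ codes rs) by [].
have szc : size (codes ((A, t) :: rs)) = (size (code_term t) + size (codes rs)).+1.
  by rewrite cE /= size_cat.
rewrite cE in ca; rewrite szc in aL fr *.
have t0 := code_gt0 t.
have [wa /at_code_cat[c1 c2]] := at_code_cons ca.
rewrite -addn1 in c1 c2.
have aL1 : a < L by lia.
have aL2 : a.+1 < L by lia.
have [P1 E1] := attach_root q LD HD P aL1 aL2 wa.
have D0 : 0 < D by lia.
have fr1 : fresh D (den attach s) a.+1 (a.+1 + size (code_term t)).
  move=> x xa; rewrite E1; split=> [|||_]; rewrite upd_neq ?fr //; rewrite /cell; lia.
rewrite -addn1 in P1 E1 fr1.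
have [||i1 [U1 [il R1]]] := parse_term q LD HD P1 _ _ c1 fr1; try lia.
set s2 := iter i1 _ _ in R1.
have e2 : s2 = iter i1.+1 (den parse_body) s.
  by rewrite iterSr (parse_body_in q P).
have keep j x : 0 < j < 6 -> 0 < x < L -> x <= a \/ a + 1 + size (code_term t) <= x ->
    mem s2 (cell j x) = mem s (cell j x).
  move=> j6 xL xa; rewrite (ps_unt R1) //; last by lia.
  rewrite E1 upd_neq // /cell.
  have : j = 1 \/ j = 2 \/ j = 3 \/ j = 4 \/ j = 5 by lia.
  by case=> [|[|[|[|]]]] ?; subst j; lia.
have [||||i2 [U2 [il2 R2]]] := IH _ _ _ (ps_pst R1).
- by lia.
- by lia.
- by [].
- by move=> j x j6 xa; rewrite keep ?fr //; lia.
set s3 := iter i2 _ _ in R2.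
exists (i2 + i1.+1), U2; split; first by lia.
rewrite iterD -e2 -/s3.
have keep2 j x : 0 < j < 6 -> 0 < x < a + 1 + size (code_term t) ->
    mem s3 (cell j x) = mem s2 (cell j x).
  by move=> *; apply: (pr_unt R2).
have keep3 j x : 0 < j < 6 -> a + 1 <= x < a + 1 + size (code_term t) ->
    mem s3 (cell j x) = mem s2 (cell j x).
  by move=> *; apply: keep2; lia.
have node1 y t' : insub (a + 1) t y t' -> innode a ((A, t) :: rs) y t'.
  by move=> h; exists (a + 1), A, t; split=> //; left.
have node2 y t' : innode (a + 1 + size (code_term t)) rs y t' ->
    innode a ((A, t) :: rs) y t'.
  by move=> [y0 [B [t'' [h1 h2]]]]; exists y0, B, t''; split=> //; right.
split; rewrite ?szc.
- by have := pr_pst R2; congr (pst _ _ _ _); lia.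
- by move=> j x j6 xa; rewrite keep2 ?keep //; lia.
- move=> y B t' [[-> [<- _]]|h] /=; last exact: (pr_tgt R2 h).
  rewrite keep2 //; last by lia.
  by rewrite (ps_unt R1) //; [rewrite E1 upd_eq|lia|right; auto].
- move=> y t' [y0 [B [t'' [h0 ins]]]]; case: h0 ins => [[-> [_ <-]]|h] ins; last first.
    by apply: (pr_loc R2); exists y0, B, t''.
  have [h1 h2] := insub_range LD HD ins.
  exact: (local_stable LD HD (pr_ext R2) (ps_loc R1 ins) h1 h2 keep3).
- move=> y ya; have [yb|yb] := ltnP y (a + 1 + size (code_term t)); last first.
    have [|h|[[t' h] h5]] := pr_head R2 (y := y); first by lia.
      by left.
    by right; split=> //; exists t'; exact: node2.
  have [y1|y1] := leqP y (a + 1).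
    left; rewrite keep2 //; last by lia.
    have [y2|y2] := eqVneq y (a + 1); last by rewrite keep ?fr //; lia.
    rewrite (ps_unt R1) //; [|lia|by right; auto].
    by rewrite E1 upd_neq ?fr //; rewrite ?/cell; lia.
  rewrite /headed keep3 //; last by lia.
  have [|h|[[t' h] h5]] := ps_head R1 (y := y); first by lia.
    by left.
  have [h1 h2] := insub_range LD HD h; have tt0 := code_gt0 t'.
  right; rewrite keep3 //; last by lia.
  by split=> //; exists t'; exact: node1.
- move=> x xn; have [new1 [-> h1]] := pr_ext R2 xn; have [new2 [-> h2]] := ps_ext R1 xn.
  exists (new1 ++ new2); split; first by rewrite catA.
  move=> y; rewrite mem_cat => /orP[/h1|/h2] [t' ht]; exists t'; [exact: node2|exact: node1].
- have := ps_tot R1; have := pr_tot R2.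
  by move: (total _ _) (total _ _) (total _ _) => *; lia.
Qed.

End Rules.

(** The tag determines the shape of what follows, so the code is prefix-free; hence an address names
    at most one subterm. *)
Lemma code_inj k n w a (t t' : term k 'I_n) :
  at_code w a (code_term t) -> at_code w a (code_term t') -> t = t'.
Proof.
elim: t t' a => [A|i j|i j|t1 IH|t1 IH1 t2 IH2|t1 IH1 t2 IH2|i t1 IH|i t1 IH];
  case=> [A'|i' j'|i' j'|t1'|t1' t2'|t1' t2'|i' t1'|i' t1'] a;
  move=> /at_code_cons[e h] /at_code_cons[e' h']; try (by rewrite e in e').
- move: h h' => /at_code_cons[e1 _] /at_code_cons[e2 _].
  by congr Leaf; apply: ord_inj; rewrite -e1 -e2.
- move: h h' => /at_code_cons[e1 /at_code_cons[e3 _]] /at_code_cons[e2 /at_code_cons[e4 _]].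
  by congr TLt; apply: ord_inj; rewrite -?e1 -?e2 -?e3 -?e4.
- move: h h' => /at_code_cons[e1 /at_code_cons[e3 _]] /at_code_cons[e2 /at_code_cons[e4 _]].
  by congr TEq; apply: ord_inj; rewrite -?e1 -?e2 -?e3 -?e4.
- by congr TNot; exact: IH h h'.
- move: h h' => /at_code_cat[h1 h2] /at_code_cat[h1' h2'].
  have E := IH1 _ _ h1 h1'; rewrite -E in h2' *.
  by congr TAnd; exact: IH2 h2 h2'.
- move: h h' => /at_code_cat[h1 h2] /at_code_cat[h1' h2'].
  have E := IH1 _ _ h1 h1'; rewrite -E in h2' *.
  by congr TOr; exact: IH2 h2 h2'.
- move: h h' => /at_code_cons[e1 h] /at_code_cons[e2 h'].
  by congr TEx; [apply: ord_inj; rewrite -e1 -e2|exact: IH h h'].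
- move: h h' => /at_code_cons[e1 h] /at_code_cons[e2 h'].
  by congr TAll; [apply: ord_inj; rewrite -e1 -e2|exact: IH h h'].
Qed.

Lemma insub_code k n w a (t : term k 'I_n) y t' : insub a t y t' ->
  at_code w a (code_term t) -> at_code w y (code_term t').
Proof.
elim: t a => [A|i j|i j|t1 IH|t1 IH1 t2 IH2|t1 IH1 t2 IH2|i t1 IH|i t1 IH] a /=;
  case=> [[-> ->]|] //=; rewrite ?addn1 ?addn2.
- by move=> h /at_code_cons[_]; exact: IH.
- by case=> [h|h] /at_code_cons[_ /at_code_cat[h1 h2]]; [exact: (IH1 _ h h1)|exact: (IH2 _ h h2)].
- by case=> [h|h] /at_code_cons[_ /at_code_cat[h1 h2]]; [exact: (IH1 _ h h1)|exact: (IH2 _ h h2)].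
- by move=> h /at_code_cons[_ /at_code_cons[_]]; exact: IH.
- by move=> h /at_code_cons[_ /at_code_cons[_]]; exact: IH.
Qed.

(** A node attached to a parent receives itself as target, so only the root of a right-hand side can
    have another one. *)
Lemma insub_tgt k n L D m U a (t : term k 'I_n) :
  (forall y t', insub a t y t' -> local L D m U y t') ->
  forall y t', insub a t y t' -> (y = a /\ t' = t) \/ m (cell D 3 y) = y.
Proof.
elim: t a => [A|i j|i j|t1 IH|t1 IH1 t2 IH2|t1 IH1 t2 IH2|i t1 IH|i t1 IH] a /= h y t';
  (case=> [[-> ->]|//]; first by left); have := h a _ (or_introl (conj erefl erefl)) => /=.
- move=> [[_ e _] _] /IH[|[-> _]|]; [|by right|by right].
  by move=> *; apply: h; right.
- move=> [[_ e1 _] [_ e2 _]] [/IH1|/IH2] [|[-> _]|]; try by right.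
  + by move=> *; apply: h; right; left.
  + by move=> *; apply: h; right; right.
- move=> [[_ e1 _] [_ e2 _]] [/IH1|/IH2] [|[-> _]|]; try by right.
  + by move=> *; apply: h; right; left.
  + by move=> *; apply: h; right; right.
- move=> [[_ e _] _] /IH[|[-> _]|]; [|by right|by right].
  by move=> *; apply: h; right.
- move=> [[_ e _] _] /IH[|[-> _]|]; [|by right|by right].
  by move=> *; apply: h; right.
Qed.

Lemma insub_trans k n a (t : term k 'I_n) y t' z t'' :
  insub a t y t' -> insub y t' z t'' -> insub a t z t''.
Proof.
elim: t a => [A|i j|i j|t1 IH|t1 IH1 t2 IH2|t1 IH1 t2 IH2|i t1 IH|i t1 IH] a /=;
  case=> [[-> ->]|] //=.
- by move=> h1 h2; right; exact: IH h1 h2.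
- by case=> h1 h2; right; [left; exact: IH1 h1 h2|right; exact: IH2 h1 h2].
- by case=> h1 h2; right; [left; exact: IH1 h1 h2|right; exact: IH2 h1 h2].
- by move=> h1 h2; right; exact: IH h1 h2.
- by move=> h1 h2; right; exact: IH h1 h2.
Qed.

(** * The tables left by the parser *)

Section Static.

Variables (k : nat) (G : grammar k) (w : seq nat) (L D : nat).
Notation n := (nnt G).
Hypothesis LD : D = L + n.

Notation cell := (cell D).
Notation ntid := (ntid L D).
Implicit Types (t : term k 'I_n) (U : nat -> seq nat) (m : nat -> nat).

Definition node y t := innode 6 (rules G) y t.

Record static m U : Prop := Static {
  st_in : forall x, x < D -> m x = nth 0 w x;
  st_code : at_code w 6 (codes (rules G));
  st_len : 6 + size (codes (rules G)) = L;
  st_tgt : forall y A t, rule_at 6 (rules G) y A t -> m (cell 3 y) = L + A;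
  st_loc : forall y t, node y t -> local L D m U y t;
  st_head : forall y, 0 < y < L -> headed D m y (fun u => exists t, node u t);
  st_chain : forall x, ntid x -> chain D m (m (cell 4 x)) (U x);
  st_user : forall x y, ntid x -> y \in U x -> exists t, node y t;
  st_tot : total D U <= L
}.

Definition users m U x :=
  if 0 < x < L then (if m (cell 4 x) == 0 then [::] else [:: m (cell 4 x)]) else U x.

Variables (m : nat -> nat) (U : nat -> seq nat).
Hypothesis S : static m U.

Lemma node_code y t : node y t -> at_code w y (code_term t).
Proof.
move=> [y0 [A [t0 [h1 h2]]]]; apply: insub_code h2 _.
elim: (rules G) (6) h1 (st_code S) => //= r rs IH a h1.
rewrite /codes /= => /at_code_cons[_ /at_code_cat[c1 c2]].
rewrite -addn1 in c1 c2.
by case: h1 => [[-> E]|h1]; [rewrite E in c1|exact: IH h1 c2].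
Qed.

Lemma node_uniq y t t' : node y t -> node y t' -> t = t'.
Proof. by move=> /node_code h1 /node_code h2; exact: code_inj h1 h2. Qed.

Lemma node_range y t : node y t -> 6 < y /\ y + size (code_term t) <= L.
Proof.
move=> h; have [h1 h2] := innode_range LD (leqnn _) h; rewrite (st_len S) in h2.
by split.
Qed.

Lemma node_mem y t i : node y t -> i < size (code_term t) ->
  m (y + i) = nth 0 (code_term t) i.
Proof.
move=> h il; have [h1 h2] := node_range h.
by rewrite (st_in S) ?(node_code h) //; lia.
Qed.

Lemma node_sub y t z t' : node y t -> insub y t z t' -> node z t'.
Proof.
move=> [y0 [A [t0 [h1 h2]]]] h; exists y0, A, t0; split=> //.
exact: insub_trans h2 h.
Qed.

Lemma node_tgt y t : node y t ->
  m (cell 3 y) = y \/ exists2 A : 'I_n, m (cell 3 y) = L + A & is_rule A t.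
Proof.
move=> [y0 [A [t0 [h1 h2]]]].
have [|[-> ->]|] := insub_tgt (m := m) (U := U) (L := L) (D := D) _ h2.
- by move=> z t' h; apply: (st_loc S); exists y0, A, t0.
- by right; exists A; [exact: st_tgt S _ _ _ h1|exact: rule_at_in h1].
- by left.
Qed.

Lemma usersP x : x < D -> chain D m (m (cell 4 x)) (users m U x) /\
  forall u, u \in users m U x -> exists t, node u t.
Proof.
move=> xD; rewrite /users; case: ifP => xL.
  case: (st_head S xL) => [->//|[[t ut] u5]].
  have [u6 _] := node_range ut.
  case: eqP => [e|_]; first by rewrite e in u6.
  split=> /=; first by split=> //; lia.
  by move=> u; rewrite inE => /eqP->; exists t.
have xn : ntid x by rewrite /ntid; lia.
by split; [exact: st_chain S _ xn|move=> u; exact: st_user S _ _ xn].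
Qed.

Lemma users_child j y x : 0 < x < L -> 0 < y -> child D m j y x -> y \in users m U x.
Proof.
move=> xL y0 [_ _ e]; rewrite /users xL e.
by case: eqP => [?|_]; [lia|rewrite inE].
Qed.

(** One [L] is for the indices inside the input, with at most one user each, the other for the lists
    of the nonterminals and of the dummy. *)
Lemma users_total : \sum_(x < D) size (users m U x) <= L + L.
Proof.
apply: (@leq_trans (\sum_(x < D) ((x < L) + size (U x)))).
  apply: leq_sum => x _; rewrite /users.
  case: ifP => [/andP[_ ->]|_]; last by rewrite leq_addl.
  by case: ifP.
rewrite big_split /= leq_add //; last exact: st_tot S.
rewrite LD big_split_ord /= -[X in _ <= X]addn0 leq_add //.
  by rewrite -[X in _ <= X]card_ord -sum1_card leq_sum // => x _; rewrite leq_b1.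
by rewrite big1 // => x _; rewrite ltnNge leq_addr.
Qed.

(** A dummy second child is not registered among the users of 0: the fact for 0 is known before all
    others, so it never has to trigger such a node. *)
Lemma node_args u t : node u t ->
  [/\ m (cell 1 u) < D, m (cell 2 u) < D, 0 < m (cell 3 u) < D,
      u \in users m U (m (cell 1 u)) &
      m (cell 2 u) != 0 -> u \in users m U (m (cell 2 u))].
Proof.
move=> ut; have [u6 uL] := node_range ut; have l := st_loc S ut.
have nt (A : 'I_n) : L + A < D by have := ltn_ord A; lia.
have T3 : 0 < m (cell 3 u) < D.
  by case: (node_tgt ut) => [->|[A -> _]]; [have := code_gt0 t|have := nt A]; lia.
have in0 : users m U 0 = U 0 by rewrite /users.
have inA (A : 'I_n) : users m U (L + A) = U (L + A).
  by rewrite /users ifF //; apply/negP; lia.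
case: t ut uL l => [A|i j|i j|t1|t1 t2|t1 t2|i t1|i t1] ut uL /=.
- by move=> [-> -> h]; split=> //; [lia|rewrite inA].
- by move=> [-> -> h]; split=> //; rewrite ?in0 //; lia.
- by move=> [-> -> h]; split=> //; rewrite ?in0 //; lia.
- move=> [c ->]; have t1g := code_gt0 t1; rewrite /= in uL.
  case: (c) => -> _ _; split=> //; try lia.
  by apply: users_child c; lia.
- move=> [c c']; have t1g := code_gt0 t1; have t2g := code_gt0 t2.
  rewrite /= size_cat in uL.
  case: (c) => -> _ _; case: (c') => -> _ _; split=> //; try lia.
    by apply: users_child c; lia.
  by move=> _; apply: users_child c'; lia.
- move=> [c c']; have t1g := code_gt0 t1; have t2g := code_gt0 t2.
  rewrite /= size_cat in uL.
  case: (c) => -> _ _; case: (c') => -> _ _; split=> //; try lia.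
    by apply: users_child c; lia.
  by move=> _; apply: users_child c'; lia.
- move=> [c ->]; have t1g := code_gt0 t1; rewrite /= in uL.
  case: (c) => -> _ _; split=> //; try lia.
  by apply: users_child c; lia.
- move=> [c ->]; have t1g := code_gt0 t1; rewrite /= in uL.
  case: (c) => -> _ _; split=> //; try lia.
  by apply: users_child c; lia.
Qed.

End Static.

(** * Saturation *)

Definition waddr x v := eadd (at_ 6 x) (emul v (EG 1)).

Definition tagE := EM (EG 7).
(** A nonterminal leaf leaves no node in the formula: its record copies the three cells of the
    formula kept for the nonterminal. Variable indices are copied from the input, and children
    become addresses. *)
Definition cell0E := EIf (eeq tagE (EC 0)) (EM (EG 13)) tagE.
Definition cell1E :=
  EIf (eeq tagE (EC 0)) (EM (eadd (EG 13) (EC 1)))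
    (EIf (EIf (elt tagE (EC 3)) (EC 1) (elt (EC 5) tagE))
       (EM (eadd (EG 7) (EC 1))) (EG 13)).
Definition cell2E :=
  EIf (eeq tagE (EC 0)) (EM (eadd (EG 13) (EC 2)))
    (EIf (elt tagE (EC 3)) (EM (eadd (EG 7) (EC 2)))
       (EIf (elt (EC 5) tagE) (EG 13) (EG 14))).

Definition record :=
  SSeq (SSt (EG 16) (EG 9))
  (SSeq (SSt (EG 9) cell0E)
  (SSeq (SSt (eadd (EG 9) (EC 1)) cell1E)
  (SSeq (SSt (eadd (EG 9) (EC 2)) cell2E)
  (SSeq (SSt (eadd (EG 9) (EC 3)) (EM (at_ 3 (EG 7))))
        (SSet 9 (eadd (EG 9) (EC 4))))))).

Definition derive2 :=
  SSeq (SSet 15 (ECall (EG 7) (EG 11) (EG 12) opE))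
  (SSeq (SSet 16 (waddr (EM (at_ 3 (EG 7))) (EG 15)))
        (SIf (EM (EG 16)) SSkip record)).

(** A cell content 0 stands for a value not found yet, since no record has address 0. *)
Definition derive :=
  SSeq (SSet 13 (EM (waddr (EM (at_ 1 (EG 7))) (EG 11))))
  (SSeq (SSet 14 (EM (waddr (EM (at_ 2 (EG 7))) (EG 12))))
        (SIf (EG 13) (SIf (EG 14) derive2 SSkip) SSkip)).

Section Saturation.

Variables (q : seq rat) (k : nat) (G : grammar k) (w : seq nat).
Variables (L D T V H : nat) (m0 : nat -> nat) (U : nat -> seq nat).
Notation n := (nnt G).
Hypotheses (LD : D = L + n) (S : static G w L D m0 U) (k0 : m0 0 = k)
  (VT : V = 2 ^ T) (HV : H = 6 * D + V * D).

Notation cell := (cell D).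
Notation node := (@node k G).
Notation den := (den q).
Implicit Types (t : term k 'I_n) (m : nat -> nat) (s : state)
  (fs : seq (nat * nat)).

Definition wc x v := 6 * D + x + v * D.

Lemma ev_waddr s r x v :
  ev q s r (waddr x v) = 6 * regs s 1 + ev q s r x + ev q s r v * regs s 1.
Proof.
rewrite -[LHS]/(ev q s r (at_ 6 x) + ev q s [:: ev q s r v; regs s 1; 0] mulE).
by rewrite ev_at ev_mul.
Qed.

Lemma wc_range x v : x < D -> v < V -> 6 * D <= wc x v /\ wc x v < H.
Proof. by rewrite /wc HV => xD vV; nia. Qed.

Lemma wc_inj x v x' v' : x < D -> x' < D -> wc x v = wc x' v' -> (x, v) = (x', v').
Proof.
rewrite /wc => xD xD' h; have e : x + v * D = x' + v' * D by lia.
have : (x + v * D) %% D = (x' + v' * D) %% D by rewrite e.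
rewrite !(addnC _ (_ * D)) !modnMDl !modn_small // => ex; congr pair => //.
by move: e; rewrite ex => /eqP; rewrite eqn_add2l eqn_pmul2r; [move/eqP|lia].
Qed.

(** Strengthens [stored] by keeping every address within the records already written, so that later
    records cannot disturb the formula. *)
Fixpoint stored_in m hi a (phi : formula k) : Prop :=
  (H <= a /\ a + 3 < hi) /\
  match phi with
  | Leaf x => match x with end
  | TLt i j => [/\ m a = 1, m (a + 1) = i & m (a + 2) = j]
  | TEq i j => [/\ m a = 2, m (a + 1) = i & m (a + 2) = j]
  | TNot p => m a = 3 /\ stored_in m hi (m (a + 1)) p
  | TAnd p1 p2 =>
      [/\ m a = 4, stored_in m hi (m (a + 1)) p1 & stored_in m hi (m (a + 2)) p2]
  | TOr p1 p2 =>
      [/\ m a = 5, stored_in m hi (m (a + 1)) p1 & stored_in m hi (m (a + 2)) p2]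
  | TEx i p => [/\ m a = 6, m (a + 1) = i & stored_in m hi (m (a + 2)) p]
  | TAll i p => [/\ m a = 7, m (a + 1) = i & stored_in m hi (m (a + 2)) p]
  end.

Lemma stored_in_stored m hi a phi : stored_in m hi a phi -> stored m a phi.
Proof.
elim: phi a => [[]|i j|i j|p IH|p1 IH1 p2 IH2|p1 IH1 p2 IH2|i p IH|i p IH] a /= [_];
  rewrite ?addn1 ?addn2.
- by [].
- by [].
- by case=> h /IH.
- by case=> h /IH1 h1 /IH2.
- by case=> h /IH1 h1 /IH2.
- by case=> h h1 /IH.
- by case=> h h1 /IH.
Qed.

Lemma stored_in_mono m m' hi hi' a phi : hi <= hi' ->
  (forall y, H <= y < hi -> m' y = m y) -> stored_in m hi a phi -> stored_in m' hi' a phi.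
Proof.
move=> hh E.
elim: phi a => [[]|i j|i j|p IH|p1 IH1 p2 IH2|p1 IH1 p2 IH2|i p IH|i p IH] a /= [[h1 h2] h];
  (split; first by split=> //; lia); rewrite !E; try lia; move: h.
- by [].
- by [].
- by case=> ? /IH.
- by case=> ? /IH1 ? /IH2.
- by case=> ? /IH1 ? /IH2.
- by case=> ? ? /IH.
- by case=> ? ? /IH.
Qed.

Lemma stored_in_range m hi a phi : stored_in m hi a phi -> H <= a /\ a + 3 < hi.
Proof. by case: phi => [[]|? ?|? ?|?|? ?|? ?|? ?|? ?] /= [h _]. Qed.

Definition good x v (phi : formula k) :=
  [/\ val T phi = v, (forall t, node x t -> der t phi)
    & forall A : 'I_n, x = L + A -> der (Leaf A) phi].

(** [fs] lists the facts (x, v) in the order of discovery, and fact number i has its record at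
    [H + 4 * i]. Number 0 is the dummy fact (0, 0), premise of the atoms and the only fact without a
    formula. *)
Record heap m fs : Prop := Heap {
  hp_static : forall y, y < 6 * D -> m y = m0 y;
  hp_w : forall x v, x < D -> v < V ->
    m (wc x v) = if (x, v) \in fs then H + 4 * index (x, v) fs else 0;
  hp_x : forall i, i < size fs -> m (H + 4 * i + 3) = (nth (0, 0) fs i).1;
  hp_in : forall x v, (x, v) \in fs -> x < D /\ v < V;
  hp_uniq : uniq fs;
  hp_size : 0 < size fs;
  hp_0 : nth (0, 0) fs 0 = (0, 0);
  hp_nz : forall v, (0, v) \in fs -> v = 0;
  hp_good : forall x v, (x, v) \in fs -> x != 0 ->
    exists phi, stored_in m (H + 4 * size fs) (H + 4 * index (x, v) fs) phi /\ good x v phi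
}.

Definition op u v1 v2 := opv k T (m0 u) (m0 (u + 1)) (m0 (u + 2)) v1 v2.

Lemma op_lt u v1 v2 : op u v1 v2 < V.
Proof. by rewrite VT; exact: bits_lt. Qed.

Definition c1 u := m0 (cell 1 u).
Definition c2 u := m0 (cell 2 u).
Definition tgt u := m0 (cell 3 u).

Lemma LDn : L <= D. Proof. by rewrite LD leq_addr. Qed.

Definition rec0 m u w1 := if m u == 0 then m w1 else m u.
Definition rec1 m u w1 := if m u == 0 then m (w1 + 1) else
  if (m u < 3) || (5 < m u) then m (u + 1) else w1.
Definition rec2 m u w1 w2 := if m u == 0 then m (w1 + 2) else
  if m u < 3 then m (u + 2) else if 5 < m u then w1 else w2.

Lemma ev_cells s (m := mem s) u w1 w2 : regs s 7 = u -> regs s 13 = w1 -> regs s 14 = w2 ->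
  [/\ ev q s [::] cell0E = rec0 m u w1, ev q s [::] cell1E = rec1 m u w1
    & ev q s [::] cell2E = rec2 m u w1 w2].
Proof.
move=> e1 e2 e3; rewrite /m /= e1 e2 e3 !nat_of_bool_neq0 /rec0 /rec1 /rec2.
split=> //; case: (mem s u == 0) => //.
by case: (mem s u < 3) => //=; rewrite nat_of_bool_neq0.
Qed.

Lemma den_st a e s : den (SSt a e) s = setm s (ev q s [::] a) (ev q s [::] e).
Proof. by []. Qed.

Lemma den_set x e s : den (SSet x e) s = setr s x (ev q s [::] e).
Proof. by []. Qed.

(** The cells are evaluated one by one in memories already changed. This is harmless because they
    read the input or, for a nonterminal leaf, a record that ends below [tl], whence the last
    hypothesis. *)
Lemma record_spec s (m := mem s) u w1 w2 a tl (s' := den record s) :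
  regs s 1 = D -> regs s 7 = u -> regs s 9 = tl -> regs s 13 = w1 -> regs s 14 = w2 ->
  regs s 16 = a -> u < L -> H <= tl -> 6 * D <= a < H ->
  (m u = 0 -> H <= w1 /\ w1 + 3 < tl) ->
  [/\ mem s' = upd (upd (upd (upd (upd m a tl) tl (rec0 m u w1)) (tl + 1) (rec1 m u w1))
        (tl + 2) (rec2 m u w1 w2)) (tl + 3) (m (cell 3 u)),
      regs s' 9 = tl + 4 & forall x, x != 9 -> regs s' x = regs s x].
Proof.
move=> r1 r7 r9 r13 r14 r16 uL Htl aH w1H; have LD' := LDn.
have HD : 6 * D <= H by lia.
rewrite /s' /record.
rewrite den_seq den_st; set s1 := setm _ _ _.
rewrite den_seq den_st; set s2 := setm _ _ _.
rewrite den_seq den_st; set s3 := setm _ _ _.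
rewrite den_seq den_st; set s4 := setm _ _ _.
rewrite den_seq den_st; set s5 := setm _ _ _.
rewrite den_set.
have m1 : mem s1 = upd m a tl by rewrite /s1 /= r9 r16.
have [x0 _ _] := ev_cells (s := s1) r7 r13 r14.
have m2 : mem s2 = upd (mem s1) tl (rec0 (mem s1) u w1).
  by rewrite -[LHS]/(upd (mem s1) (regs s 9) (ev q s1 [::] cell0E)) x0 r9.
have [_ x1 _] := ev_cells (s := s2) r7 r13 r14.
have m3 : mem s3 = upd (mem s2) (tl + 1) (rec1 (mem s2) u w1).
  by rewrite -[LHS]/(upd (mem s2) (regs s 9 + 1) (ev q s2 [::] cell1E)) x1 r9.
have [_ _ x2] := ev_cells (s := s3) r7 r13 r14.
have m4 : mem s4 = upd (mem s3) (tl + 2) (rec2 (mem s3) u w1 w2).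
  by rewrite -[LHS]/(upd (mem s3) (regs s 9 + 2) (ev q s3 [::] cell2E)) x2 r9.
have m5 : mem s5 = upd (mem s4) (tl + 3) (mem s4 (cell 3 u)).
  rewrite -[LHS]/(upd (mem s4) (regs s 9 + 3) (mem s4 (ev q s4 [::] (at_ 3 (EG 7))))).
  by rewrite ev_at -[regs s4 1]/(regs s 1) -[ev _ _ _ (EG 7)]/(regs s 7) r9 r7 r1.
have lo y : y < 6 * D -> [/\ mem s1 y = m y, mem s2 y = m y, mem s3 y = m y & mem s4 y = m y].
  by move=> yD; split; rewrite ?m4 ?m3 ?m2 ?m1; rupd.
have [u1 u2 u3 u4] := lo u ltac:(lia).
have [v1 v2 v3 v4] := lo (u + 1) ltac:(lia).
have [z1 z2 z3 z4] := lo (u + 2) ltac:(lia).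
have [t1 t2 t3 t4] : [/\ mem s1 (cell 3 u) = m (cell 3 u), mem s2 (cell 3 u) = m (cell 3 u),
   mem s3 (cell 3 u) = m (cell 3 u) & mem s4 (cell 3 u) = m (cell 3 u)].
  by apply: lo; rewrite /cell; lia.
have R0 : rec0 (mem s1) u w1 = rec0 m u w1.
  rewrite /rec0 u1; case: eqP => // /w1H h.
  by rewrite m1; rupd.
have R1 : rec1 (mem s2) u w1 = rec1 m u w1.
  rewrite /rec1 u2 v2; case: eqP => // /w1H h.
  by rewrite m2 m1; rupd.
have R2 : rec2 (mem s3) u w1 w2 = rec2 m u w1 w2.
  rewrite /rec2 u3 z3; case: eqP => // /w1H h.
  by rewrite m3 m2 m1; rupd.
split.
- by rewrite -[LHS]/(mem s5) m5 t4 m4 R2 m3 R1 m2 R0 m1.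
- by rewrite /= r9.
- by move=> x /negPf /= ->.
Qed.

Lemma new_fact m m' fs u t v1 v2 w1 w2 (tl := H + 4 * size fs) :
  heap m fs -> node u t -> (c1 u, v1) \in fs -> (c2 u, v2) \in fs ->
  w1 = H + 4 * index (c1 u, v1) fs -> w2 = H + 4 * index (c2 u, v2) fs ->
  (forall y, H <= y < tl -> m' y = m y) ->
  m' tl = rec0 m u w1 -> m' (tl + 1) = rec1 m u w1 -> m' (tl + 2) = rec2 m u w1 w2 ->
  exists phi, [/\ stored_in m' (tl + 4) tl phi, val T phi = op u v1 v2 & der t phi].
Proof.
move=> hp ut f1 f2 ew1 ew2 same M0 M1 M2.
have [u6 uL] := node_range LD S ut.
have LD' := LDn.
have LDlt : L < D by rewrite LD; have := ltn_ord (start G); lia.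
have nm i : i < size (code_term t) -> m (u + i) = nth 0 (code_term t) i.
  move=> il; rewrite -(node_mem LD S ut il) (hp_static hp) //; lia.
have nm0 i : i < size (code_term t) -> m0 (u + i) = nth 0 (code_term t) i.
  exact: (node_mem LD S ut).
have tagm : m u = nth 0 (code_term t) 0 by rewrite -[u]addn0 nm ?code_gt0.
have tag0 : m0 u = nth 0 (code_term t) 0 by rewrite -[u]addn0 nm0 ?code_gt0.
have hi : H <= tl /\ tl + 3 < tl + 4 by rewrite /tl; lia.
have lift a phi : stored_in m tl a phi -> stored_in m' (tl + 4) a phi.
  by apply: stored_in_mono => //; lia.
have get x v : (x, v) \in fs -> 0 < x -> exists phi,
    stored_in m tl (H + 4 * index (x, v) fs) phi /\ good x v phi.
  by move=> h x0; apply: (hp_good hp h); rewrite -lt0n.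
have sub z t' : insub u t z t' -> node z t' by exact: node_sub ut.
have := st_loc S ut.
case: t ut uL nm nm0 tagm tag0 sub => [A|i j|i j|t1|t1 t2|t1 t2|i t1|i t1] ut uL nm nm0 /= tagm tag0 sub.
- move=> [e1 _ _]; rewrite /c1 e1 in f1 ew1.
  have [|phi [s1 [v1E _ dA]]] := get _ _ f1; first by lia.
  exists phi; split; last exact: dA.
    rewrite /rec0 /rec1 /rec2 tagm /= in M0 M1 M2.
    rewrite -ew1 in s1; have r1 := stored_in_range s1.
    have cp y : y < 3 -> m' (tl + y) = m' (w1 + y).
      move=> y3; rewrite [RHS]same; last by lia.
      have : y = 0 \/ y = 1 \/ y = 2 by lia.
      by case=> [|[|]] ->; rewrite ?addn0 ?M0 ?M1 ?M2.
    move: (lift _ _ s1) (cp 0 isT) (cp 1 isT) (cp 2 isT); rewrite !addn0.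
    by case: (phi) => [[]|? ?|? ?|?|? ?|? ?|? ?|? ?] /= [_ h] E0 E1 E2; rewrite ?E0 ?E1 ?E2.
  by rewrite /op tag0 -v1E opv_copy.
- move=> _; exists (TLt i j).
  rewrite /rec0 /rec1 /rec2 tagm /= in M0 M1 M2.
  by split=> //=; [rewrite M0 M1 M2 !nm|rewrite /op tag0 !nm0|constructor].
- move=> _; exists (TEq i j).
  rewrite /rec0 /rec1 /rec2 tagm /= in M0 M1 M2.
  by split=> //=; [rewrite M0 M1 M2 !nm|rewrite /op tag0 !nm0|constructor].
- move=> [[e1 _ _] _]; rewrite /c1 e1 in f1 ew1.
  have [|phi [s1 [v1E d1 _]]] := get _ _ f1; first by lia.
  rewrite /rec0 /rec1 /rec2 tagm /= in M0 M1 M2.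
  exists (TNot phi); split=> /=.
  + by rewrite M0 M1 ew1; split=> //; split=> //; exact: lift.
  + by rewrite v1E /op tag0.
  + by constructor; apply: d1; apply: sub; right; exact: insub_refl.
- move=> [[e1 _ _] [e2 _ _]]; rewrite /c1 e1 in f1 ew1; rewrite /c2 e2 in f2 ew2.
  have [|phi [s1 [v1E d1 _]]] := get _ _ f1; first by lia.
  have [|psi [s2 [v2E d2 _]]] := get _ _ f2; first by lia.
  rewrite /rec0 /rec1 /rec2 tagm /= in M0 M1 M2.
  exists (TAnd phi psi); split=> /=.
  + by rewrite M0 M1 M2 ew1 ew2; split=> //; split=> //; exact: lift.
  + by rewrite v1E v2E /op tag0.
  + by constructor; [apply: d1|apply: d2]; apply: sub; right; [left|right]; exact: insub_refl.
- move=> [[e1 _ _] [e2 _ _]]; rewrite /c1 e1 in f1 ew1; rewrite /c2 e2 in f2 ew2.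
  have [|phi [s1 [v1E d1 _]]] := get _ _ f1; first by lia.
  have [|psi [s2 [v2E d2 _]]] := get _ _ f2; first by lia.
  rewrite /rec0 /rec1 /rec2 tagm /= in M0 M1 M2.
  exists (TOr phi psi); split=> /=.
  + by rewrite M0 M1 M2 ew1 ew2; split=> //; split=> //; exact: lift.
  + by rewrite v1E v2E /op tag0.
  + by constructor; [apply: d1|apply: d2]; apply: sub; right; [left|right]; exact: insub_refl.
- move=> [[e1 _ _] _]; rewrite /c1 e1 in f1 ew1.
  have [|phi [s1 [v1E d1 _]]] := get _ _ f1; first by lia.
  rewrite /rec0 /rec1 /rec2 tagm /= in M0 M1 M2.
  exists (TEx i phi); split=> /=.
  + by rewrite M0 M1 M2 ew1 nm //; split=> //; split=> //; exact: lift.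
  + by rewrite v1E /op tag0 nm0.
  + by constructor; apply: d1; apply: sub; right; exact: insub_refl.
- move=> [[e1 _ _] _]; rewrite /c1 e1 in f1 ew1.
  have [|phi [s1 [v1E d1 _]]] := get _ _ f1; first by lia.
  rewrite /rec0 /rec1 /rec2 tagm /= in M0 M1 M2.
  exists (TAll i phi); split=> /=.
  + by rewrite M0 M1 M2 ew1 nm //; split=> //; split=> //; exact: lift.
  + by rewrite v1E /op tag0 nm0.
  + by constructor; apply: d1; apply: sub; right; exact: insub_refl.
Qed.

Lemma good_tgt u t v phi : node u t -> val T phi = v -> der t phi -> good (tgt u) v phi.
Proof.
move=> ut vE d; have [u6 uL] := node_range LD S ut; have tg := code_gt0 t.
rewrite /tgt; case: (node_tgt S ut) => [->|[A -> rA]]; split=> //.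
- by move=> t' /(node_uniq S ut) <-.
- by move=> A e; lia.
- by move=> t' /(node_range LD S) h; have := code_gt0 t'; lia.
- move=> A' /eqP; rewrite eqn_add2l => /eqP/ord_inj <-.
  exact: der_leaf rA d.
Qed.

Lemma heap_add m m' fs u t v1 v2 w1 w2 (tl := H + 4 * size fs) :
  heap m fs -> node u t -> (c1 u, v1) \in fs -> (c2 u, v2) \in fs ->
  w1 = H + 4 * index (c1 u, v1) fs -> w2 = H + 4 * index (c2 u, v2) fs ->
  (tgt u, op u v1 v2) \notin fs ->
  m' = upd (upd (upd (upd (upd m (wc (tgt u) (op u v1 v2)) tl) tl (rec0 m u w1))
    (tl + 1) (rec1 m u w1)) (tl + 2) (rec2 m u w1 w2)) (tl + 3) (tgt u) ->
  heap m' (rcons fs (tgt u, op u v1 v2)).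
Proof.
move=> hp ut f1 f2 ew1 ew2 nin E.
have [_ _ /andP[x0 xD] _ _] := node_args LD S ut; rewrite -/(tgt u) in x0 xD.
have vV := op_lt u v1 v2.
set x := tgt u in nin E x0 xD *; set v := op u v1 v2 in nin E vV *.
set a := wc x v in E.
have [aD aH] : 6 * D <= a /\ a < H by exact: wc_range.
have HD : 6 * D <= H by lia.
have Htl : H <= tl by rewrite /tl; lia.
have same y : H <= y < tl -> m' y = m y by move=> ?; rewrite E; rupd.
have [|||phi [st vE d]] := new_fact (m' := m') hp ut f1 f2 ew1 ew2 same; rewrite -/tl.
- by rewrite E; rupd.
- by rewrite E; rupd.
- by rewrite E; rupd.
have tl4 : H + 4 * size (rcons fs (x, v)) = tl + 4 by rewrite size_rcons /tl; lia.
have idx p : p \in fs -> index p (rcons fs (x, v)) = index p fs.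
  by move=> h; rewrite -cats1 index_cat h.
have idxn : index (x, v) (rcons fs (x, v)) = size fs.
  by rewrite -cats1 index_cat (negPf nin) /= eqxx addn0.
split.
- by move=> y yD; rewrite E -(hp_static hp yD); rupd.
- move=> x' v' xD' vV'; have [b1 b2] := wc_range xD' vV'.
  rewrite mem_rcons inE; case: eqP => [e|ne] /=.
    by rewrite e idxn; case: e => -> ->; rewrite E -/a; rupd.
  have na : wc x' v' <> a by move=> /wc_inj h; apply: ne; apply: h.
  have -> : m' (wc x' v') = m (wc x' v') by rewrite E; rupd.
  rewrite (hp_w hp) //; case: ifP => // h; by rewrite idx.
- move=> i; rewrite size_rcons ltnS leq_eqVlt => /orP[/eqP->|il].
    by rewrite nth_rcons ltnn eqxx E -/tl; rupd.
  rewrite nth_rcons il -(hp_x hp il) same //; rewrite /tl; lia.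
- move=> x' v'; rewrite mem_rcons inE => /orP[/eqP[-> ->]//|]; exact: hp_in hp _ _.
- by rewrite rcons_uniq nin (hp_uniq hp).
- by rewrite size_rcons.
- by rewrite nth_rcons (hp_size hp) (hp_0 hp).
- move=> v'; rewrite mem_rcons inE => /orP[/eqP[e]|]; first by lia.
  exact: hp_nz hp _.
- move=> x' v'; rewrite mem_rcons inE tl4; case: eqP => [[-> ->] _ _|_ /= h x0'].
    rewrite idxn -/tl; exists phi; split=> //; exact: good_tgt ut vE d.
  rewrite idx //; have [psi [s1 g1]] := hp_good hp h x0'.
  exists psi; split=> //; apply: stored_in_mono s1 => //; rewrite -/tl; lia.
Qed.

End Saturation.

Definition incr x := SSet x (eadd (EG x) (EC 1)).

Definition inner := SRep (EG 3) (SSeq derive (incr 12)).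

Definition outer := SRep (EG 3) (SSeq (SSeq (SSet 12 (EC 0)) inner) (incr 11)).

(** All pairs of values of the two children are tried, not only those with the new value: the factor
    [V ^ 2] disappears in a power of [Z]. *)
Definition recompute := SSeq (SSet 11 (EC 0)) outer.

(** Register 7 walks along the users of the fact popped last. When it is 0 the next fact is popped,
    and on an empty queue the turn is idle. *)
Definition main_body :=
  SIf (EG 7) (SSeq recompute (SSet 7 (EM (at_ 5 (EG 7)))))
   (SIf (elt (EG 8) (EG 9))
      (SSeq (SSet 7 (EM (at_ 4 (EM (eadd (EG 8) (EC 3))))))
            (SSet 8 (eadd (EG 8) (EC 4)))) SSkip).

Lemma sum_subset (I : eqType) (s r : seq I) (F : I -> nat) :
  uniq s -> {subset s <= r} -> \sum_(i <- s) F i <= \sum_(i <- r) F i.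
Proof.
elim: s r => [|x s IH] r /=; first by rewrite big_nil.
move=> /andP[xs us] sr; have xr : x \in r by apply: sr; rewrite inE eqxx.
rewrite big_cons (perm_big _ (perm_to_rem xr)) big_cons leq_add2l.
apply: IH => // y ys; have := sr y; rewrite inE ys orbT => /(_ isT).
rewrite (perm_mem (perm_to_rem xr)) inE => /orP[/eqP e|//].
by rewrite -e ys in xs.
Qed.

(** * The worklist: invariant and number of turns *)

Section Loop.

Variables (q : seq rat) (k : nat) (G : grammar k) (w : seq nat).
Variables (L D T V H Z : nat) (m0 : nat -> nat) (U : nat -> seq nat).
Notation n := (nnt G).
Hypotheses (LD : D = L + n) (S : static G w L D m0 U) (k0 : m0 0 = k)
  (VT : V = 2 ^ T) (HV : H = 6 * D + V * D).
Hypotheses (VZ : V <= Z) (TZ : T <= Z) (kZ : 0 < T -> 2 <= Z /\ k <= Z).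

Notation cell := (cell D).
Notation node := (@node k G).
Notation den := (den q).
Notation wc := (wc D).
Notation heap := (heap G L D T V H m0).
Notation c1 := (c1 D m0).
Notation c2 := (c2 D m0).
Notation tgt := (tgt D m0).
Notation op := (op k T m0).
Notation users := (users L D m0 U).
Implicit Types (t : term k 'I_n) (m : nat -> nat) (s : state)
  (fs : seq (nat * nat)).

Record wstate s fs : Prop := WState {
  ws_0 : regs s 0 = L; ws_1 : regs s 1 = D; ws_2 : regs s 2 = T;
  ws_3 : regs s 3 = V; ws_6 : regs s 6 = H;
  ws_9 : regs s 9 = H + 4 * size fs;
  ws_heap : heap (mem s) fs
}.

Lemma wstate_same s s' fs : wstate s fs -> mem s' = mem s ->
  (forall x, x \in [:: 0; 1; 2; 3; 6; 9] -> regs s' x = regs s x) -> wstate s' fs.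
Proof.
move=> W E R; split; rewrite ?E ?R //; try exact: ws_heap W.
- exact: ws_0 W.
- exact: ws_1 W.
- exact: ws_2 W.
- exact: ws_3 W.
- exact: ws_6 W.
- exact: ws_9 W.
Qed.

Lemma LD1 : L < D.
Proof. by rewrite LD; have := ltn_ord (start G); lia. Qed.

Lemma H6 : 6 * D <= H. Proof. by rewrite HV leq_addr. Qed.

Lemma ok_waddr s r x v : eok q Z s r x -> eok q Z s r v -> ev q s r v <= Z ->
  eok q Z s r (waddr x v).
Proof.
move=> h1 h2 h3; split; last by split; [exact: h2|exact: I|exact: I|exact: ok_mul].
rewrite /at_; elim: 6 => [|j IH]; [exact: h1|split; [exact: I|exact: IH]].
Qed.

Lemma ok_mem s r a : eok q Z s r a -> eok q Z s r (EM a).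
Proof. by []. Qed.

Lemma sok_if s e a b : eok q Z s [::] e -> (ev q s [::] e != 0 -> sok q Z a s) ->
  (ev q s [::] e = 0 -> sok q Z b s) -> sok q Z (SIf e a b) s.
Proof.
move=> h1 h2 h3; split=> [//|]; case: ifP => [|/negP h]; first exact: h2.
by apply: h3; apply/eqP; case: eqP h.
Qed.

Definition temps := [:: 9; 13; 14; 15; 16].

Definition derived s s' fs fs' := wstate s' fs' /\ exists new, fs' = fs ++ new.

Lemma derive_spec s fs u t v1 v2 (s' := den derive s) :
  wstate s fs -> node u t -> regs s 7 = u -> regs s 11 = v1 -> regs s 12 = v2 ->
  v1 < V -> v2 < V ->
  [/\ sok q Z derive s, forall x, x \notin temps -> regs s' x = regs s x
    & exists fs', derived s s' fs fs' /\
      ((c1 u, v1) \in fs -> (c2 u, v2) \in fs -> (tgt u, op u v1 v2) \in fs')].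
Proof.
move=> W ut r7 r11 r12 v1V v2V; have hp := ws_heap W; have r1 := ws_1 W.
have lD := LD1; have h6 := H6.
have [u6 uL] := node_range LD S ut; have tg := code_gt0 t.
have [d1 d2 d3 _ _] := node_args LD S ut.
have stat j : j < 6 -> mem s (j * D + u) = m0 (cell j u).
  by move=> j6; rewrite (hp_static hp) //; nia.
set w1 := mem s (wc (c1 u) v1); set w2 := mem s (wc (c2 u) v2).
have ev7 j s1 : regs s1 1 = D -> regs s1 7 = u ->
    ev q s1 [::] (EM (at_ j (EG 7))) = mem s1 (j * D + u).
  move=> e1 e7; rewrite -[LHS]/(mem s1 (ev q s1 [::] (at_ j (EG 7)))).
  by rewrite ev_at e1 -[ev _ _ _ _]/(regs s1 7) e7.
have E1 : ev q s [::] (EM (waddr (EM (at_ 1 (EG 7))) (EG 11))) = w1.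
  rewrite -[LHS]/(mem s (ev q s [::] (waddr (EM (at_ 1 (EG 7))) (EG 11)))).
  by rewrite ev_waddr ev7 // stat // r1 -[ev _ _ _ (EG 11)]/(regs s 11) r11.
set s1 := setr s 13 w1.
have E2 : ev q s1 [::] (EM (waddr (EM (at_ 2 (EG 7))) (EG 12))) = w2.
  rewrite -[LHS]/(mem s (ev q s1 [::] (waddr (EM (at_ 2 (EG 7))) (EG 12)))).
  rewrite ev_waddr ev7 // stat // -[regs s1 1]/(regs s 1) r1.
  by rewrite -[ev _ _ _ (EG 12)]/(regs s 12) r12.
set s2 := setr s1 14 w2.
have ok1 : eok q Z s [::] (EM (waddr (EM (at_ 1 (EG 7))) (EG 11))).
  by apply: ok_mem; apply: ok_waddr; [do ?split|exact: I|rewrite /= r11; lia].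
have ok2 : eok q Z s1 [::] (EM (waddr (EM (at_ 2 (EG 7))) (EG 12))).
  by apply: ok_mem; apply: ok_waddr; [do ?split|exact: I|rewrite /= r12; lia].
have W1 : w1 = if (c1 u, v1) \in fs then H + 4 * index (c1 u, v1) fs else 0.
  by rewrite /w1 (hp_w hp).
have W2 : w2 = if (c2 u, v2) \in fs then H + 4 * index (c2 u, v2) fs else 0.
  by rewrite /w2 (hp_w hp).
have Es : s' = if w1 != 0 then if w2 != 0 then den derive2 s2 else s2 else s2.
  by rewrite /s' /derive den_seq den_set E1 -/s1 den_seq den_set E2 -/s2 !den_if.
have oks : (w1 != 0 -> w2 != 0 -> sok q Z derive2 s2) -> sok q Z derive s.
  move=> h; split; first exact: ok1.
  rewrite den_set E1 -/s1; split; first exact: ok2.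
  rewrite den_set E2 -/s2.
  apply: sok_if => [|n1|_]; [exact: I| |exact: I].
  by apply: sok_if => [|n2|_]; [exact: I|exact: h|exact: I].
have Wid : wstate s2 fs.
  by apply: (wstate_same W) => // x; rewrite !inE => /or4P[/eqP->|/eqP->|/eqP->|/or3P[/eqP->|/eqP->|/eqP->]].
have R2 x : x \notin temps -> regs s2 x = regs s x.
  by rewrite !inE !negb_or /= => /and5P[_ /negPf-> /negPf-> _ _].
have Hpos : 0 < H by have := H6; lia.
case: (boolP ((c1 u, v1) \in fs)) W1 => f1 W1; last first.
  rewrite Es W1 eqxx; split=> //; first by apply: oks; rewrite W1 eqxx.
  by exists fs; split=> //; split=> //; exists [::]; rewrite cats0.
have w1n : w1 != 0 by rewrite W1; lia.
case: (boolP ((c2 u, v2) \in fs)) W2 => f2 W2; last first.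
  rewrite Es w1n W2 eqxx; split=> //; first by apply: oks; rewrite W2 eqxx.
  by exists fs; split=> //; split=> //; exists [::]; rewrite cats0.
have w2n : w2 != 0 by rewrite W2; lia.
rewrite w1n w2n in Es.
set v := op u v1 v2.
have E3 : ev q s2 [::] (ECall (EG 7) (EG 11) (EG 12) opE) = v.
  rewrite -[LHS]/(ev q s2 [:: regs s 7; regs s 11; regs s 12] opE) ev_op.
  rewrite r7 r11 r12 -[mem s2]/(mem s) -[regs s2 2]/(regs s 2) (ws_2 W).
  by rewrite !(hp_static hp) ?k0 //; lia.
have ok3 : eok q Z s2 [::] (ECall (EG 7) (EG 11) (EG 12) opE).
  apply: ok_call; [exact: I|exact: I|exact: I|].
  rewrite -/(ev q s2 _ (EG 7)) -[ev _ _ _ (EG 7)]/(regs s 7) -[ev _ _ _ (EG 11)]/(regs s 11).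
  rewrite -[ev _ _ _ (EG 12)]/(regs s 12) r7 r11 r12.
  apply: ok_op; first by rewrite -[regs s2 2]/(regs s 2) (ws_2 W).
  rewrite -[regs s2 2]/(regs s 2) (ws_2 W) => /kZ[Z2 kz].
  have e0 : mem s2 0 = k by rewrite -[mem s2]/(mem s) (hp_static hp) ?k0 //; lia.
  split=> //; [by rewrite e0|lia|lia|].
  rewrite /small_args -[mem s2]/(mem s) -[u]addn0 !(hp_static hp) ?addn0; try lia.
  have nm i : i < size (code_term t) -> m0 (u + i) = nth 0 (code_term t) i.
    exact: (node_mem LD S ut).
  rewrite -[u in m0 u]addn0 nm //.
  case: t {ut uL tg} nm => [A|i j|i j|t1|t1 t2|t1 t2|i t1|i t1] nm; rewrite /= !inE //= => _.
    by rewrite !nm //=; have := ltn_ord i; have := ltn_ord j; lia.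
  by rewrite !nm //=; have := ltn_ord i; have := ltn_ord j; lia.
set s3 := setr s2 15 v.
have vV : v < V by exact: op_lt.
have E4 : ev q s3 [::] (waddr (EM (at_ 3 (EG 7))) (EG 15)) = wc (tgt u) v.
  by rewrite ev_waddr ev7 // -[mem s3]/(mem s) stat // -[regs s3 1]/(regs s 1) r1.
have ok4 : eok q Z s3 [::] (waddr (EM (at_ 3 (EG 7))) (EG 15)).
  by apply: ok_waddr; [do ?split|exact: I|rewrite -[ev _ _ _ _]/v; lia].
set a := wc (tgt u) v in E4 *.
set s4 := setr s3 16 a.
have Es4 : s' = if mem s a != 0 then s4 else den record s4.
  by rewrite Es /derive2 den_seq den_set E3 -/s3 den_seq den_set E4 -/s4 den_if.
have ok5 : sok q Z derive2 s2.
  split; first exact: ok3.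
  rewrite den_set E3 -/s3; split; first exact: ok4.
  rewrite den_set E4 -/s4.
  apply: sok_if => [|_|_]; [exact: I|exact: I|].
  exact: slf_ok.
have R4 x : x \notin temps -> regs s4 x = regs s x.
  by rewrite !inE !negb_or /= => /and5P[_ /negPf-> /negPf-> /negPf-> /negPf->].
have Wid4 : wstate s4 fs.
  by apply: (wstate_same W) => // x; rewrite !inE => /or4P[/eqP->|/eqP->|/eqP->|/or3P[/eqP->|/eqP->|/eqP->]].
have d3' : tgt u < D by case/andP: d3.
have Wa : mem s a = if (tgt u, v) \in fs then H + 4 * index (tgt u, v) fs else 0.
  by rewrite /a (hp_w hp).
case: (boolP ((tgt u, v) \in fs)) Wa => f3 Wa.
  rewrite Es4 Wa ifT; last by lia.
  split=> //; first by apply: oks.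
  by exists fs; split=> //; split=> //; exists [::]; rewrite cats0.
rewrite Wa eqxx [~~ true]/= in Es4.
have [a1 a2] := wc_range LD k0 VT HV d3' vV.
have sw1 : m0 u = 0 -> H <= w1 /\ w1 + 3 < H + 4 * size fs.
  have : index (c1 u, v1) fs < size fs by rewrite index_mem.
  by rewrite W1; move: (index _ _) => i il _; lia.
have [||||||||||M R9 Rx] := record_spec q LD k0 VT HV (s := s4) (u := u)
  (w1 := w1) (w2 := w2) (a := a) (tl := H + 4 * size fs).
- exact: r1.
- exact: r7.
- exact: ws_9 W.
- by [].
- by [].
- by [].
- by lia.
- by lia.
- by rewrite a1 a2.
- by rewrite -[mem s4]/(mem s) (hp_static hp) //; lia.
rewrite -Es4 in M R9 Rx.
split; first by apply: oks.
  move=> x xt; rewrite Rx ?R4 //.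
  by move: xt; rewrite !inE !negb_or => /andP[].
have F : tgt u = mem s4 (cell 3 u) by rewrite -[mem s4]/(mem s) stat.
exists (rcons fs (tgt u, v)); split; last by rewrite mem_rcons inE eqxx.
split; last by exists [:: (tgt u, v)]; rewrite cats1.
split.
- by rewrite Rx //; exact: ws_0 W.
- by rewrite Rx.
- by rewrite Rx //; exact: ws_2 W.
- by rewrite Rx //; exact: ws_3 W.
- by rewrite Rx //; exact: ws_6 W.
- by rewrite size_rcons R9; lia.
- apply: (heap_add LD S k0 VT HV hp ut f1 f2 W1 W2 f3); rewrite M -F //.
Qed.

Lemma den_rep e c s : den (SRep e c) s = iter (ev q s [::] e) (den c) s.
Proof. by []. Qed.

Lemma sok_seq a b s : sok q Z a s -> sok q Z b (den a s) -> sok q Z (SSeq a b) s.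
Proof. by move=> h1 h2; split. Qed.

Lemma sok_rep e c s : eok q Z s [::] e -> ev q s [::] e <= Z ->
  (forall j, j < ev q s [::] e -> sok q Z c (iter j (den c) s)) -> sok q Z (SRep e c) s.
Proof. by move=> *; split. Qed.

Lemma incr_spec x s fs : wstate s fs -> x \notin [:: 0; 1; 2; 3; 6; 9] ->
  wstate (den (incr x) s) fs.
Proof.
move=> W xn; apply: (wstate_same W) => // y yin /=.
by case: eqP => // e; rewrite e in yin; rewrite yin in xn.
Qed.

(** Only premises in the initial [fs] are promised: facts found meanwhile are still to come in the
    queue, and their users will be treated then. *)
Lemma inner_spec s fs u t v1 (s' := den inner s) :
  wstate s fs -> node u t -> regs s 7 = u -> regs s 11 = v1 -> regs s 12 = 0 -> v1 < V ->
  [/\ sok q Z inner s, forall x, x \notin 12 :: temps -> regs s' x = regs s x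
    & exists fs', derived s s' fs fs' /\ forall v2, v2 < V ->
      (c1 u, v1) \in fs -> (c2 u, v2) \in fs -> (tgt u, op u v1 v2) \in fs'].
Proof.
move=> W ut r7 r11 r12 v1V.
set body := SSeq derive (incr 12).
have eV : ev q s [::] (EG 3) = V by exact: ws_3 W.
pose I i s1 := [/\ forall x, x \notin 12 :: temps -> regs s1 x = regs s x, regs s1 12 = i
  & exists fs', derived s s1 fs fs' /\ forall v2, v2 < i ->
      (c1 u, v1) \in fs -> (c2 u, v2) \in fs -> (tgt u, op u v1 v2) \in fs'].
have step i s1 : i < V -> I i s1 -> sok q Z body s1 /\ I i.+1 (den body s1).
  move=> iV [R1 R12 [fs1 [[W1 [new E1]] H1]]].
  have e7 : regs s1 7 = u by rewrite R1.
  have e11 : regs s1 11 = v1 by rewrite R1.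
  have [ok R2 [fs2 [[W2 [new2 E2]] H2]]] := derive_spec W1 ut e7 e11 R12 v1V iV.
  split; first by apply: sok_seq; [exact: ok|do ?split].
  rewrite /body den_seq; split.
  - move=> x xn; move: (xn); rewrite inE negb_or => /andP[/negPf x12 xt].
    by rewrite -[LHS]/(if x == 12 then regs (den derive s1) 12 + 1 else regs (den derive s1) x)
      x12 R2 ?R1.
  - by rewrite /incr den_set -[LHS]/(regs (den derive s1) 12 + 1) R2 // R12 addn1.
  exists fs2; split.
    split; first exact: incr_spec.
    by exists (new ++ new2); rewrite catA -E1 -E2.
  have sub p : p \in fs1 -> p \in fs2 by rewrite E2 mem_cat => ->.
  have sub0 p : p \in fs -> p \in fs1 by rewrite E1 mem_cat => ->.
  move=> v2; rewrite ltnS leq_eqVlt => /orP[/eqP-> h1 h2|lt h1 h2].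
    by apply: H2; apply: sub0.
  by apply: sub; apply: H1.
have I0 : I 0 s.
  by split=> //; exists fs; split=> //; split=> //; exists [::]; rewrite cats0.
have IV j : j <= V -> I j (iter j (den body) s).
  by apply: iter_rule => // i s1 iV /(step _ _ iV)[].
have [R1 _ h] := IV V (leqnn _).
have es : s' = iter V (den body) s by rewrite /s' /inner den_rep eV.
rewrite es; split=> //; apply: sok_rep; rewrite ?eV //.
by move=> j jV; have [] := step j _ jV (IV j (ltnW jV)).
Qed.

Definition rtemps := 11 :: 12 :: temps.

Lemma recompute_spec s fs u t (s' := den recompute s) :
  wstate s fs -> node u t -> regs s 7 = u ->
  [/\ sok q Z recompute s, forall x, x \notin rtemps -> regs s' x = regs s x
    & exists fs', derived s s' fs fs' /\ forall v1 v2, v1 < V -> v2 < V ->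
      (c1 u, v1) \in fs -> (c2 u, v2) \in fs -> (tgt u, op u v1 v2) \in fs'].
Proof.
move=> W0 ut r7.
set s0 := setr s 11 0.
have W : wstate s0 fs.
  by apply: (wstate_same W0) => // x; rewrite !inE => /or4P[/eqP->|/eqP->|/eqP->|/or3P[/eqP->|/eqP->|/eqP->]].
set mid := SSeq (SSet 12 (EC 0)) inner.
set body := SSeq mid (incr 11).
have eV : ev q s0 [::] (EG 3) = V by exact: ws_3 W.
pose I i s1 := [/\ forall x, x \notin rtemps -> regs s1 x = regs s x, regs s1 11 = i
  & exists fs', derived s s1 fs fs' /\ forall v1 v2, v1 < i -> v2 < V ->
      (c1 u, v1) \in fs -> (c2 u, v2) \in fs -> (tgt u, op u v1 v2) \in fs'].
have step i s1 : i < V -> I i s1 -> sok q Z body s1 /\ I i.+1 (den body s1).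
  move=> iV [R1 R11 [fs1 [[W1 [new E1]] H1]]].
  set s2 := setr s1 12 0.
  have e7 : regs s2 7 = u by rewrite -[LHS]/(regs s1 7) R1.
  have W2 : wstate s2 fs1.
    by apply: (wstate_same W1) => // x; rewrite !inE => /or4P[/eqP->|/eqP->|/eqP->|/or3P[/eqP->|/eqP->|/eqP->]].
  have [ok R2 [fs2 [[W3 [new2 E2]] H2]]] := inner_spec W2 ut e7 R11 erefl iV.
  set s3 := den inner s2 in R2 W3.
  have em : den mid s1 = s3 by rewrite /mid den_seq.
  split.
    by apply: sok_seq; [apply: sok_seq; [exact: Logic.I|exact: ok]|do ?split].
  rewrite /body den_seq em; split.
  - move=> x xn; move: (xn); rewrite /rtemps inE negb_or => /andP[x11 xt].
    rewrite -[LHS]/(if x == 11 then regs s3 11 + 1 else regs s3 x) (negPf x11) R2 //.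
    move: (xt); rewrite inE negb_or => /andP[x12 _].
    by rewrite -[LHS]/(if x == 12 then 0 else regs s1 x) (negPf x12) R1.
  - by rewrite -[LHS]/(regs s3 11 + 1) R2 // -[regs s2 11]/(regs s1 11) R11 addn1.
  exists fs2; split.
    split; first exact: incr_spec.
    by exists (new ++ new2); rewrite catA -E1 -E2.
  have sub p : p \in fs1 -> p \in fs2 by rewrite E2 mem_cat => ->.
  have sub0 p : p \in fs -> p \in fs1 by rewrite E1 mem_cat => ->.
  move=> v1 v2; rewrite ltnS leq_eqVlt => /orP[/eqP-> v2V h1 h2|lt v2V h1 h2].
    by apply: H2 => //; apply: sub0.
  by apply: sub; apply: H1.
have I0 : I 0 s0.
  split=> //.
    move=> x; rewrite /rtemps inE negb_or => /andP[/negPf x11 _].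
    by rewrite -[LHS]/(if x == 11 then 0 else regs s x) x11.
  by exists fs; split=> //; split=> //; exists [::]; rewrite cats0.
have IV j : j <= V -> I j (iter j (den body) s0).
  by apply: iter_rule => // i s1 iV /(step _ _ iV)[].
have [R1 _ h] := IV V (leqnn _).
have es : s' = iter V (den body) s0.
  by rewrite /s' /recompute den_seq -/s0 /outer den_rep -[den _ s]/s0 eV.
rewrite es; split=> //; apply: sok_seq; first exact: Logic.I.
apply: sok_rep; rewrite -[den _ s]/s0 ?eV //.
by move=> j jV; have [] := step j _ jV (IV j (ltnW jV)).
Qed.

Definition closed fs (done todo : seq _) := forall u t v1 v2, node u t ->
  (c1 u, v1) \in done -> (c2 u, v2) \in done -> u \notin todo ->
  (tgt u, op u v1 v2) \in fs.

(* [todo] holds the users still to be treated of the fact number [h - 1]. *)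
Record linv s fs h (todo : seq nat) : Prop := LInv {
  li_w : wstate s fs;
  li_8 : regs s 8 = H + 4 * h;
  li_h : h <= size fs;
  li_chain : chain D m0 (regs s 7) todo;
  li_todo : forall u, u \in todo -> exists t, node u t;
  li_closed : closed fs (take h fs) todo
}.

(** One turn pops the fact and one more treats each of its users. *)
Definition work (l : seq (nat * nat)) := \sum_(p <- l) (size (users p.1)).+1.

Lemma main_step s fs h todo : linv s fs h todo ->
  sok q Z main_body s /\
  ((todo = [::] /\ h = size fs /\ den main_body s = s) \/
   exists fs' h' todo', [/\ linv (den main_body s) fs' h' todo',
     (todo != [::]) || (h < size fs) &
     work (take h' fs') + size todo = work (take h fs) + size todo' + 1]).
Proof.
move=> I; have W := li_w I; have hp := ws_heap W; have r1 := ws_1 W.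
have lD := LD1; have h6 := H6.
case: todo I => [|u l] I.
  have r7 : regs s 7 = 0 by exact: li_chain I.
  have [hs|hs] := ltnP h (size fs); last first.
    have eh : h = size fs by apply/eqP; rewrite eqn_leq hs (li_h I).
    have E : ev q s [::] (elt (EG 8) (EG 9)) = 0.
      by rewrite -[LHS]/(nat_of_bool (regs s 8 < regs s 9)) (li_8 I) (ws_9 W) eh ltnn.
    split.
      apply: sok_if => [|h1|_]; [exact: Logic.I| |].
        by move: h1; rewrite -[ev _ _ _ _]/(regs s 7) r7.
      by apply: sok_if => [|h1|_]; [split|rewrite E in h1|exact: Logic.I].
    left; split=> //; split=> //.
    by rewrite /main_body den_if -[ev _ _ _ (EG 7)]/(regs s 7) r7 eqxx den_if E.
  have E : ev q s [::] (elt (EG 8) (EG 9)) = 1.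
    by rewrite -[LHS]/(nat_of_bool (regs s 8 < regs s 9)) (li_8 I) (ws_9 W); lia.
  split.
    apply: sok_if => [|h1|_]; [exact: Logic.I| |].
      by move: h1; rewrite -[ev _ _ _ _]/(regs s 7) r7.
    by apply: sok_if => [|_|]; [split|do ?split|rewrite E].
  right; set x := (nth (0, 0) fs h).1; set v := (nth (0, 0) fs h).2.
  have xv : nth (0, 0) fs h = (x, v) by rewrite /x /v; case: (nth _ _ _).
  have xin : (x, v) \in fs by rewrite -xv mem_nth.
  have [xD vV] := hp_in hp xin.
  have [ch us] := usersP LD S xD.
  have Ex : ev q s [::] (EM (at_ 4 (EM (eadd (EG 8) (EC 3))))) = m0 (cell 4 x).
    rewrite -[LHS]/(mem s (ev q s [::] (at_ 4 (EM (eadd (EG 8) (EC 3)))))) ev_at r1.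
    rewrite -[ev _ _ _ (EM _)]/(mem s (regs s 8 + 3)) (li_8 I) (hp_x hp) // -/x.
    by rewrite (hp_static hp) // /cell; lia.
  have Ed : den main_body s = setr (setr s 7 (m0 (cell 4 x))) 8 (regs s 8 + 4).
    rewrite /main_body den_if ifF; last by rewrite -[ev _ _ _ _]/(regs s 7) r7.
    by rewrite den_if E den_seq !den_set Ex.
  exists fs, h.+1, (users x); rewrite Ed; split; [|by []|]; last first.
    by rewrite (take_nth (0, 0)) // /work -cats1 big_cat /= big_seq1 xv /=; lia.
  split=> //.
  - by apply: (wstate_same W) => // y; rewrite !inE => /or4P[/eqP->|/eqP->|/eqP->|/or3P[/eqP->|/eqP->|/eqP->]].
  - by rewrite -[LHS]/(regs s 8 + 4) (li_8 I); lia.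
  move=> u t v1 v2 ut; have [_ _ _ n1 n2] := node_args LD S ut.
  rewrite (take_nth (0, 0)) // xv !mem_rcons !inE => f1 f2 un.
  have [c1x|c1x] := eqVneq (c1 u) x; first by move: n1; rewrite -/(c1 u) c1x (negPf un).
  rewrite xpair_eqE (negPf c1x) /= in f1.
  have [c2x|c2x] := eqVneq (c2 u) x; last first.
    rewrite xpair_eqE (negPf c2x) /= in f2.
    exact: (li_closed I ut f1 f2).
  (* If the popped fact is the dummy one, it is number 0 and nothing was popped before it, against
     [f1]. *)
  have [x0|x0] := eqVneq x 0.
    have v0 : v = 0 by apply: (hp_nz hp); rewrite -x0.
    have : index (x, v) fs = h by rewrite -xv index_uniq // (hp_uniq hp).
    have : index (0, 0) fs = 0 by rewrite -[X in index X](hp_0 hp) index_uniq ?(hp_uniq hp) ?(hp_size hp).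
    rewrite x0 v0 => -> h0; move: f1; by rewrite -h0 take0.
  by move: n2; rewrite -/(c2 u) c2x (negPf un) => /(_ x0).
have [r7 u0 ch] := li_chain I.
have [|t ut] := li_todo I (u := u); first by rewrite inE eqxx.
have [ok R [fs' [[W' [new E']] Hn]]] := recompute_spec W ut r7.
set s1 := den recompute s in R W'.
have [u6 uL] := node_range LD S ut; have tg := code_gt0 t.
have E7 : ev q s1 [::] (EM (at_ 5 (EG 7))) = m0 (cell 5 u).
  rewrite -[LHS]/(mem s1 (ev q s1 [::] (at_ 5 (EG 7)))) ev_at (ws_1 W').
  by rewrite -[ev _ _ _ (EG 7)]/(regs s1 7) R // r7 (hp_static (ws_heap W')) // /cell; lia.
have un0 : ev q s [::] (EG 7) != 0 by rewrite -[ev _ _ _ _]/(regs s 7) r7; lia.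
have Ed : den main_body s = setr s1 7 (m0 (cell 5 u)).
  by rewrite /main_body den_if un0 den_seq den_set -/s1 E7.
split.
  apply: sok_if => [|_|h1]; [exact: Logic.I| |by rewrite h1 in un0].
  by apply: sok_seq; [exact: ok|do ?split].
right; exists fs', h, l; rewrite Ed; have hh := li_h I.
have tk : take h fs' = take h fs.
  by rewrite E' takel_cat.
split; [|by []|by rewrite tk /=; lia].
split=> //.
- by apply: (wstate_same W') => // y; rewrite !inE => /or4P[/eqP->|/eqP->|/eqP->|/or3P[/eqP->|/eqP->|/eqP->]].
- by rewrite -[LHS]/(regs s1 8) R // (li_8 I).
- by rewrite E' size_cat; lia.
- by move=> z zl; apply: (li_todo I); rewrite inE zl orbT.
rewrite tk => z tz v1 v2 nz f1 f2 zl.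
have [zu|zu] := eqVneq z u.
  rewrite zu in f1 f2 *.
  have g1 := mem_take f1; have g2 := mem_take f2.
  by apply: Hn => //; [have [] := hp_in hp g1|have [] := hp_in hp g2].
by rewrite E' mem_cat (li_closed I nz f1 f2) // inE negb_or zu.
Qed.

(** Facts are distinct, so each [x] occurs in at most [V] of them. The 3 comes from one pop for each
    of the [D] indices and at most [L + L] users in all. *)
Lemma work_bound m fs : heap m fs -> work fs <= V * (3 * D).
Proof.
move=> hp; have tot := users_total LD S; have lD := LD1.
pose pairs := [seq (x, v) | x <- iota 0 D, v <- iota 0 V].
apply: (@leq_trans (work pairs)).
  apply: sum_subset (hp_uniq hp) _ => -[x v] /(hp_in hp)[xD vV].
  by apply/allpairsP; exists (x, v); rewrite !mem_iota.
rewrite /work /pairs big_allpairs /=.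
rewrite (eq_bigr (fun x => V * (size (users x)).+1)); last first.
  by move=> x _; rewrite big_const_seq count_predT size_iota iter_addn_0 mulnC.
rewrite -big_distrr /= leq_mul2l; apply/orP; right.
rewrite -[X in iota _ X]subn0 -/(index_iota 0 D) big_mkord.
under eq_bigr do rewrite -add1n.
rewrite big_split /= sum1_card card_ord.
by move: tot; set X := \sum_(x < D) _ => tot; lia.
Qed.

Lemma main_loop s fs : linv s fs 0 [::] ->
  forall i, i <= V * (3 * D) ->
  exists fs' h todo, linv (iter i (den main_body) s) fs' h todo /\
    ((todo = [::] /\ h = size fs') \/ i + size todo = work (take h fs')).
Proof.
move=> I0; elim=> [|i IH] iN.
  by exists fs, 0, [::]; split=> //; right; rewrite take0 /work big_nil.
have [fs' [h [todo [I hi]]]] := IH (ltnW iN).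
have [_ [[e1 [e2 e3]]|[fs2 [h2 [todo2 [I2 nd e]]]]]] := main_step I.
  by exists fs', h, todo; rewrite iterS e3; split=> //; left.
case: hi => [[e1 e2]|hi].
  by rewrite e1 e2 eqxx ltnn in nd.
by exists fs2, h2, todo2; rewrite iterS; split=> //; right; lia.
Qed.

End Loop.

Lemma nth_flatten_tuples k (l : seq (k.-tuple rat)) t0 i a : i < size l -> a < k ->
  nth 0%R (flatten [seq tval t | t <- l]) (i * k + a) = nth 0%R (nth t0 l i) a.
Proof.
elim: l i => //= t l IH [|i] il ak; rewrite nth_cat size_tuple; first by rewrite mul0n ak.
rewrite mulSn -addnA ltnNge leq_addr /= addnC addnK; exact: IH.
Qed.

(** * Acceptance of a value by the examples *)

Section Accept.

Variables (k : nat) (P N : seq (k.-tuple rat)) (s : state).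
Let q := rat_tape P N.
Let m := size P + size N.
Let T := if m == 0 then 0 else k ^ k.
Hypotheses (s0 : mem s 0 = k) (s1 : mem s 1 = size P) (s2 : mem s 2 = size N)
  (sT : regs s 2 = T).

Lemma typbP t0 f i : i < m ->
  reflect (same_type (dec f) (tnth (nth t0 (P ++ N) i))) (typb q s f i).
Proof.
move=> im.
have E (a : 'I_k) : nth 0%R q (i * k + a) = tnth (nth t0 (P ++ N) i) a.
  rewrite /q /rat_tape (nth_flatten_tuples t0) ?size_cat //.
  by rewrite (tnth_nth 0%R).
rewrite /typb s0 /=; apply: (iffP allP) => [h a b|h a].
  have := h a; rewrite mem_iota => /(_ (ltn_ord a))/allP/(_ b).
  by rewrite mem_iota => /(_ (ltn_ord b))/eqP; rewrite dec_lt -!E.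
rewrite mem_iota => /= ak; apply/allP => b; rewrite mem_iota => /= bk.
have := h (Ordinal ak) (Ordinal bk); rewrite dec_lt -!E /= => ->.
by [].
Qed.

(** A tuple has some code by [dec_onto], and by [sat_same_type] all its codes carry the truth value
    of [phi] at the tuple. *)
Lemma acceptbP phi :
  acceptb q s (val T phi) <->
  (forall t, t \in P -> models t phi) /\ (forall t, t \in N -> ~ models t phi).
Proof.
(* Without examples [T] is 0 and [val_sat] says nothing, but both sides hold trivially. *)
have [m0|m0] := eqVneq m 0.
  have [P0 N0] : P = [::] /\ N = [::].
    by split; apply: size0nil; move: m0; rewrite /m; lia.
  rewrite /acceptb s1 s2 -/m m0; split=> // _; rewrite P0 N0; by split.
have TE : T = k ^ k by rewrite /T (negPf m0).
pose t0 : k.-tuple rat := nseq_tuple k 0%R.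
have key i : i < m ->
    all (fun f => typb q s f i ==> (bit (val T phi) f == (i < size P))) (iota 0 T)
    <-> (models (nth t0 (P ++ N) i) phi <-> i < size P).
  move=> im; split=> [/allP h|h].
    have [f fk same] := dec_onto (tnth (nth t0 (P ++ N) i)).
    have := h f; rewrite mem_iota TE => /(_ fk).
    have -> : typb q s f i by apply/(typbP t0).
    move=> /eqP <-; rewrite /models -(sat_same_type phi same).
    by apply: iff_sym; exact: val_sat.
  apply/allP => f; rewrite mem_iota TE => /= fk; apply/implyP => /(typbP t0 _ im) same.
  have e := val_sat phi fk; rewrite (sat_same_type phi same) in e.
  by apply/eqP; apply/idP/idP => [/e/h|/h/e].
rewrite /acceptb s1 s2 sT -/m; split=> [/allP h|[hP hN]].
  split=> t tin.
    have ip : index t P < size P by rewrite index_mem.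
    have im : index t P < m by rewrite /m; lia.
    have := h (index t P); rewrite mem_iota => /(_ im)/(key _ im).
    by rewrite nth_cat ip nth_index // => e; apply/e.
  have ip : index t N < size N by rewrite index_mem.
  have im : size P + index t N < m by rewrite /m; lia.
  have := h (size P + index t N); rewrite mem_iota => /(_ im)/(key _ im).
  rewrite nth_cat ltnNge leq_addr /= addnC addnK nth_index // => e /e.
  by lia.
apply/allP => i; rewrite mem_iota => /= im; apply/(key _ im).
rewrite nth_cat; case: ltnP => ip; split=> // h.
  by apply: hP; apply: mem_nth.
have lt : i - size P < size N by rewrite ltn_subLR.
by case: (hN _ (mem_nth t0 lt)).
Qed.

End Accept.

Lemma der_leaf_inv k (G : grammar k) A phi :
  der (G := G) (Leaf A) phi -> exists2 t, is_rule A t & der t phi.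
Proof. by move=> d; inversion d; subst; exists s. Qed.

(** * Completeness of a closed set of facts *)

Section Complete.

Variables (q : seq rat) (k : nat) (G : grammar k) (w : seq nat).
Variables (L D T V H : nat) (m0 : nat -> nat) (U : nat -> seq nat).
Hypotheses (LD : D = L + nnt G) (S : static G w L D m0 U).
Variable fs : seq (nat * nat).
Hypotheses (fs0 : (0, 0) \in fs) (cl : closed G D T m0 fs fs [::]).

(** Induction on the derivation and not on the term, because a nonterminal leaf continues in a whole
    right-hand side. The conclusion is about [tgt], so the root of that side yields a fact on the
    nonterminal. *)
Lemma complete t phi : der t phi -> forall y, @node k G y t ->
  (tgt D m0 y, val T phi) \in fs.
Proof.
elim=> {t phi} [A t phi r _ IH|i j|i j|t p _ IH|t1 t2 p1 p2 _ IH1 _ IH2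
  |t1 t2 p1 p2 _ IH1 _ IH2|i t p _ IH|i t p _ IH] y yt.
all: have := st_loc S yt => /=.
all: have nm j' := node_mem LD S (i := j') yt; rewrite /= in nm.
all: have t0 := node_mem LD S (i := 0) yt (code_gt0 _); rewrite addn0 in t0.
all: rewrite /= in t0.
all: have cl' v1 v2 := cl (u := y) (v1 := v1) (v2 := v2) yt; rewrite /op t0 in cl'.
- move=> [e1 e2 _].
  have [y0 h0] := rule_atP 6 r.
  have n0 : node y0 t by exists y0, A, t; split=> //; exact: insub_refl.
  have := IH _ n0; rewrite /tgt (st_tgt S h0) => f1.
  have := cl' (val T phi) 0; rewrite opv_copy; apply=> //.
    by rewrite /c1 e1.
  by rewrite /c2 e2.
- move=> [e1 e2 _]; have := cl' 0 0; rewrite !nm //=; apply=> //.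
    by rewrite /c1 e1.
  by rewrite /c2 e2.
- move=> [e1 e2 _]; have := cl' 0 0; rewrite !nm //=; apply=> //.
    by rewrite /c1 e1.
  by rewrite /c2 e2.
- move=> [[e1 e3 _] e2]; have := IH (y + 1).
  rewrite /tgt e3 => f1; apply: (cl' (val T p) 0) => //.
    by rewrite /c1 e1; apply: f1; apply: node_sub yt _; right; exact: insub_refl.
  by rewrite /c2 e2.
- move=> [[e1 e3 _] [e2 e4 _]].
  have := IH1 (y + 1); have := IH2 (y + 1 + size (code_term t1)).
  rewrite /tgt e3 e4 => f2 f1; apply: (cl' (val T p1) (val T p2)) => //.
    by rewrite /c1 e1; apply: f1; apply: node_sub yt _; right; left; exact: insub_refl.
  by rewrite /c2 e2; apply: f2; apply: node_sub yt _; right; right; exact: insub_refl.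
- move=> [[e1 e3 _] [e2 e4 _]].
  have := IH1 (y + 1); have := IH2 (y + 1 + size (code_term t1)).
  rewrite /tgt e3 e4 => f2 f1; apply: (cl' (val T p1) (val T p2)) => //.
    by rewrite /c1 e1; apply: f1; apply: node_sub yt _; right; left; exact: insub_refl.
  by rewrite /c2 e2; apply: f2; apply: node_sub yt _; right; right; exact: insub_refl.
- move=> [[e1 e3 _] e2]; have := IH (y + 2).
  rewrite /tgt e3 => f1; have := cl' (val T p) 0; rewrite nm //; apply=> //.
    by rewrite /c1 e1; apply: f1; apply: node_sub yt _; right; exact: insub_refl.
  by rewrite /c2 e2.
- move=> [[e1 e3 _] e2]; have := IH (y + 2).
  rewrite /tgt e3 => f1; have := cl' (val T p) 0; rewrite nm //; apply=> //.
    by rewrite /c1 e1; apply: f1; apply: node_sub yt _; right; exact: insub_refl.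
  by rewrite /c2 e2.
Qed.

Lemma complete_lang phi : lang G phi -> (L + start G, val T phi) \in fs.
Proof.
move=> /lang_der/der_leaf_inv[t r d'].
have [y0 h0] := rule_atP 6 r.
have n0 : node y0 t by exists y0, (start G), t; split=> //; exact: insub_refl.
by have := complete d' n0; rewrite /tgt (st_tgt S h0).
Qed.

End Complete.

(** The result 0 means that nothing was accepted; this is unambiguous as only non-zero entries are
    kept. *)
Lemma fold_find (W : nat -> nat) (p : nat -> bool) n
  (r := foldl (fun acc v => if W v != 0 then (if p v then W v else acc) else acc)
    0 (iota 0 n)) :
  (r = 0 /\ forall v, v < n -> W v != 0 -> ~~ p v) \/
  (r != 0 /\ exists2 v, v < n & W v = r /\ p v).
Proof.
rewrite /r {r}; elim: n => [|n IH]; first by left.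
rewrite iota0S foldl_cat /=.
case: (eqVneq (W n) 0) => [e|ne] /=.
  case: IH => [[-> h]|[h1 [v vn hv]]]; [left|right].
    split=> // v; rewrite ltnS leq_eqVlt => /orP[/eqP->|]; [by rewrite e|exact: h].
  by split=> //; exists v; [lia|].
case: (boolP (p n)) => pn; first by right; split=> //; exists n.
case: IH => [[-> h]|[h1 [v vn hv]]]; [left|right].
  split=> // v; rewrite ltnS leq_eqVlt => /orP[/eqP->//|]; exact: h.
by split=> //; exists v; [lia|].
Qed.

(** * The program *)

(** The [EIf] avoids computing [k ^ k] without examples, when the time may not depend on [k].
    Parsing starts at cell 6, after the six header cells. *)
Definition setup :=
  SSeq (SSet 1 (eadd (EG 0) (EM (EC 3))))
  (SSeq (SSet 2 (EIf (eadd (EM (EC 1)) (EM (EC 2)))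
                     (epow (EM (EC 0)) (EM (EC 0))) (EC 0)))
  (SSeq (SSet 3 (epow (EC 2) (EG 2)))
  (SSeq (SSet 6 (waddr (EC 0) (EG 3)))
  (SSeq (SSet 4 (EC 6)) (SSet 5 (EG 6)))))).

(** Enters the dummy fact as record number 0: its address [H] goes to the cell of index 0 and value
    0, and the index 0 to the fourth cell of the record. Popping it sets off all atoms. *)
Definition start_main :=
  SSeq (SSt (at_ 6 (EC 0)) (EG 6))
  (SSeq (SSt (eadd (EG 6) (EC 3)) (EC 0))
  (SSeq (SSet 7 (EC 0))
  (SSeq (SSet 8 (EG 6)) (SSet 9 (eadd (EG 6) (EC 4)))))).

(** The bound of [work_bound], computed in advance because a loop fixes its number of turns at the
    start; the product is a loop of V turns. *)
Definition countE := emul (EG 3) (at_ 3 (EC 0)).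

Definition startW := waddr (eadd (EG 0) (EM (EC 4))) (EV 1).

Definition searchE :=
  EFold (EG 3) (EC 0)
    (EIf (EM startW)
       (EIf (ECall (EV 1) (EC 0) (EC 0) acceptE) (EM startW) (EV 0)) (EV 0)).

Definition answer := SSeq (SSet 1 searchE) (SSet 0 (elt (EC 0) (EG 1))).

Definition program :=
  SSeq setup (SSeq (SRep (EG 0) parse_body)
    (SSeq start_main (SSeq (SRep countE main_body) answer))).

Lemma program_wf : swf program.
Proof. by vm_compute. Qed.

Lemma scost_seq q a b s : scost q (SSeq a b) s = scost q a s + scost q b (den q a s).
Proof. by []. Qed.

Lemma ev_epow q s r a b : ev q s r (epow a b) = ev q s r a ^ ev q s r b.
Proof. by rewrite -(ev_pow q s _ _ 0). Qed.

Lemma ev_emul q s r a b : ev q s r (emul a b) = ev q s r a * ev q s r b.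
Proof. by rewrite -(ev_mul q s _ _ 0). Qed.

(** Here [y] is the power of [Z] that bounds one turn. The number [V] of values costs one more
    factor [Z], and the grammar enters by the single factor [D]. *)
Lemma cost_arith (y a b c d e f x1 x2 x3 x4 x5 D L V Z : nat) :
  0 < y -> L <= D -> 0 < D -> V <= Z -> 0 < Z ->
  x1 <= a * y -> x2 <= 2 + 6 + L * (b * y + 10) -> x3 <= c * y ->
  x4 <= d * y + 6 + V * (3 * D) * (e * y + 10) -> x5 <= f * y ->
  x1 + (x2 + (x3 + (x4 + x5))) <=
    (a + (b + 18) + c + (d + 6 + 3 * (e + 10)) + f) * (Z * y) * D.
Proof.
move=> y0 LD D0 VZ Z0 C1 C2 C3 C4 C5.
have yA : y <= Z * y * D by rewrite mulnAC leq_pmull // muln_gt0 Z0.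
have one : 1 <= Z * y * D by rewrite !muln_gt0 Z0 y0.
have B2 : L * (b * y + 10) <= (b + 10) * (Z * y * D).
  have -> : (b + 10) * (Z * y * D) = D * (Z * ((b + 10) * y)) by lia.
  by apply: leq_mul => //; rewrite (leq_trans _ (leq_pmull _ Z0)) // mulnDl leq_add2l leq_pmulr.
have B4 : V * (3 * D) * (e * y + 10) <= 3 * (e + 10) * (Z * y * D).
  have -> : 3 * (e + 10) * (Z * y * D) = Z * (3 * D) * ((e + 10) * y) by lia.
  apply: leq_mul; first by rewrite leq_mul2r VZ orbT.
  by rewrite mulnDl leq_add2l leq_pmulr.
have T1 : a * y <= a * (Z * y * D) by rewrite leq_mul2l yA orbT.
have T3 : c * y <= c * (Z * y * D) by rewrite leq_mul2l yA orbT.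
have T4 : d * y <= d * (Z * y * D) by rewrite leq_mul2l yA orbT.
have T5 : f * y <= f * (Z * y * D) by rewrite leq_mul2l yA orbT.
rewrite -[_ * (Z * y) * D]mulnA; move: one B2 B4 T1 T3 T4 T5 C1 C2 C3 C4 C5.
move: (Z * y * D) => A.
move: (L * _) (V * _ * _) (a * y) (c * y) (d * y) (f * y) => *; nia.
Qed.

(** * The run on a given input and its cost *)

Section Run.

Variables (k : nat) (P N : seq (k.-tuple rat)) (G : grammar k).
Let q := rat_tape P N.
Let w := code_input P N G.
Let n := nnt G.
Let L := size w.
Let D := L + n.
Let m := size P + size N.
Let T := if m == 0 then 0 else k ^ k.
Let V := 2 ^ T.
Let H := 6 * D + V * D.
Let X := m * k ^ k.
(** The successor makes [Z] at least 2 also for [X = 0]. *)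
Let Z := 2 ^ X.+1.
Let LD : D = L + nnt G := erefl.
Let VT : V = 2 ^ T := erefl.
Let HV : H = 6 * D + V * D := erefl.
Let HD : 6 * D <= H := leq_addr _ _.
Notation den := (den q).

Lemma k_le_pow : k <= k ^ k.
Proof. by case: (k) => // k'; rewrite -{1}[k'.+1]expn1 leq_pexp2l. Qed.

Lemma kk_gt0 : 0 < k ^ k.
Proof. by rewrite expn_gt0; case: (k). Qed.

Lemma T_le : T <= X.
Proof. by rewrite /T /X; case: eqVneq => // m0; rewrite leq_pmull // lt0n. Qed.

Lemma X_lt : X < Z.
Proof. by apply: ltnW; exact: ltn_expl. Qed.

Lemma T_Z : T <= Z.
Proof. exact: leq_trans T_le (ltnW X_lt). Qed.

Lemma V_Z : V <= Z.
Proof. by rewrite /V /Z leq_exp2l // ltnW // ltnS T_le. Qed.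

Lemma two_Z : 2 <= Z.
Proof. by rewrite /Z -{1}[2]expn1 leq_exp2l. Qed.

Lemma m_Z : m <= Z.
Proof.
apply: leq_trans (ltnW X_lt); rewrite /X leq_pmulr //; exact: kk_gt0.
Qed.

Lemma k_Z : m != 0 -> k <= Z.
Proof.
move=> m0; apply: leq_trans k_le_pow (leq_trans _ (ltnW X_lt)).
by rewrite /X leq_pmull // lt0n.
Qed.

Lemma kZ_T : 0 < T -> 2 <= Z /\ k <= Z.
Proof. by rewrite /T; case: eqVneq => // m0 _; split; [exact: two_Z|exact: k_Z]. Qed.

Let s0 := init_state w.

Lemma header : [/\ nth 0 w 0 = k, nth 0 w 1 = size P, nth 0 w 2 = size N,
  nth 0 w 3 = n & nth 0 w 4 = start G].
Proof. by []. Qed.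

Lemma code_at6 : at_code w 6 (codes (rules G)).
Proof. by move=> i _; rewrite addnC /w /code_input nth_cat /= ltnNge leq_addl /= addnK. Qed.

Lemma L_eq : 6 + size (codes (rules G)) = L.
Proof. by []. Qed.

Let s1 := setr (setr (setr (setr (setr (setr s0 1 D) 2 T) 3 V) 6 H) 4 6) 5 H.

Lemma setup_spec : den setup s0 = s1 /\ sok q Z setup s0.
Proof.
have [h0 h1 h2 h3 h4] := header.
have e1 : ev q s0 [::] (eadd (EG 0) (EM (EC 3))) = D by [].
set sa := setr s0 1 D.
have e2 : ev q sa [::] (EIf (eadd (EM (EC 1)) (EM (EC 2)))
                     (epow (EM (EC 0)) (EM (EC 0))) (EC 0)) = T.
  rewrite -[LHS]/(if m != 0 then ev q sa [::] (epow (EM (EC 0)) (EM (EC 0))) else 0).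
  by rewrite ev_epow /T if_neg.
set sb := setr sa 2 T.
have e3 : ev q sb [::] (epow (EC 2) (EG 2)) = V by rewrite ev_epow.
set sc := setr sb 3 V.
have e4 : ev q sc [::] (waddr (EC 0) (EG 3)) = H.
  by rewrite ev_waddr -[regs sc 1]/D -[ev _ _ _ (EC 0)]/0 addn0.
split.
  rewrite /setup den_seq den_set e1 -/sa den_seq den_set e2 -/sb.
  by rewrite den_seq den_set e3 -/sc den_seq den_set e4 den_seq !den_set.
apply: sok_seq; first exact: elf_ok.
rewrite den_set e1 -/sa; apply: sok_seq.
  apply: ok_if => [|mn|_]; [exact: elf_ok| |exact: elf_ok].
  have kz : k <= Z by exact: k_Z.
  by apply: ok_call; [exact: elf_ok|exact: elf_ok|exact: elf_ok|exact: ok_pow].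
rewrite den_set e2 -/sb; apply: sok_seq.
  apply: ok_call; [exact: elf_ok|exact: elf_ok|exact: elf_ok|].
  by apply: ok_pow => [_|]; [exact: two_Z|exact: T_Z].
rewrite den_set e3 -/sc; apply: sok_seq; last exact: slf_ok.
by apply: ok_waddr; [exact: elf_ok|exact: elf_ok|exact: V_Z].
Qed.

Lemma pst1 : pst w L D T V H s1 6 [::] (fun=> [::]).
Proof.
split=> //; first by rewrite addn0.
  (* Cells past the input read 0, the default of [nth] in the initial memory. *)
  move=> y y6 _; rewrite -[LHS]/(nth 0 w y) nth_default //.
  by apply: leq_trans y6; rewrite (leq_trans (leq_addr n L)) // leq_pmull.
move=> x _; rewrite -[chain _ _ _ _]/(nth 0 w (cell D 4 x) = 0) nth_default //.
by rewrite (leq_trans (leq_addr n L)) // (leq_trans _ (leq_addr x _)) // leq_pmull.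
Qed.

Let s2 := iter L (den parse_body) s1.

Lemma parse_idle s i U : pst w L D T V H s L [::] U -> iter i (den parse_body) s = s.
Proof.
move=> p; elim: i => [|i IH]; first by [].
rewrite iterS IH.
have E : ev q s [::] (elt (EG 4) (EG 0)) = 0.
  by rewrite -[LHS]/(nat_of_bool (regs s 4 < regs s 0)) (p4 p) (p0 p) ltnn.
by rewrite /parse_body den_if E.
Qed.

Lemma parsed_all : exists U,
  pst w L D T V H s2 L [::] U /\ static G w L D (mem s2) U.
Proof.
have fr j x : 0 < j < 6 -> 6 <= x < 6 + size (codes (rules G)) -> mem s1 (cell D j x) = 0.
  case/andP=> j0 _ _; rewrite -[LHS]/(nth 0 w (cell D j x)) nth_default //.
  by rewrite (leq_trans (leq_addr n L)) // (leq_trans _ (leq_addr x _)) // leq_pmull.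
have [|i [U [iL R]]] := parse_rules q LD HD pst1 (isT : 0 < 6) _ code_at6 fr.
  by rewrite L_eq.
have iL' : i <= L by rewrite -L_eq; lia.
set sp := iter i _ s1 in R.
have R1 := pr_pst R; rewrite L_eq in R1.
have es : s2 = sp.
  by rewrite /s2 -(subnK iL') iterD -/sp (parse_idle _ R1).
exists U; rewrite es; split=> //.
split.
- exact: (pin R1).
- exact: code_at6.
- exact: L_eq.
- exact: (pr_tgt R).
- exact: (pr_loc R).
- move=> y yL; have [y6|y6] := ltnP y 6.
    left; rewrite (pr_unt R) //; last by lia.
    rewrite -[LHS]/(nth 0 w (cell D 4 y)) nth_default //.
    by rewrite (leq_trans (leq_addr n L)) // (leq_trans _ (leq_addr y _)) // leq_pmull.
  by apply: (pr_head R); rewrite L_eq; lia.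
- exact: (pch R1).
- move=> x y xn; have [new [-> h]] := pr_ext R xn; rewrite cats0; exact: h.
- have := pr_tot R; rewrite {2}/total big1 // add0n => h.
  by apply: leq_trans h _; rewrite -L_eq leq_addl.
Qed.

Lemma start_main_spec s (s' := den start_main s) U :
  pst w L D T V H s L [::] U -> static G w L D (mem s) U ->
  linv G L D T V H (mem s) s' [:: (0, 0)] 0 [::].
Proof.
move=> p S; have h6 : H + 3 <> 6 * D by move: HD; lia.
have D0 : 0 < D by rewrite /D /n; have := ltn_ord (start G); lia.
have e1 : ev q s [::] (at_ 6 (EC 0)) = 6 * D.
  by rewrite ev_at (p1 p) -[ev _ _ _ (EC 0)]/0 addn0.
have E : s' = setr (setr (setr (setm (setm s (6 * D) H) (H + 3) 0) 7 0) 8 H) 9 (H + 4).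
  rewrite /s' /start_main den_seq den_st e1.
  have -> : ev q s [::] (EG 6) = H by exact: p6 p.
  rewrite !den_seq den_st !den_set.
  set sx := setm s _ _; have e6 : regs sx 6 = H by exact: p6 p.
  rewrite -[ev q sx _ (eadd _ _)]/(regs sx 6 + 3) e6.
  set sy := setm sx _ _; have e7 : regs sy 6 = H by exact: p6 p.
  rewrite -[ev q _ _ (EG 6)]/(regs sy 6) e7.
  by rewrite -[ev q _ _ (eadd _ _)]/(regs sy 6 + 4) e7.
have M : mem s' = upd (upd (mem s) (6 * D) H) (H + 3) 0 by rewrite E.
have W0 x v : x < D -> v < V -> wc D x v = 6 * D -> (x, v) = (0, 0).
  rewrite /wc => _ _ e.
  have [-> /eqP] : x = 0 /\ v * D = 0 by move: (v * D) e => y e; lia.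
  by rewrite muln_eq0 => /orP[/eqP->//|/eqP d]; rewrite d in D0.
rewrite E; split; [|by rewrite muln0 addn0|by []|by []|by []|by rewrite take0].
split=> //; rewrite -?E.
- exact: (p0 p).
- exact: (p1 p).
- exact: (p2 p).
- exact: (p3 p).
- exact: (p6 p).
split=> //.
- by move=> y yD; rewrite M !upd_neq //; move: HD; lia.
- move=> x v xD vV; have := W0 x v xD vV; rewrite inE M.
  have [c1 c2] : 6 * D <= wc D x v /\ wc D x v < H by rewrite /wc /H; split; nia.
  case: eqP => [[-> ->] _|ne h].
    have e0 : wc D 0 0 = 6 * D by rewrite /wc mul0n !addn0.
    by rewrite e0 upd_neq; [rewrite upd_eq // muln0 addn0|exact/nesym].
  rewrite upd_neq; last by lia.
  by rewrite upd_neq ?(pW p) //; move=> /h.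
- by case=> // _; rewrite M upd_eq //; lia.
- move=> x v; rewrite inE => /eqP[-> ->]; split=> //; by rewrite /V expn_gt0.
- by move=> v; rewrite inE => /eqP[].
- by move=> x v; rewrite inE => /eqP[-> _]; rewrite eqxx.
Qed.

Let s3 := den start_main s2.

Let s4 := iter (V * (3 * D)) (den main_body) s3.

Lemma count_spec s : regs s 1 = D -> regs s 3 = V -> ev q s [::] countE = V * (3 * D).
Proof.
move=> r1 r3; rewrite /countE ev_emul ev_at r1 -[ev _ _ _ (EG 3)]/(regs s 3) r3.
by rewrite -[ev _ _ _ (EC 0)]/0 addn0.
Qed.

Lemma saturated U : pst w L D T V H s2 L [::] U -> static G w L D (mem s2) U ->
  exists fs, wstate G L D T V H (mem s2) s4 fs /\ closed G D T (mem s2) fs fs [::].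
Proof.
move=> p S; have I0 := start_main_spec p S.
have k0 : mem s2 0 = k by rewrite (pin p) //; rewrite /D /n; have := ltn_ord (start G); lia.
have [fs [h [todo [I hi]]]] := main_loop q LD S k0 VT HV V_Z T_Z kZ_T I0 (leqnn _).
have wb := work_bound LD S k0 VT HV V_Z T_Z kZ_T (ws_heap (li_w I)).
exists fs; split; first exact: (li_w I).
(* After as many active turns as the whole work can amount to, the popped facts account for all of
   it; a fact left over would need at least one turn more. *)
have [td eh] : todo = [::] /\ h = size fs.
  case: hi => // hi.
  have split_work : work L D (mem s2) U fs =
      work L D (mem s2) U (take h fs) + work L D (mem s2) U (drop h fs).
    by rewrite /work -big_cat cat_take_drop.
  have t0 : size todo = 0 by lia.
  split; first exact: size0nil.
  have := li_h I; rewrite leq_eqVlt => /orP[/eqP//|hlt].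
  move: split_work; rewrite (drop_nth (0, 0) hlt) {3}/work big_cons; lia.
by have := li_closed I; rewrite td eh take_size.
Qed.

Lemma answer_spec U : pst w L D T V H s2 L [::] U -> static G w L D (mem s2) U ->
  correct_answer P N G (den answer s4) /\ sok q Z answer s4.
Proof.
move=> p S; have [fs [W C]] := saturated p S; have hp := ws_heap W.
have L6 : 6 <= L by rewrite -L_eq leq_addr.
have D6 : L < D by rewrite /D /n; have := ltn_ord (start G); lia.
have low y : y < 6 -> mem s4 y = nth 0 w y.
  by move=> y6; rewrite (hp_static hp) ?(pin p) //; lia.
have [h0 h1 h2 h3 h4] := header.
have m4 : mem s4 4 = start G by rewrite low.
have eW acc v : ev q s4 [:: acc; v] (EM startW) = mem s4 (wc D (L + start G) v).
  rewrite -[LHS]/(mem s4 (ev q s4 [:: acc; v] startW)) ev_waddr (ws_1 W).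
  by rewrite -[ev _ _ _ (eadd _ _)]/(regs s4 0 + mem s4 4) (ws_0 W) m4.
have eS : ev q s4 [::] searchE =
    foldl (fun acc v => if mem s4 (wc D (L + start G) v) != 0
      then (if acceptb q s4 v then mem s4 (wc D (L + start G) v) else acc) else acc)
    0 (iota 0 V).
  rewrite -[LHS]/(foldl (fun acc v => if ev q s4 [:: acc; v] (EM startW) != 0 then
     (if ev q s4 [:: v; 0; 0] acceptE != 0 then ev q s4 [:: acc; v] (EM startW) else acc)
     else acc) 0 (iota 0 (regs s4 3))) (ws_3 W).
  by apply: eq_foldl => acc v; rewrite eW ev_accept nat_of_bool_neq0.
split; last first.
  apply: sok_seq; last exact: elf_ok.
  split; [exact: Logic.I|exact: Logic.I|by rewrite -[ev _ _ _ _]/(regs s4 3) (ws_3 W) V_Z|].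
  move=> j; rewrite -[ev _ _ _ _]/(regs s4 3) (ws_3 W) => jV.
  have jZ : j <= Z by apply: leq_trans (ltnW jV) V_Z.
  move: (acc_at _ _ _ _ _ _) => acc.
  have okW : eok q Z s4 [:: acc; j] (EM startW).
    by apply: ok_mem; apply: ok_waddr; [exact: elf_ok|exact: elf_ok|exact: jZ].
  apply: ok_if => [|_|_]; [exact: okW| |exact: elf_ok].
  apply: ok_if => [|_|_]; [|exact: okW|exact: elf_ok].
  apply: ok_call; [exact: elf_ok|exact: elf_ok|exact: elf_ok|].
  apply: ok_accept; first by rewrite !low // h1 h2 -/m m_Z.
  rewrite !low // h0 h1 h2 -/m lt0n => mn; split.
  - exact: two_Z.
  - exact: k_Z.
  - by rewrite (ws_2 W) T_Z.
  - exact: jZ.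
set r := ev q s4 [::] searchE in eS.
have sE : den answer s4 = setr (setr s4 1 r) 0 (0 < r).
  by rewrite /answer den_seq !den_set.
have AP phi := acceptbP (P := P) (N := N) (etrans (low 0 isT) h0)
  (etrans (low 1 isT) h1) (etrans (low 2 isT) h2) (ws_2 W) phi.
have LG : L + start G < D by rewrite /D /n ltn_add2l.
rewrite sE; case: (fold_find (fun v => mem s4 (wc D (L + start G) v)) (acceptb q s4) V);
  rewrite -eS => -[r0 hr].
  right; split; first by rewrite /= r0.
  move=> [phi [lp hP hN]].
  have f0 : (0, 0) \in fs by rewrite -(hp_0 hp) mem_nth // (hp_size hp).
  have pin' := complete_lang LD S f0 C lp.
  have vV := val_lt T phi.
  have := hr _ vV; rewrite (hp_w hp) // pin' => /(_ _)/negP; apply; first by move: L6 HD; lia.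
  by apply/AP.
left; split; first by rewrite /= lt0n r0.
have [v vV [Wv pv]] := hr.
have fin : (L + start G, v) \in fs.
  by move: Wv; rewrite (hp_w hp) //; case: ifP => // _ e; rewrite -e in r0.
have [|phi [st [vE _ dl]]] := hp_good hp fin; first by lia.
exists phi; split.
  rewrite -[regs _ 1]/r -[mem (setr _ _ _)]/(mem s4) -Wv (hp_w hp) // fin.
  exact: stored_in_stored st.
rewrite -vE in pv; have [hP hN] := (AP phi).1 pv.
by split=> //; apply/lang_der; exact: dl.
Qed.

(** Depends on the program alone and never has to be computed; a sum dominates all the depths at
    once. *)
Definition top_dep := sdep setup + sdep parse_body + sdep start_main + edep countE +
  sdep main_body + sdep answer.

Definition top_wt := swt setup + (swt parse_body + 18) + swt start_main +
  (ewt countE + 6 + 3 * (swt main_body + 10)) + swt answer.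

Lemma top_deps :
  [/\ sdep setup <= top_dep, sdep parse_body <= top_dep & sdep start_main <= top_dep]
  /\ [/\ edep countE <= top_dep, sdep main_body <= top_dep & sdep answer <= top_dep].
Proof.
rewrite /top_dep; move: (sdep setup) (sdep parse_body) (sdep start_main) (edep countE)
  (sdep main_body) (sdep answer) => *; split; split; lia.
Qed.

Lemma program_spec : correct_answer P N G (den program s0) /\
  scost q program s0 <= top_wt * Z ^ top_dep.+1 * D.
Proof.
have [U [p S]] := parsed_all.
have [se sok1] := setup_spec.
have I0 := start_main_spec p S.
have [ca sok5] := answer_spec p S.
have k0 : mem s2 0 = k by rewrite (pin p) //; rewrite /D /n; have := ltn_ord (start G); lia.
have W3 := li_w I0.
have cnt := count_spec (ws_1 W3) (ws_3 W3).
have dE : den program s0 = den answer s4.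
  rewrite /program den_seq se den_seq den_rep -[ev q s1 _ _]/L -/s2.
  by rewrite den_seq -/s3 den_seq den_rep cnt.
rewrite dE; split; first exact: ca.
have [[d1 d2 d3] [d4 d5 d6]] := top_deps.
have Z0 : 0 < Z by apply: leq_trans two_Z.
rewrite /program scost_seq se scost_seq den_rep -[ev q s1 _ _]/L -/s2.
rewrite scost_seq -/s3 scost_seq den_rep cnt -/s4.
have ok2 s : sok q Z parse_body s by exact: slf_ok.
have ok3 s : sok q Z start_main s by exact: slf_ok.
have C1 : scost q setup s0 <= swt setup * Z ^ top_dep by exact: (scost_bound Z0 sok1 d1).
have C2 : scost q (SRep (EG 0) parse_body) s1 <= 2 + 6 + L * (swt parse_body * Z ^ top_dep + 10).
  by apply: scost_rep => j _; exact: (scost_bound Z0 (ok2 _) d2).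
have C3 : scost q start_main s2 <= swt start_main * Z ^ top_dep.
  exact: (scost_bound Z0 (ok3 _) d3).
have C4 : scost q (SRep countE main_body) s3 <=
    ewt countE * Z ^ top_dep + 6 + V * (3 * D) * (swt main_body * Z ^ top_dep + 10).
  apply: (@leq_trans (ecost q s3 [::] countE + 6 + V * (3 * D) * (swt main_body * Z ^ top_dep + 10))).
    rewrite -cnt; apply: scost_rep => j; rewrite cnt => jN.
    have [fs [h [todo [I _]]]] := main_loop q LD S k0 VT HV V_Z T_Z kZ_T I0 (ltnW jN).
    have [ok _] := main_step q LD S k0 VT HV V_Z T_Z kZ_T I.
    exact: (scost_bound Z0 ok d5).
  rewrite !leq_add2r; apply: (ecost_bound Z0 _ d4).
  apply: ok_call; [exact: elf_ok|exact: elf_ok|exact: elf_ok|].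
  by apply: ok_mul; rewrite -[ev _ _ _ _]/(regs s3 3) (ws_3 W3) V_Z.
have C5 : scost q answer s4 <= swt answer * Z ^ top_dep by exact: (scost_bound Z0 sok5 d6).
have LD' : L <= D := leq_addr _ _.
have D0 : 0 < D by rewrite /D /n; have := ltn_ord (start G); lia.
have VZ := V_Z.
have y0 : 0 < Z ^ top_dep by rewrite expn_gt0 Z0.
rewrite expnS; exact: (cost_arith y0 LD' D0 VZ Z0 C1 C2 C3 C4 C5).
Qed.

(** A node is coded by at most three cells, and the six header cells are absorbed by the
    nonterminals, of which there is at least one, the start symbol. *)
Lemma D_size : D <= 9 * grammar_size G.
Proof.
have szt (t : term k 'I_(nnt G)) : size (code_term t) <= 3 * term_size t.
  by elim: t => //= [t IH|t1 IH1 t2 IH2|t1 IH1 t2 IH2|i t IH|i t IH]; rewrite ?size_cat; lia.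
have szc : size (codes (rules G)) <= 3 * \sum_(r <- rules G) (term_size r.2).+1.
  rewrite /codes; elim: (rules G) => [|r rs IH]; first by rewrite big_nil.
  rewrite big_cons /= size_cat; have := szt r.2; lia.
rewrite /D /grammar_size -L_eq -/n; have : 0 < n by rewrite /n; have := ltn_ord (start G); lia.
by move: szc; move: (size _) (\sum_(_ <- _) _) => *; lia.
Qed.

End Run.

Theorem theorem8p1 :
  exists (prog : cmd) (C : nat) (p : {poly nat}),
  forall (k : nat) (P N : seq (k.-tuple rat)) (G : grammar k),
  uniq P -> uniq N ->
  exists (s : state) (t : nat),
    [/\ exec (rat_tape P N) prog (init_state (code_input P N G)) s t,
        t <= C * 2 ^ p.[((size P + size N) * k ^ k)%N]%R * grammar_size G
      & correct_answer P N G s].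
Proof.
(* With d = [top_dep.+1] the polynomial is d x + d, because [Z ^ d] is 2 to the power (x + 1) d at x
   = m k^k. The 9 is that of [D_size]. *)
exists (scomp nglob program), (9 * top_wt), (Poly [:: top_dep.+1; top_dep.+1]).
move=> k P N G _ _; set q := rat_tape P N; set s0 := init_state _.
have [ca cost] := program_spec P N G; rewrite -/q -/s0 in ca cost.
have [|s [t [ex tle [m r] _]]] := scomp_correct q program_wf (leqnn nglob) (s := s0) (s0 := s0).
  by split.
exists s, t; split=> //; last first.
  by move: ca; rewrite /correct_answer m !r.
apply: leq_trans tle (leq_trans cost _).
have -> : (Poly [:: top_dep.+1; top_dep.+1]).[((size P + size N) * k ^ k)%N]%R =
    ((size P + size N) * k ^ k).+1 * top_dep.+1.
  rewrite horner_Poly /=; move: top_dep.+1 (_ * k ^ k) => d x.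
  by rewrite GRing.mul0r GRing.add0r -[LHS]/(d * x + d) mulSn addnC mulnC.
rewrite -expnM; have := D_size P N G.
move: (2 ^ _) (size _ + _) (top_wt) => y x wt h.
rewrite [9 * wt]mulnC -!mulnA [9 * _]mulnCA; apply: leq_mul => //.
by apply: leq_mul.
Qed.
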